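(* Let $0<a<\infty$, $I=(-a,a)$, $q\in C^\infty(I)$. Let $\mathbf{T}:\mathcal{D}'(I)\to\mathcal{D}'(I)$ be the operator defined by $\langle\mathbf{T}u,\phi\rangle=\langle u,\mathbf{T}^\square\phi\rangle$ for $u\in\mathcal{D}'(I)$, $\phi\in C_c^\infty(I)$, where $$\mathbf{T}^\square\psi(x)=\psi(x)-\int_{-a}^{-|x|}K(t,x)\psi(t)\,dt+\int_{|x|}^{a}K(t,x)\psi(t)\,dt .$$ Then a continuous linear operator $\mathcal{T}:\mathcal{D}'(I)\to\mathcal{D}'(I)$ is a standard transmutation operator on $\mathcal{D}'(I)$ if and only if $\mathcal{T}$ is a linear combination (with complex coefficients) of the operators $$\mathbf{T}P_+,\quad\mathbf{T}P_-,\quad\mathbf{T}AP_+,\quad\mathbf{T}\frac{d}{dx}P_- .$$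
   Context: All functions are complex valued; $\mathbb{N}_0=\{0,1,2,\dots\}$. $\mathcal{D}'(I)$ is the space of distributions on $I$, with pointwise convergence: $u_n\to u$ iff $\langle u_n,\phi\rangle\to\langle u,\phi\rangle$ for all $\phi\in C_c^\infty(I)$. Derivatives are distributional and $\langle qu,\phi\rangle=\langle u,q\phi\rangle$. The kernel $K$: let $H$ be the unique continuous solution of $H(u,v)=\frac12\int_0^uq(s)\,ds+\int_0^u\int_0^vq(\alpha+\beta)H(\alpha,\beta)\,d\beta\,d\alpha$ on $\{(u,v):|u|+|v|<a\}$, and $K(x,t)=H\left(\frac{x+t}2,\frac{x-t}2\right)$ for $(x,t)\in I\times I$. For $u\in L^1_{loc}(I)$, $\mathbf{T}u(x)=u(x)+\int_{-x}^xK(x,t)u(t)\,dt$. On $L^1_{loc}(I)$, $P_\pm u(x)=\frac{u(x)\pm u(-x)}2$ and $Au(x)=\int_0^xu(t)\,dt$. They are extended to $\mathcal{D}'(I)$ by transposition: $\langle P_\pm u,\phi\rangle=\langle u,P_\pm\phi\rangle$ and $\langle AP_+u,\phi\rangle=\langle u,A^\square P_-\phi\rangle$, where $A^\square\psi(x)=-\int_{-a}^x\psi(t)\,dt$ for $-a\le x\le0$ and $A^\square\psi(x)=\int_x^a\psi(t)\,dt$ for $0<x\le a$ ($A^\square P_-$ maps $C_c^\infty(I)$ continuously into itself). A linear operator $\mathcal{T}$ is a transmutation operator on $\mathcal{D}'(I)$ if $\left(\frac{d^2}{dx^2}-q\right)\mathcal{T}u=\mathcal{T}\frac{d^2}{dx^2}u$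 in $\mathcal{D}'(I)$ for all $u\in\mathcal{D}'(I)$. In that case $\varphi_k:=\mathcal{T}[x^k]\in C^\infty(I)$ for all $k\in\mathbb{N}_0$, and $\mathcal{T}$ is called standard if $\varphi_k(0)=\varphi_k'(0)=0$ for all $k\ge2$. *)

(* Defs.v *)
From Stdlib Require Import Reals Lra Lia.
From Stdlib Require Import ClassicalEpsilon FunctionalExtensionality ProofIrrelevance.
From Coquelicot Require Import Coquelicot.
Set Implicit Arguments.
Unset Strict Implicit.
Open Scope R_scope.

(* Stdlib reals with Coquelicot.

   Functions on I = (-a, a) are total functions [R -> C]; their values outside I
   are irrelevant.  Test functions on I are extended by zero to R. *)

Definition interval (a x : R) : Prop := - a < x < a.

Definition nderiv (k : nat) (f : R -> C) (x : R) : C :=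
  (Derive_n (fun t => Re (f t)) k x, Derive_n (fun t => Im (f t)) k x).

Definition smooth_on (D : R -> Prop) (f : R -> C) : Prop :=
  forall (k : nat) (x : R), D x ->
    ex_derive_n (fun t => Re (f t)) k x /\ ex_derive_n (fun t => Im (f t)) k x.

Definition CInt (f : R -> C) (x y : R) : C := RInt (V := C_R_CompleteNormedModule) f x y.

Definition supported_in (b : R) (f : R -> C) : Prop :=
  forall x : R, b < Rabs x -> f x = RtoC 0.

Definition is_test (a : R) (f : R -> C) : Prop :=
  smooth_on (fun _ => True) f /\ exists b : R, b < a /\ supported_in b f.

Record test (a : R) : Type := Test { test_fun :> R -> C; testP : is_test a test_fun }.

Lemma is_derive_comb (p q : R) (A B G : R -> R) (x : R) :
  ex_derive A x -> ex_derive B x -> ex_derive G x ->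
  is_derive (fun t => p * A t + q * B t + G t) x
    (p * Derive A x + q * Derive B x + Derive G x).
Proof.
intros hA hB hG.
exact (is_derive_plus _ _ _ _ _
  (is_derive_plus _ _ _ _ _ (is_derive_scal _ _ p _ (Derive_correct _ _ hA))
                            (is_derive_scal _ _ q _ (Derive_correct _ _ hB)))
  (Derive_correct _ _ hG)).
Qed.

Lemma nderiv_lin (c : C) (f g : R -> C) (hf : smooth_on (fun _ => True) f)
  (hg : smooth_on (fun _ => True) g) (k : nat) (x : R) :
  nderiv k (fun t => (c * f t + g t)%C) x = (c * nderiv k f x + nderiv k g x)%C
  /\ ex_derive_n (fun t => Re (c * f t + g t)%C) k x
  /\ ex_derive_n (fun t => Im (c * f t + g t)%C) k x.
Proof.
revert x; induction k as [|k IH]; intros x.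
- now repeat split.
- assert (e1 : forall y, Derive_n (fun t => Re (c * f t + g t)%C) k y =
      Re c * Derive_n (fun t => Re (f t)) k y + - Im c * Derive_n (fun t => Im (f t)) k y
      + Derive_n (fun t => Re (g t)) k y).
  { intros y; destruct (IH y) as [e _]; rewrite <- Ropp_mult_distr_l; exact (f_equal fst e). }
  assert (e2 : forall y, Derive_n (fun t => Im (c * f t + g t)%C) k y =
      Re c * Derive_n (fun t => Im (f t)) k y + Im c * Derive_n (fun t => Re (f t)) k y
      + Derive_n (fun t => Im (g t)) k y).
  { intros y; destruct (IH y) as [e _]; exact (f_equal snd e). }
  destruct (hf (S k) x I) as [fr fi], (hg (S k) x I) as [gr gi].
  simpl in fr, fi, gr, gi.
  assert (d1 := is_derive_comb (Re c) (- Im c) fr fi gr).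
  assert (d2 := is_derive_comb (Re c) (Im c) fi fr gi).
  apply (is_derive_ext _ _ _ _ (fun y => eq_sym (e1 y))) in d1.
  apply (is_derive_ext _ _ _ _ (fun y => eq_sym (e2 y))) in d2.
  split; [|split; simpl; eexists; eassumption].
  apply injective_projections.
  + refine (eq_trans (is_derive_unique _ _ _ d1) _).
    rewrite <- Ropp_mult_distr_l; reflexivity.
  + exact (is_derive_unique _ _ _ d2).
Qed.

Lemma is_test_lin (a : R) (c : C) (f g : test a) : is_test a (fun x => (c * f x + g x)%C).
Proof.
destruct (testP f) as [sf [b [hb zf]]], (testP g) as [sg [b' [hb' zg]]].
split; [intros k x _; apply nderiv_lin; assumption|].
exists (Rmax b b'); split; [now apply Rmax_lub_lt|].
intros x hx.
rewrite zf, zg; [ring| |]; eapply Rle_lt_trans; [|eassumption| |eassumption].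
- apply Rmax_r.
- apply Rmax_l.
Qed.

Lemma is_test_zero (a : R) : is_test a (fun _ => RtoC 0).
Proof.
split.
- intros k x _; split; apply ex_derive_n_const.
- exists (a - 1); split; [lra|now intros x _].
Qed.

Definition test_lin (a : R) (c : C) (f g : test a) : test a := Test (is_test_lin c f g).
Definition test_zero (a : R) : test a := Test (is_test_zero a).

Definition test_of (a : R) (f : R -> C) : test a :=
  match excluded_middle_informative (is_test a f) with
  | left h => Test h
  | right _ => test_zero a
  end.

Lemma test_ofE (a : R) (f : R -> C) : is_test a f -> forall x, test_of a f x = f x.
Proof.
intros h x; unfold test_of.
now destruct (excluded_middle_informative _).
Qed.

Definition test_cv (a : R) (f : nat -> test a) (g : test a) : Prop :=
  (exists b : R, b < a /\ supported_in b g /\ forall n, supported_in b (f n)) /\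
  forall (k : nat) (eps : R), 0 < eps ->
    exists N : nat, forall n : nat, (N <= n)%nat ->
      forall x : R, Cmod (nderiv k (f n) x - nderiv k g x)%C < eps.

Definition cv (z : nat -> C) (l : C) : Prop := filterlim z eventually (locally l).

(* On C_c^oo(I) (a strict inductive limit of Frechet spaces) a linear functional
   is continuous as soon as it is sequentially continuous. *)
Definition is_distr (a : R) (u : test a -> C) : Prop :=
  (forall (c : C) (f g : test a), u (test_lin c f g) = (c * u f + u g)%C) /\
  (forall (f : nat -> test a) (g : test a), test_cv f g -> cv (fun n => u (f n)) (u g)).

Record distribution (a : R) : Type :=
  Distribution { distr_fun :> test a -> C; distrP : is_distr distr_fun }.

Lemma distr_ext (a : R) (u v : distribution a) : (forall f, u f = v f) -> u = v.
Proof.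
destruct u as [u hu], v as [v hv]; simpl; intros e.
assert (e' : u = v) by now apply functional_extensionality.
subst v; f_equal; apply proof_irrelevance.
Qed.

Lemma is_distr_lin (a : R) (c : C) (u v : distribution a) :
  is_distr (fun f => (c * u f + v f)%C).
Proof.
split.
- intros d f g; rewrite (proj1 (distrP u)), (proj1 (distrP v)); ring.
- intros f g h.
  apply (filterlim_comp_2 (F := eventually) (G := locally (c * u g)%C) (H := locally (v g))
           (fun n => (c * u (f n))%C) (fun n => v (f n)) Cplus).
  + apply (filterlim_comp _ _ _ (fun n => u (f n)) (Cmult c) _ (locally (u g)));
      [now apply (proj2 (distrP u))|].
    apply (filterlim_scal_r (K := C_AbsRing) (V := C_NormedModule) c (u g)).
  + now apply (proj2 (distrP v)).
  + apply (filterlim_plus (K := C_AbsRing) (V := C_NormedModule)).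
Qed.

Lemma is_distr_zero (a : R) : is_distr (fun _ : test a => RtoC 0).
Proof.
split; [intros; ring|intros; apply filterlim_const].
Qed.

Definition distr_lin (a : R) (c : C) (u v : distribution a) : distribution a :=
  Distribution (is_distr_lin c u v).
Definition distr_zero (a : R) : distribution a := Distribution (is_distr_zero a).
Definition distr_add (a : R) (u v : distribution a) : distribution a := distr_lin (RtoC 1) u v.
Definition distr_scal (a : R) (c : C) (u : distribution a) : distribution a :=
  distr_lin c u (distr_zero a).
Definition distr_sub (a : R) (u v : distribution a) : distribution a :=
  distr_lin (RtoC (-1)) v u.

Definition distr_of (a : R) (u : test a -> C) : distribution a :=
  match excluded_middle_informative (is_distr u) with
  | left h => Distribution h
  | right _ => distr_zero a
  end.

Lemma distr_ofE (a : R) (u : test a -> C) : is_distr u -> forall f, distr_of u f = u f.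
Proof.
intros h f; unfold distr_of.
now destruct (excluded_middle_informative _).
Qed.

Definition distr_cv (a : R) (u : nat -> distribution a) (v : distribution a) : Prop :=
  forall f : test a, cv (fun n => u n f) (v f).

Definition regular (a : R) (g : R -> C) : distribution a :=
  distr_of (fun f : test a => CInt (fun x => (g x * f x)%C) (- a) a).

(* <transpose S u, f> = <u, S f> for S a continuous linear map of C_c^oo(I) into
   itself; every S to which this is applied below is one, so the default values
   of [test_of] and [distr_of] are never reached. *)
Definition transpose (a : R) (S : (R -> C) -> R -> C) (u : distribution a) : distribution a :=
  distr_of (fun f : test a => u (test_of a (S f))).

Lemma transposeE (a : R) (S : (R -> C) -> R -> C) (u : distribution a) :
  (forall f : test a, is_test a (S f)) ->
  is_distr (fun f : test a => u (test_of a (S f))) ->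
  forall f g : test a, (forall x, g x = S f x) -> transpose S u f = u g.
Proof.
intros hS hd f g e; unfold transpose; rewrite distr_ofE by assumption.
f_equal; unfold test_of.
destruct (excluded_middle_informative _) as [h|h]; [|now destruct (h (hS f))].
destruct g as [g hg]; simpl in e.
assert (e' : g = S f) by now apply functional_extensionality.
subst g; f_equal; apply proof_irrelevance.
Qed.

Definition dderiv (a : R) : distribution a -> distribution a :=
  transpose (fun f x => (- nderiv 1 f x)%C).

Definition dmul (a : R) (q : R -> C) : distribution a -> distribution a :=
  transpose (fun f x => (q x * f x)%C).

Definition even_part (f : R -> C) (x : R) : C := ((f x + f (- x)%R) / RtoC 2)%C.
Definition odd_part (f : R -> C) (x : R) : C := ((f x - f (- x)%R) / RtoC 2)%C.

Definition Asq (a : R) (f : R -> C) (x : R) : C :=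
  if Rle_dec x 0 then (- CInt f (- a) x)%C else CInt f x a.

Definition P_even (a : R) : distribution a -> distribution a := transpose even_part.
Definition P_odd (a : R) : distribution a -> distribution a := transpose odd_part.
(* <AP_+ u, f> = <u, A^square P_- f>, with A^square = Asq a. *)
Definition AP_even (a : R) : distribution a -> distribution a :=
  transpose (fun f => Asq a (odd_part f)).

(* H is determined by this only on |u| + |v| < a, i.e. [kernel H] only on I x I. *)
Definition goursat_solution (a : R) (q : R -> C) (H : R -> R -> C) : Prop :=
  forall u v : R, Rabs u + Rabs v < a ->
    continuous (fun p : R * R => H (fst p) (snd p)) (u, v) /\
    H u v = (CInt q 0 u / RtoC 2
             + CInt (fun al => CInt (fun be => q (al + be)%R * H al be) 0 v) 0 u)%C.

Definition kernel (H : R -> R -> C) (x t : R) : C := H ((x + t) / 2) ((x - t) / 2).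

Definition Tsq (a : R) (K : R -> R -> C) (f : R -> C) (x : R) : C :=
  (f x - CInt (fun t => K t x * f t) (- a) (- Rabs x)
       + CInt (fun t => K t x * f t) (Rabs x) a)%C.

Definition T_op (a : R) (K : R -> R -> C) : distribution a -> distribution a :=
  transpose (Tsq a K).

Definition linear_op (a : R) (F : distribution a -> distribution a) : Prop :=
  forall (c : C) (u v : distribution a), F (distr_lin c u v) = distr_lin c (F u) (F v).

Definition continuous_op (a : R) (F : distribution a -> distribution a) : Prop :=
  forall (u : nat -> distribution a) (v : distribution a),
    distr_cv u v -> distr_cv (fun n => F (u n)) (F v).

Definition transmutation (a : R) (q : R -> C) (F : distribution a -> distribution a) : Prop :=
  linear_op F /\
  forall u : distribution a,
    distr_sub (dderiv (dderiv (F u))) (dmul q (F u)) = F (dderiv (dderiv u)).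

Definition monomial (a : R) (k : nat) : distribution a := regular a (fun x => RtoC (x ^ k)).

Definition standard (a : R) (F : distribution a -> distribution a) : Prop :=
  forall k : nat, (2 <= k)%nat ->
    exists phi : R -> C,
      smooth_on (interval a) phi /\ F (monomial a k) = regular a phi /\
      phi 0 = RtoC 0 /\ nderiv 1 phi 0 = RtoC 0.

(* Main.v *)
Require Import Defs.
From Stdlib Require Import Reals.
From Coquelicot Require Import Coquelicot.
From Stdlib Require Import Lra Lia.
From Stdlib Require Import FunctionalExtensionality ProofIrrelevance ClassicalEpsilon.
Open Scope R_scope.

(** Why the theorem holds.

    A transmutation F sends x^k to a solution of y'' - q y = k(k-1) F(x^(k-2)). For k >= 2 the
    standard condition prescribes zero Cauchy data at 0, so all the F(x^k) are determined by
    F(1) and F(x), two solutions of y'' = q y, hence by four numbers. A combination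
    G = T (c1 P_+ + c2 P_- + c3 A P_+ + c4 (d/dx) P_-) is a standard transmutation for which
    G(1) = c1 T(1) + c3 T(x) and G(x) = c4 T(1) + c2 T(x), where T(1) and T(x) are the
    solutions with Cauchy data (1, 0) and (0, 1). Thus the coefficients can be chosen so that
    F and G agree on polynomials, and polynomials are dense in the distributions
    ([op_eq_of_monomials]). This needs four ingredients.

    On functions of class C^2, (T g)'' - q T g = T(g'') ([dTfun_derive]). In characteristic
    coordinates the integral part of T g is an integral along the segment u + v = x.
    Differentiating once with v fixed and once with u fixed produces only Hu, Hv and
    d(Hu)/dv = q(u+v) H, and the Goursat equation gives all three.

    The transposed operator maps test functions to test functions, continuously
    ([good_Tsq]). Interchanging the order of integration ([Tsq_dual]) and Green's formula turn
    the classical property into a weak form of (T^t f)'' = T^t(f'' - q f). A comparison of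
    T^t f with the second primitive of the right-hand side makes this equality classical
    ([Tsq_second_primitive]). Since f'' - q f is a test function again, smoothness and uniform
    estimates of all derivatives follow by repeated use of this equality.

    Distributional solutions of u'' = q u are combinations of T(1) and T(x)
    ([distr_solution]): a test function whose moments against these two vanish is
    psi'' - q psi for a test function psi, by variation of constants.

    For the density of polynomials, a distribution chi u with a compactly supported factor is
    convolved with the Landau kernels, which are polynomials; on the side of test functions
    this is chi (L_n * f), which converges to chi f with all derivatives ([poly_approx]).
    Letting chi exhaust I reaches every distribution. *)

(** * Parameter integrals of real functions *)

Lemma continuity_2d_pt_comp (f g h : R -> R -> R) (x y : R) :
  continuity_2d_pt f (g x y) (h x y) ->
  continuity_2d_pt g x y -> continuity_2d_pt h x y ->
  continuity_2d_pt (fun u v => f (g u v) (h u v)) x y.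
Proof.
intros hf hg hh eps.
destruct (hf eps) as [d hd], (hg d) as [d1 h1], (hh d) as [d2 h2].
assert (p : 0 < Rmin d1 d2) by (apply Rmin_case; apply cond_pos).
exists (mkposreal _ p); simpl; intros u v hu hv.
apply hd; [apply h1|apply h2]; eapply Rlt_le_trans; try eassumption;
  auto using Rmin_l, Rmin_r.
Qed.

Lemma continuity_2d_pt_comp1 (f : R -> R) (g : R -> R -> R) (x y : R) :
  continuous f (g x y) -> continuity_2d_pt g x y ->
  continuity_2d_pt (fun u v => f (g u v)) x y.
Proof.
intros hf hg; apply continuity_1d_2d_pt_comp; [|exact hg].
now apply continuity_pt_filterlim.
Qed.

Lemma continuity_2d_pt_slice (f : R -> R -> R) (x y : R) :
  continuity_2d_pt f x y -> continuous (f x) y.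
Proof.
intros h; apply continuity_pt_filterlim; intros eps he.
destruct (h (mkposreal eps he)) as [d hd].
exists d; split; [apply cond_pos|]; intros z [_ hz]; apply hd; [|exact hz].
rewrite Rminus_diag, Rabs_R0; apply cond_pos.
Qed.

Ltac cont2_affine :=
  repeat (apply continuity_2d_pt_plus || apply continuity_2d_pt_minus
          || apply continuity_2d_pt_mult || apply continuity_2d_pt_opp
          || apply continuity_2d_pt_id1 || apply continuity_2d_pt_id2
          || apply continuity_2d_pt_const).

Lemma ex_RInt_cont (f : R -> R) (a b : R) :
  (forall z, Rmin a b <= z <= Rmax a b -> continuous f z) -> ex_RInt f a b.
Proof. exact (ex_RInt_continuous (V := R_CompleteNormedModule) f a b). Qed.

Lemma RInt_bound (f : R -> R) (a b M : R) :
  (forall z, Rmin a b <= z <= Rmax a b -> continuous f z) ->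
  (forall z, Rmin a b <= z <= Rmax a b -> Rabs (f z) <= M) ->
  Rabs (RInt f a b) <= M * Rabs (b - a).
Proof.
intros hc hM; destruct (Rle_dec a b) as [h|h].
- rewrite Rmin_left, Rmax_right in hc, hM by lra.
  rewrite (Rabs_right (b - a)), Rmult_comm by lra.
  apply abs_RInt_le_const; auto.
  apply ex_RInt_cont; rewrite Rmin_left, Rmax_right by lra; auto.
- rewrite Rmin_right, Rmax_left in hc, hM by lra.
  rewrite <- opp_RInt_swap; [|apply ex_RInt_cont; rewrite Rmin_left, Rmax_right by lra; auto].
  change (Rabs (- RInt f b a) <= M * Rabs (b - a)).
  rewrite Rabs_Ropp, (Rabs_left (b - a)), Rmult_comm by lra.
  replace (- (b - a)) with (a - b) by ring.
  apply abs_RInt_le_const; auto; [lra|].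
  apply ex_RInt_cont; rewrite Rmin_left, Rmax_right by lra; auto.
Qed.

Lemma is_derive_RInt_upper (f : R -> R) (c x l r : R) :
  (forall z, l < z < r -> continuous f z) -> l < c < r -> l < x < r ->
  is_derive (fun y => RInt f c y) x (f x).
Proof.
intros hf hc hx.
apply (is_derive_RInt (V := R_NormedModule) f _ c); [|now apply hf].
assert (p : 0 < Rmin (x - l) (r - x)) by (apply Rmin_case; lra).
exists (mkposreal _ p); intros y hy.
apply (RInt_correct (V := R_CompleteNormedModule)).
apply ex_RInt_cont; intros z hz; apply hf.
change (Rabs (y - x) < Rmin (x - l) (r - x)) in hy.
apply Rabs_def2 in hy.
assert (h1 := Rmin_l (x - l) (r - x)); assert (h2 := Rmin_r (x - l) (r - x)).
revert hz; unfold Rmin, Rmax; destruct (Rle_dec c y); lra.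
Qed.

Section Tube.

Variables (G : R -> R -> R) (c x0 y0 r : R).
Hypothesis r_pos : 0 < r.
(** The integrands below are controlled only on a diamond, so the rules ask for
    hypotheses near the segment of integration and for parameters close to [x0]. *)
Definition in_tube (x t : R) : Prop :=
  Rabs (x - x0) < r /\ Rmin c y0 - r < t < Rmax c y0 + r.

(** Uniform continuity on the compact core of the tube takes care of the parameter, the
    fundamental theorem of the end point. *)
Lemma continuity_2d_pt_RInt :
  (forall x t, in_tube x t -> continuity_2d_pt G x t) ->
  continuity_2d_pt (fun x y => RInt (G x) c y) x0 y0.
Proof.
intros hG eps.
set (m := Rmin c y0 - r / 2); set (M := Rmax c y0 + r / 2).
assert (hm1 := Rmin_l c y0); assert (hm2 := Rmin_r c y0).
assert (hM1 := Rmax_l c y0); assert (hM2 := Rmax_r c y0).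
assert (hmM : 0 < M - m) by (unfold m, M; lra).
assert (hx0 : Rabs (x0 - x0) < r) by (rewrite Rminus_diag, Rabs_R0; lra).
assert (he : 0 < eps / 2 / (M - m + 1)).
{ apply Rdiv_lt_0_compat; [|lra]; destruct eps as [e pe]; simpl; lra. }
destruct (uniform_continuity_2d_1d' G m M x0) with (eps := mkposreal _ he) as [d hd].
{ intros t ht; apply hG; split; [exact hx0|unfold m, M in ht; lra]. }
assert (hcy : continuous (fun y => RInt (G x0) c y) y0).
{ apply (ex_derive_continuous (K := R_AbsRing) (V := R_NormedModule)).
  eexists; apply (is_derive_RInt_upper (G x0) c y0 (Rmin c y0 - r) (Rmax c y0 + r)); try lra.
  intros z hz; apply continuity_2d_pt_slice, hG; split; [exact hx0|lra]. }
apply continuity_pt_filterlim in hcy.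
destruct (hcy (eps / 2)) as [d2 [hd2 hcy2]]; [destruct eps; simpl; lra|].
assert (p : 0 < Rmin (Rmin (d / 2) d2) (r / 2)).
{ assert (hd' := cond_pos d); repeat apply Rmin_case; lra. }
exists (mkposreal _ p); simpl; intros x y hx hy.
assert (hx1 : Rabs (x - x0) < d / 2 /\ Rabs (x - x0) < r / 2).
{ split; eapply Rlt_le_trans; try exact hx.
  - eapply Rle_trans; apply Rmin_l.
  - apply Rmin_r. }
assert (hy1 : Rabs (y - y0) < d2 /\ Rabs (y - y0) < r / 2).
{ split; eapply Rlt_le_trans; try exact hy.
  - eapply Rle_trans; [apply Rmin_l|apply Rmin_r].
  - apply Rmin_r. }
destruct hx1 as [hx1 hx2], hy1 as [hy1 hy2].
assert (hcyr : forall z, Rmin c y <= z <= Rmax c y -> m <= z <= M).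
{ intros z hz; apply Rabs_def2 in hy2; unfold m, M.
  revert hz; unfold Rmin at 1, Rmax at 1; destruct (Rle_dec c y); lra. }
assert (hcx : forall z, Rmin c y <= z <= Rmax c y -> continuous (G x) z).
{ intros z hz; apply continuity_2d_pt_slice, hG; split; [lra|].
  apply hcyr in hz; unfold m, M in hz; lra. }
assert (hcx0 : forall z, Rmin c y <= z <= Rmax c y -> continuous (G x0) z).
{ intros z hz; apply continuity_2d_pt_slice, hG; split; [lra|].
  apply hcyr in hz; unfold m, M in hz; lra. }
assert (e1 : Rabs (RInt (G x) c y - RInt (G x0) c y) < eps / 2).
{ assert (ei : RInt (fun t => G x t - G x0 t) c y = RInt (G x) c y - RInt (G x0) c y).
  { apply (RInt_minus (V := R_CompleteNormedModule)); apply ex_RInt_cont; auto. }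
  rewrite <- ei.
  eapply Rle_lt_trans; [apply RInt_bound with (M := eps / 2 / (M - m + 1))|].
  - intros z hz; apply (continuous_minus (V := R_NormedModule)); auto.
  - intros z hz; left; apply (hd z x0 z x); try (apply hcyr; assumption).
    + assert (hd' := cond_pos d); lra.
    + apply Rabs_def2 in hx1; lra.
    + rewrite Rminus_diag, Rabs_R0; apply cond_pos.
  - assert (hb : Rabs (y - c) <= M - m).
    { destruct (hcyr c) as [h1 h2]; [split; [apply Rmin_l|apply Rmax_l]|].
      destruct (hcyr y) as [h3 h4]; [split; [apply Rmin_r|apply Rmax_r]|].
      apply Rabs_le; lra. }
    apply Rle_lt_trans with (eps / 2 / (M - m + 1) * (M - m)).
    + apply Rmult_le_compat_l; [lra|exact hb].
    + replace (eps / 2) with (eps / 2 / (M - m + 1) * (M - m + 1)) at 2 by (field; lra).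
      apply Rmult_lt_compat_l; lra. }
assert (e2 : Rabs (RInt (G x0) c y - RInt (G x0) c y0) < eps / 2).
{ destruct (Req_dec y y0) as [->|hne].
  - rewrite Rminus_diag, Rabs_R0; destruct eps; simpl; lra.
  - apply (hcy2 y); split; [split; [exact Logic.I|congruence]|exact hy1]. }
replace (RInt (G x) c y - RInt (G x0) c y0) with
  ((RInt (G x) c y - RInt (G x0) c y) + (RInt (G x0) c y - RInt (G x0) c y0)) by ring.
eapply Rle_lt_trans; [apply Rabs_triang|lra].
Qed.

(** The general rule wants data on both sides of the moving end point; the tube reaches
    beyond it. *)
Lemma is_derive_RInt_tube (Gx : R -> R -> R) (b : R -> R) (db : R) :
  (forall x t, in_tube x t -> is_derive (fun z => G z t) x (Gx x t)) ->
  (forall x t, in_tube x t -> continuity_2d_pt Gx x t) ->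
  (forall x t, in_tube x t -> continuous (G x) t) ->
  b x0 = y0 -> is_derive b x0 db ->
  is_derive (fun x => RInt (G x) c (b x)) x0 (RInt (Gx x0) c y0 + G x0 y0 * db).
Proof.
intros hd hc hG hb hdb.
assert (hm1 := Rmin_l c y0); assert (hm2 := Rmin_r c y0).
assert (hM1 := Rmax_l c y0); assert (hM2 := Rmax_r c y0).
assert (hx0 : Rabs (x0 - x0) < r) by (rewrite Rminus_diag, Rabs_R0; lra).
assert (hD : forall x t, in_tube x t -> Derive (fun z => G z t) x = Gx x t).
{ intros x t h; apply is_derive_unique, hd, h. }
assert (hcD : forall x t, in_tube x t ->
  continuity_2d_pt (fun u v => Derive (fun z => G z v) u) x t).
{ intros x t h; apply continuity_2d_pt_ext_loc with Gx; [|apply hc, h].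
  destruct h as [h1 h2].
  assert (p : 0 < Rmin (r - Rabs (x - x0))
                 (Rmin (t - (Rmin c y0 - r)) (Rmax c y0 + r - t))).
  { repeat apply Rmin_glb_lt; lra. }
  exists (mkposreal _ p); simpl; intros u v hu hv; symmetry; apply hD.
  assert (q1 := Rmin_l (r - Rabs (x - x0)) (Rmin (t - (Rmin c y0 - r)) (Rmax c y0 + r - t))).
  assert (q2 := Rmin_r (r - Rabs (x - x0)) (Rmin (t - (Rmin c y0 - r)) (Rmax c y0 + r - t))).
  assert (q3 := Rmin_l (t - (Rmin c y0 - r)) (Rmax c y0 + r - t)).
  assert (q4 := Rmin_r (t - (Rmin c y0 - r)) (Rmax c y0 + r - t)).
  split.
  - replace (u - x0) with ((u - x) + (x - x0)) by ring.
    eapply Rle_lt_trans; [apply Rabs_triang|lra].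
  - assert (hv' : Rabs (v - t) < Rmin (t - (Rmin c y0 - r)) (Rmax c y0 + r - t)) by lra.
    apply Rabs_def2 in hv'; lra. }
assert (hex : forall y, ball x0 r y -> forall s t,
   Rmin c y0 - r < s < Rmax c y0 + r -> Rmin c y0 - r < t < Rmax c y0 + r ->
   ex_RInt (G y) s t).
{ intros y hy s t hs ht; apply ex_RInt_cont; intros z hz; apply hG; split; [exact hy|].
  revert hz; unfold Rmin at 1, Rmax at 1; destruct (Rle_dec s t); lra. }
replace (RInt (Gx x0) c y0 + G x0 y0 * db) with
  (RInt (fun t => Derive (fun u => G u t) x0) c (b x0) + G x0 (b x0) * db).
- apply is_derive_RInt_param_bound_comp_aux3; rewrite ?hb.
  + exists (mkposreal r r_pos); intros y hy; apply hex; auto; lra.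
  + assert (p : 0 < r / 2) by lra.
    exists (mkposreal _ p), (mkposreal r r_pos); simpl; intros y hy; apply hex; auto; lra.
  + exact hdb.
  + assert (p : 0 < r / 2) by lra.
    exists (mkposreal _ p), (mkposreal r r_pos); simpl; intros y hy t ht.
    exists (Gx y t); apply hd; split; [exact hy|].
    revert ht; unfold Rmin, Rmax; repeat destruct Rle_dec; lra.
  + intros t ht; apply hcD; split; [exact hx0|lra].
  + assert (p : 0 < r) by lra.
    exists (mkposreal _ p); simpl; intros u v hu hv; apply hcD; split; [exact hu|].
    apply Rabs_def2 in hv; lra.
  + apply continuity_pt_filterlim, hG; split; [exact hx0|lra].
- rewrite hb; f_equal; apply RInt_ext; intros t ht; apply hD; split; [exact hx0|lra].
Qed.

End Tube.

(** * Calculus of complex valued functions of a real variable *)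

(** [nderiv] is taken componentwise; continuity, derivatives and integrals are too, so that
    each rule below comes from the rule for real functions. *)
Definition ccont (f : R -> C) (x : R) : Prop :=
  continuous (fun t => Re (f t)) x /\ continuous (fun t => Im (f t)) x.

Definition ccont2 (F : R -> R -> C) (x y : R) : Prop :=
  continuity_2d_pt (fun u v => Re (F u v)) x y /\
  continuity_2d_pt (fun u v => Im (F u v)) x y.

Definition is_cderive (f : R -> C) (x : R) (l : C) : Prop :=
  is_derive (fun t => Re (f t)) x (Re l) /\ is_derive (fun t => Im (f t)) x (Im l).

Definition RI (f : R -> C) (a b : R) : C :=
  (RInt (fun t => Re (f t)) a b, RInt (fun t => Im (f t)) a b).

Definition ccont_seg (f : R -> C) (a b : R) : Prop :=
  forall z, Rmin a b <= z <= Rmax a b -> ccont f z.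

Lemma C_eq (z w : C) : Re z = Re w -> Im z = Im w -> z = w.
Proof. destruct z, w; simpl; congruence. Qed.

Lemma Cmod_le_sum (z : C) : Cmod z <= Rabs (Re z) + Rabs (Im z).
Proof.
replace z with (RtoC (Re z) + (0, Im z))%C at 1 by (apply C_eq; simpl; ring).
eapply Rle_trans; [apply Cmod_triangle|].
rewrite Cmod_R; apply Rplus_le_compat_l.
unfold Cmod; simpl.
replace (0 * (0 * 1) + Im z * (Im z * 1)) with (Im z)² by (unfold Rsqr; ring).
rewrite sqrt_Rsqr_abs; apply Rle_refl.
Qed.

Lemma Re_le_Cmod (z : C) : Rabs (Re z) <= Cmod z.
Proof. eapply Rle_trans; [apply Rmax_l|apply Rmax_Cmod]. Qed.

Lemma Im_le_Cmod (z : C) : Rabs (Im z) <= Cmod z.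
Proof. eapply Rle_trans; [apply Rmax_r|apply Rmax_Cmod]. Qed.

(** ** Rules for real functions *)

Lemma continuous_Rplus (f g : R -> R) x :
  continuous f x -> continuous g x -> continuous (fun t => f t + g t) x.
Proof. apply (continuous_plus (V := R_NormedModule)). Qed.

Lemma continuous_Rmult (f g : R -> R) x :
  continuous f x -> continuous g x -> continuous (fun t => f t * g t) x.
Proof. apply (continuous_mult (K := R_AbsRing)). Qed.

Lemma continuous_Ropp (f : R -> R) x :
  continuous f x -> continuous (fun t => - f t) x.
Proof. apply (continuous_opp (V := R_NormedModule)). Qed.

Lemma continuous_Rminus (f g : R -> R) x :
  continuous f x -> continuous g x -> continuous (fun t => f t - g t) x.
Proof. apply (continuous_minus (V := R_NormedModule)). Qed.

Lemma is_derive_Rplus (f g : R -> R) x k l :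
  is_derive f x k -> is_derive g x l -> is_derive (fun t => f t + g t) x (k + l).
Proof. apply (is_derive_plus (K := R_AbsRing) (V := R_NormedModule)). Qed.

Lemma is_derive_Rmult (f g : R -> R) x k l :
  is_derive f x k -> is_derive g x l ->
  is_derive (fun t => f t * g t) x (k * g x + f x * l).
Proof. intros hf hg; apply (is_derive_mult f g x k l hf hg); intros; apply Rmult_comm. Qed.

Lemma is_derive_Rminus (f g : R -> R) x k l :
  is_derive f x k -> is_derive g x l -> is_derive (fun t => f t - g t) x (k - l).
Proof. apply (is_derive_minus (K := R_AbsRing) (V := R_NormedModule)). Qed.

Lemma is_derive_Ropp (f : R -> R) x k :
  is_derive f x k -> is_derive (fun t => - f t) x (- k).
Proof. apply (is_derive_opp (K := R_AbsRing) (V := R_NormedModule)). Qed.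

Lemma is_derive_Rconst (c x : R) : is_derive (fun _ => c) x 0.
Proof. exact (is_derive_const (K := R_AbsRing) (V := R_NormedModule) c x). Qed.

Lemma is_derive_R_continuous (f : R -> R) x l : is_derive f x l -> continuous f x.
Proof.
intros h; apply (ex_derive_continuous (K := R_AbsRing) (V := R_NormedModule)).
now exists l.
Qed.

(** ** Continuity *)

Lemma ccont_const (c : C) x : ccont (fun _ => c) x.
Proof. split; apply continuous_const. Qed.

Lemma ccont_plus f g x : ccont f x -> ccont g x -> ccont (fun t => f t + g t)%C x.
Proof.
intros [a b] [c d]; split.
- exact (continuous_Rplus _ _ _ a c).
- exact (continuous_Rplus _ _ _ b d).
Qed.

Lemma ccont_opp f x : ccont f x -> ccont (fun t => - f t)%C x.
Proof.
intros [a b]; split; [exact (continuous_Ropp _ _ a)|exact (continuous_Ropp _ _ b)].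
Qed.

Lemma ccont_minus f g x : ccont f x -> ccont g x -> ccont (fun t => f t - g t)%C x.
Proof. intros hf hg; apply (ccont_plus f _ x hf (ccont_opp g x hg)). Qed.

Lemma ccont_mult f g x : ccont f x -> ccont g x -> ccont (fun t => f t * g t)%C x.
Proof.
intros [a b] [c d]; split.
- exact (continuous_Rminus _ _ _ (continuous_Rmult _ _ _ a c) (continuous_Rmult _ _ _ b d)).
- exact (continuous_Rplus _ _ _ (continuous_Rmult _ _ _ a d) (continuous_Rmult _ _ _ b c)).
Qed.

Lemma ccont_RtoC (f : R -> R) x : continuous f x -> ccont (fun t => RtoC (f t)) x.
Proof. split; [assumption|apply continuous_const]. Qed.

Lemma ccont_conj f x : ccont f x -> ccont (fun t => Cconj (f t)) x.
Proof. intros [a b]; split; [exact a|exact (continuous_Ropp _ _ b)]. Qed.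

Lemma ccont_comp f (h : R -> R) x :
  ccont f (h x) -> continuous h x -> ccont (fun t => f (h t)) x.
Proof.
intros [a b] c; split.
- exact (continuous_comp h (fun t => Re (f t)) x c a).
- exact (continuous_comp h (fun t => Im (f t)) x c b).
Qed.

Lemma ccont_ext_loc f g x :
  locally x (fun t => f t = g t) -> ccont f x -> ccont g x.
Proof.
intros e [a b]; split;
  [apply continuous_ext_loc with (2 := a)|apply continuous_ext_loc with (2 := b)];
  (eapply filter_imp; [|exact e]); now intros t ->.
Qed.

Lemma continuous_affine (u v x : R) : continuous (fun t => u * t + v) x.
Proof. apply is_derive_R_continuous with u; auto_derive; [auto|ring]. Qed.

Lemma continuous_Ropp_id (x : R) : continuous (fun t => - t) x.
Proof. apply is_derive_R_continuous with (-1); auto_derive; [auto|ring]. Qed.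

Lemma ccont2_slice F x y : ccont2 F x y -> ccont (F x) y.
Proof.
intros [a b]; split.
- exact (continuity_2d_pt_slice _ _ _ a).
- exact (continuity_2d_pt_slice _ _ _ b).
Qed.

Lemma ccont2_plus F G x y :
  ccont2 F x y -> ccont2 G x y -> ccont2 (fun u v => F u v + G u v)%C x y.
Proof.
intros [a b] [c d]; split.
- exact (continuity_2d_pt_plus _ _ _ _ a c).
- exact (continuity_2d_pt_plus _ _ _ _ b d).
Qed.

Lemma ccont2_opp F x y : ccont2 F x y -> ccont2 (fun u v => - F u v)%C x y.
Proof.
intros [a b]; split; [exact (continuity_2d_pt_opp _ _ _ a)|exact (continuity_2d_pt_opp _ _ _ b)].
Qed.

Lemma ccont2_minus F G x y :
  ccont2 F x y -> ccont2 G x y -> ccont2 (fun u v => F u v - G u v)%C x y.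
Proof. intros hf hg; apply (ccont2_plus F _ x y hf (ccont2_opp G x y hg)). Qed.

Lemma ccont2_mult F G x y :
  ccont2 F x y -> ccont2 G x y -> ccont2 (fun u v => F u v * G u v)%C x y.
Proof.
intros [a b] [c d]; split.
- exact (continuity_2d_pt_minus _ _ _ _ (continuity_2d_pt_mult _ _ _ _ a c)
           (continuity_2d_pt_mult _ _ _ _ b d)).
- exact (continuity_2d_pt_plus _ _ _ _ (continuity_2d_pt_mult _ _ _ _ a d)
           (continuity_2d_pt_mult _ _ _ _ b c)).
Qed.

Lemma ccont2_const (c : C) x y : ccont2 (fun _ _ => c) x y.
Proof. split; apply continuity_2d_pt_const. Qed.

Lemma ccont2_comp F (g h : R -> R -> R) x y :
  ccont2 F (g x y) (h x y) -> continuity_2d_pt g x y -> continuity_2d_pt h x y ->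
  ccont2 (fun u v => F (g u v) (h u v)) x y.
Proof.
intros [a b] hg hh; split.
- exact (continuity_2d_pt_comp (fun u v => Re (F u v)) g h x y a hg hh).
- exact (continuity_2d_pt_comp (fun u v => Im (F u v)) g h x y b hg hh).
Qed.

Lemma ccont2_comp1 f (g : R -> R -> R) x y :
  ccont f (g x y) -> continuity_2d_pt g x y -> ccont2 (fun u v => f (g u v)) x y.
Proof.
intros [a b] hg; split.
- exact (continuity_2d_pt_comp1 (fun u => Re (f u)) g x y a hg).
- exact (continuity_2d_pt_comp1 (fun u => Im (f u)) g x y b hg).
Qed.

Lemma ccont2_curve F (g h : R -> R) x :
  ccont2 F (g x) (h x) -> continuous g x -> continuous h x ->
  ccont (fun t => F (g t) (h t)) x.
Proof.
intros hF hg hh.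
apply (ccont2_slice (fun _ t => F (g t) (h t)) 0 x).
apply (ccont2_comp F (fun _ t => g t) (fun _ t => h t)); [exact hF| |].
- apply (continuity_2d_pt_comp1 g (fun _ t => t)); [exact hg|apply continuity_2d_pt_id2].
- apply (continuity_2d_pt_comp1 h (fun _ t => t)); [exact hh|apply continuity_2d_pt_id2].
Qed.

(** ** Derivatives *)

Lemma is_cderive_eq f x l l' : is_cderive f x l -> l = l' -> is_cderive f x l'.
Proof. now intros h <-. Qed.

Lemma is_cderive_ccont f x l : is_cderive f x l -> ccont f x.
Proof.
intros [a b]; split.
- exact (is_derive_R_continuous _ _ _ a).
- exact (is_derive_R_continuous _ _ _ b).
Qed.

Lemma is_cderive_ext_loc f g x l :
  locally x (fun t => f t = g t) -> is_cderive f x l -> is_cderive g x l.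
Proof.
intros e [a b]; split;
  [apply (is_derive_ext_loc _ _ _ _) with (2 := a)|apply (is_derive_ext_loc _ _ _ _) with (2 := b)];
  (eapply filter_imp; [|exact e]); now intros t ->.
Qed.

Lemma is_cderive_ext f g x l :
  (forall t, f t = g t) -> is_cderive f x l -> is_cderive g x l.
Proof. intros e; apply is_cderive_ext_loc, filter_forall, e. Qed.

Lemma is_cderive_const (c : C) x : is_cderive (fun _ => c) x (RtoC 0).
Proof. split; apply is_derive_Rconst. Qed.

Lemma is_cderive_plus f g x k l :
  is_cderive f x k -> is_cderive g x l -> is_cderive (fun t => f t + g t)%C x (k + l)%C.
Proof.
intros [a b] [c d]; split.
- exact (is_derive_Rplus _ _ _ _ _ a c).
- exact (is_derive_Rplus _ _ _ _ _ b d).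
Qed.

Lemma is_cderive_opp f x k : is_cderive f x k -> is_cderive (fun t => - f t)%C x (- k)%C.
Proof.
intros [a b]; split; [exact (is_derive_Ropp _ _ _ a)|exact (is_derive_Ropp _ _ _ b)].
Qed.

Lemma is_cderive_minus f g x k l :
  is_cderive f x k -> is_cderive g x l -> is_cderive (fun t => f t - g t)%C x (k - l)%C.
Proof. intros hf hg; apply (is_cderive_plus f _ x k _ hf (is_cderive_opp g x l hg)). Qed.

Lemma is_cderive_mult f g x k l :
  is_cderive f x k -> is_cderive g x l ->
  is_cderive (fun t => f t * g t)%C x (k * g x + f x * l)%C.
Proof.
intros [a b] [c d]; split.
- refine (eq_ind _ (is_derive _ x) (is_derive_Rminus _ _ _ _ _
    (is_derive_Rmult _ _ _ _ _ a c) (is_derive_Rmult _ _ _ _ _ b d)) _ _).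
  simpl; unfold Re, Im; ring.
- refine (eq_ind _ (is_derive _ x) (is_derive_Rplus _ _ _ _ _
    (is_derive_Rmult _ _ _ _ _ a d) (is_derive_Rmult _ _ _ _ _ b c)) _ _).
  simpl; unfold Re, Im; ring.
Qed.

Lemma is_cderive_scal (c : C) f x l :
  is_cderive f x l -> is_cderive (fun t => c * f t)%C x (c * l)%C.
Proof.
intros h; eapply is_cderive_eq;
  [apply (is_cderive_mult (fun _ => c) f x _ l (is_cderive_const c x) h)|ring].
Qed.

Lemma is_cderive_conj f x l :
  is_cderive f x l -> is_cderive (fun t => Cconj (f t)) x (Cconj l).
Proof. intros [a b]; split; [exact a|exact (is_derive_Ropp _ _ _ b)]. Qed.

Lemma is_cderive_RtoC (f : R -> R) x l :
  is_derive f x l -> is_cderive (fun t => RtoC (f t)) x (RtoC l).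
Proof.
split; [assumption|exact (is_derive_Rconst 0 x)].
Qed.

Lemma is_cderive_comp f (h : R -> R) x l (dh : R) :
  is_cderive f (h x) l -> is_derive h x dh ->
  is_cderive (fun t => f (h t)) x (RtoC dh * l)%C.
Proof.
intros [a b] c; split.
- refine (eq_ind _ (is_derive _ x) (is_derive_comp _ h x _ dh a c) _ _).
  unfold scal; simpl; unfold mult; simpl; unfold Re, Im; ring.
- refine (eq_ind _ (is_derive _ x) (is_derive_comp _ h x _ dh b c) _ _).
  unfold scal; simpl; unfold mult; simpl; unfold Re, Im; ring.
Qed.

Lemma is_cderive_zero_const f a b :
  (forall z, Rmin a b <= z <= Rmax a b -> is_cderive f z (RtoC 0)) -> f a = f b.
Proof.
intros h.
assert (hr : forall g : R -> R,
  (forall z, Rmin a b <= z <= Rmax a b -> is_derive g z 0) -> g a = g b).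
{ intros g hg.
  destruct (MVT_gen g a b (fun _ => 0)) as [c [_ e]].
  - intros x hx; apply hg; lra.
  - intros x hx; apply continuity_pt_filterlim, (is_derive_R_continuous g x 0), hg, hx.
  - lra. }
apply C_eq; [apply (hr (fun t => Re (f t)))|apply (hr (fun t => Im (f t)))];
  intros z hz; apply h, hz.
Qed.

(** ** Integrals *)

Lemma ccont_seg_ex f a b : ccont_seg f a b ->
  ex_RInt (fun t => Re (f t)) a b /\ ex_RInt (fun t => Im (f t)) a b.
Proof. intros h; split; apply ex_RInt_cont; intros z hz; apply h, hz. Qed.

Lemma CInt_RI f a b : ccont_seg f a b -> CInt f a b = RI f a b.
Proof.
intros h; destruct (ccont_seg_ex _ _ _ h) as [h1 h2].
apply (is_RInt_unique (V := C_R_CompleteNormedModule)).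
apply (is_RInt_fct_extend_pair (U := R_NormedModule) (V := R_NormedModule)).
- exact (RInt_correct (V := R_CompleteNormedModule) _ _ _ h1).
- exact (RInt_correct (V := R_CompleteNormedModule) _ _ _ h2).
Qed.

Lemma RI_ext f g a b :
  (forall z, Rmin a b < z < Rmax a b -> f z = g z) -> RI f a b = RI g a b.
Proof.
intros e; unfold RI; f_equal; apply RInt_ext; intros z hz; now rewrite e.
Qed.

Lemma CInt_ext f g a b :
  (forall z, Rmin a b < z < Rmax a b -> f z = g z) -> CInt f a b = CInt g a b.
Proof. exact (RInt_ext (V := C_R_CompleteNormedModule) f g a b). Qed.

Lemma RI_point f a : RI f a a = RtoC 0.
Proof.
unfold RI; rewrite !(RInt_point (V := R_CompleteNormedModule)); reflexivity.
Qed.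

Lemma RI_zero a b : RI (fun _ => RtoC 0) a b = RtoC 0.
Proof.
unfold RI; simpl; rewrite !(RInt_const (V := R_CompleteNormedModule)).
unfold scal; simpl; unfold mult; simpl; rewrite Rmult_0_r; reflexivity.
Qed.

Lemma RI_plus f g a b : ccont_seg f a b -> ccont_seg g a b ->
  RI (fun t => f t + g t)%C a b = (RI f a b + RI g a b)%C.
Proof.
intros hf hg; apply ccont_seg_ex in hf, hg; destruct hf, hg.
apply C_eq; apply (RInt_plus (V := R_CompleteNormedModule)); assumption.
Qed.

Lemma RI_opp f a b : ccont_seg f a b -> RI (fun t => - f t)%C a b = (- RI f a b)%C.
Proof.
intros hf; apply ccont_seg_ex in hf; destruct hf.
apply C_eq; apply (RInt_opp (V := R_CompleteNormedModule)); assumption.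
Qed.

Lemma ccont_seg_plus f g a b : ccont_seg f a b -> ccont_seg g a b ->
  ccont_seg (fun t => f t + g t)%C a b.
Proof. intros hf hg z hz; apply ccont_plus; auto. Qed.

Lemma ccont_seg_opp f a b : ccont_seg f a b -> ccont_seg (fun t => - f t)%C a b.
Proof. intros hf z hz; apply ccont_opp; auto. Qed.

Lemma ccont_seg_mult f g a b : ccont_seg f a b -> ccont_seg g a b ->
  ccont_seg (fun t => f t * g t)%C a b.
Proof. intros hf hg z hz; apply ccont_mult; auto. Qed.

Lemma RI_minus f g a b : ccont_seg f a b -> ccont_seg g a b ->
  RI (fun t => f t - g t)%C a b = (RI f a b - RI g a b)%C.
Proof.
intros hf hg; unfold Cminus; rewrite <- (RI_opp g) by assumption.
apply RI_plus; [assumption|now apply ccont_seg_opp].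
Qed.

Lemma RI_scal (c : C) f a b : ccont_seg f a b ->
  RI (fun t => c * f t)%C a b = (c * RI f a b)%C.
Proof.
intros hf; apply ccont_seg_ex in hf; destruct hf as [h1 h2].
assert (s : forall (k : R) (g : R -> R), ex_RInt g a b -> ex_RInt (fun t => k * g t) a b).
{ intros k g; apply (ex_RInt_scal (V := R_CompleteNormedModule)). }
assert (s' : forall (k : R) (g : R -> R), ex_RInt g a b ->
  RInt (fun t => k * g t) a b = k * RInt g a b).
{ intros k g; apply (RInt_scal (V := R_CompleteNormedModule)). }
apply C_eq; simpl.
- change (RInt (fun t => Re c * Re (f t) - Im c * Im (f t)) a b =
    Re c * RInt (fun t => Re (f t)) a b - Im c * RInt (fun t => Im (f t)) a b).
  rewrite <- !s' by assumption.
  apply (RInt_minus (V := R_CompleteNormedModule)); now apply s.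
- change (RInt (fun t => Re c * Im (f t) + Im c * Re (f t)) a b =
    Re c * RInt (fun t => Im (f t)) a b + Im c * RInt (fun t => Re (f t)) a b).
  rewrite <- !s' by assumption.
  apply (RInt_plus (V := R_CompleteNormedModule)); now apply s.
Qed.

Lemma RI_Chasles f a b c : ccont_seg f a b -> ccont_seg f b c ->
  (RI f a b + RI f b c)%C = RI f a c.
Proof.
intros hf hg; apply ccont_seg_ex in hf, hg; destruct hf, hg.
apply C_eq; apply (RInt_Chasles (V := R_CompleteNormedModule)); assumption.
Qed.

Lemma RI_swap f a b : ccont_seg f a b -> RI f b a = (- RI f a b)%C.
Proof.
intros hf; apply ccont_seg_ex in hf; destruct hf.
apply C_eq; symmetry; apply (opp_RInt_swap (V := R_CompleteNormedModule)); assumption.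
Qed.

Lemma RI_bound f a b (M : R) : ccont_seg f a b ->
  (forall z, Rmin a b <= z <= Rmax a b -> Cmod (f z) <= M) ->
  Cmod (RI f a b) <= 2 * M * Rabs (b - a).
Proof.
intros hc hM; eapply Rle_trans; [apply Cmod_le_sum|].
assert (h1 : Rabs (RInt (fun t => Re (f t)) a b) <= M * Rabs (b - a)).
{ apply RInt_bound; intros z hz; [apply hc, hz|].
  eapply Rle_trans; [apply Re_le_Cmod|auto]. }
assert (h2 : Rabs (RInt (fun t => Im (f t)) a b) <= M * Rabs (b - a)).
{ apply RInt_bound; intros z hz; [apply hc, hz|].
  eapply Rle_trans; [apply Im_le_Cmod|auto]. }
simpl; lra.
Qed.

Lemma RI_FTC F f a b :
  (forall z, Rmin a b <= z <= Rmax a b -> is_cderive F z (f z)) -> ccont_seg f a b ->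
  RI f a b = (F b - F a)%C.
Proof.
intros hF hf; apply C_eq;
  refine (is_RInt_unique (V := R_CompleteNormedModule) _ _ _ _
    (is_RInt_derive (V := R_CompleteNormedModule) _ _ _ _ _ _));
  intros z hz; first [apply hF, hz|apply hf, hz].
Qed.

Lemma is_cderive_RI f c x l r :
  (forall z, l < z < r -> ccont f z) -> l < c < r -> l < x < r ->
  is_cderive (fun y => RI f c y) x (f x).
Proof.
intros hf hc hx; split.
- apply (is_derive_RInt_upper (fun t => Re (f t)) c x l r); auto; apply hf.
- apply (is_derive_RInt_upper (fun t => Im (f t)) c x l r); auto; apply hf.
Qed.

Lemma is_cderive_RI_global f c x :
  (forall z, ccont f z) -> is_cderive (fun y => RI f c y) x (f x).
Proof.
intros hf; apply is_cderive_RI with (Rmin c x - 1) (Rmax c x + 1); auto;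
  unfold Rmin, Rmax; destruct (Rle_dec c x); lra.
Qed.

Lemma RI_comp_affine f (u v a b : R) :
  ccont_seg f (u * a + v) (u * b + v) ->
  (RtoC u * RI (fun y => f (u * y + v)%R) a b)%C = RI f (u * a + v) (u * b + v).
Proof.
intros hf.
destruct (Req_dec u 0) as [->|hu].
{ rewrite !Rmult_0_l, RI_point; ring. }
assert (hg : ccont_seg (fun y => f (u * y + v)%R) a b).
{ intros z hz; apply (ccont_comp f (fun y => u * y + v)); [|apply continuous_affine].
  apply hf; clear hf; revert hz.
  destruct (Rle_lt_dec 0 u) as [h|h].
  - assert (m : forall y y', y <= y' -> u * y <= u * y') by (intros; now apply Rmult_le_compat_l).
    unfold Rmin, Rmax; destruct (Rle_dec a b) as [hab|hab]; intros [z1 z2];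
      apply m in z1; apply m in z2; repeat destruct Rle_dec; try lra;
      assert (m' := m b a); lra.
  - assert (m : forall y y', y <= y' -> u * y' <= u * y)
      by (intros; apply Rmult_le_compat_neg_l; lra).
    unfold Rmin, Rmax; destruct (Rle_dec a b) as [hab|hab]; intros [z1 z2];
      apply m in z1; apply m in z2; repeat destruct Rle_dec; try lra;
      assert (m' := m b a); assert (m'' := m a b); lra. }
rewrite <- RI_scal by assumption.
apply ccont_seg_ex in hf; destruct hf as [h1 h2].
apply C_eq.
- refine (eq_trans _ (RInt_comp_lin (V := R_CompleteNormedModule) (fun t => Re (f t)) u v a b h1)).
  apply RInt_ext; intros y _; unfold scal; simpl; unfold mult; simpl; unfold Re, Im; simpl; ring.
- refine (eq_trans _ (RInt_comp_lin (V := R_CompleteNormedModule) (fun t => Im (f t)) u v a b h2)).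
  apply RInt_ext; intros y _; unfold scal; simpl; unfold mult; simpl; unfold Re, Im; simpl; ring.
Qed.

Lemma ccont2_RI G c x0 y0 r : 0 < r ->
  (forall x t, in_tube c x0 y0 r x t -> ccont2 G x t) ->
  ccont2 (fun x y => RI (G x) c y) x0 y0.
Proof.
intros hr h; split.
- apply (continuity_2d_pt_RInt (fun x t => Re (G x t)) c x0 y0 r hr); intros; now apply h.
- apply (continuity_2d_pt_RInt (fun x t => Im (G x t)) c x0 y0 r hr); intros; now apply h.
Qed.

Lemma is_cderive_RI_tube G Gx c x0 y0 r (b : R -> R) (db : R) : 0 < r ->
  (forall x t, in_tube c x0 y0 r x t -> is_cderive (fun z => G z t) x (Gx x t)) ->
  (forall x t, in_tube c x0 y0 r x t -> ccont2 Gx x t) ->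
  (forall x t, in_tube c x0 y0 r x t -> ccont (G x) t) ->
  b x0 = y0 -> is_derive b x0 db ->
  is_cderive (fun x => RI (G x) c (b x)) x0 (RI (Gx x0) c y0 + RtoC db * G x0 y0)%C.
Proof.
intros hr h1 h2 h3 hb hdb; split.
- refine (eq_ind _ (is_derive _ x0) (is_derive_RInt_tube (fun x t => Re (G x t)) c x0 y0 r hr
    (fun x t => Re (Gx x t)) b db _ _ _ hb hdb) _ _); try (intros; now apply h1 || now apply h2 || now apply h3).
  simpl; unfold Re, Im; ring.
- refine (eq_ind _ (is_derive _ x0) (is_derive_RInt_tube (fun x t => Im (G x t)) c x0 y0 r hr
    (fun x t => Im (Gx x t)) b db _ _ _ hb hdb) _ _); try (intros; now apply h1 || now apply h2 || now apply h3).
  simpl; unfold Re, Im; ring.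
Qed.

(** * Smoothness *)

Definition open_dom (D : R -> Prop) : Prop := forall x, D x -> locally x D.

(** Smoothness as a chain of successive derivatives: with it, stability under products is
    an induction on the order. *)
Fixpoint diffn (D : R -> Prop) (k : nat) (f : R -> C) : Prop :=
  match k with
  | O => True
  | S k => exists g, (forall x, D x -> is_cderive f x (g x)) /\ diffn D k g
  end.

Definition everywhere (_ : R) : Prop := True.

Lemma open_everywhere : open_dom everywhere.
Proof. intros x _; now apply filter_forall. Qed.

Lemma open_interval a : open_dom (interval a).
Proof.
intros x [h1 h2].
assert (p : 0 < Rmin (x + a) (a - x)) by (apply Rmin_glb_lt; lra).
exists (mkposreal _ p); intros y hy; change (Rabs (y - x) < Rmin (x + a) (a - x)) in hy.
apply Rabs_def2 in hy.
assert (q1 := Rmin_l (x + a) (a - x)); assert (q2 := Rmin_r (x + a) (a - x)).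
unfold interval; lra.
Qed.

Lemma ex_derive_n_shift (f : R -> R) k x :
  ex_derive_n f (S (S k)) x -> ex_derive_n (Derive f) (S k) x.
Proof.
simpl; intros [l hl]; exists l.
refine (is_derive_ext _ _ _ _ _ hl); intros t.
refine (eq_trans _ (eq_sym (Derive_n_comp f k 1 t))).
now replace (k + 1)%nat with (S k) by lia.
Qed.

Lemma smooth_on_cderive D f x : smooth_on D f -> D x -> is_cderive f x (nderiv 1 f x).
Proof. intros h hx; destruct (h 1%nat x hx); split; now apply Derive_correct. Qed.

Lemma smooth_on_nderiv1 D f : smooth_on D f -> smooth_on D (nderiv 1 f).
Proof.
intros h [|k] x hx; [split; exact I|].
destruct (h (S (S k)) x hx); split; now apply ex_derive_n_shift.
Qed.

Lemma smooth_on_ccont D f x : smooth_on D f -> D x -> ccont f x.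
Proof. intros h hx; eapply is_cderive_ccont, smooth_on_cderive; eassumption. Qed.

Lemma nderiv_S f k x : nderiv (S k) f x = nderiv k (nderiv 1 f) x.
Proof.
unfold nderiv; simpl; apply C_eq; unfold Re, Im; simpl; symmetry.
- refine (eq_trans (Derive_n_comp (fun t => fst (f t)) k 1 x) _).
  now replace (k + 1)%nat with (S k) by lia.
- refine (eq_trans (Derive_n_comp (fun t => snd (f t)) k 1 x) _).
  now replace (k + 1)%nat with (S k) by lia.
Qed.

Lemma nderiv_0 f : nderiv 0 f = f.
Proof. apply functional_extensionality; intros x; unfold nderiv; simpl; now apply C_eq. Qed.

Lemma nderiv_zero k x : nderiv k (fun _ => RtoC 0) x = RtoC 0.
Proof. destruct k; [reflexivity|]; unfold nderiv; rewrite !Derive_n_const; reflexivity. Qed.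

Lemma nderiv_ext_loc f g k x :
  locally x (fun t => f t = g t) -> nderiv k f x = nderiv k g x.
Proof.
intros e; unfold nderiv; f_equal; apply Derive_n_ext_loc;
  (eapply filter_imp; [|exact e]); now intros t ->.
Qed.

Lemma nderiv_ext f g k x : (forall t, f t = g t) -> nderiv k f x = nderiv k g x.
Proof. intros e; apply nderiv_ext_loc, filter_forall, e. Qed.

Lemma nderiv_1 f x l : is_cderive f x l -> nderiv 1 f x = l.
Proof. intros [a b]; apply C_eq; now apply is_derive_unique. Qed.

Lemma nderiv_S_on D f g k x : open_dom D ->
  (forall y, D y -> is_cderive f y (g y)) -> D x -> nderiv (S k) f x = nderiv k g x.
Proof.
intros hD h hx; rewrite nderiv_S; apply nderiv_ext_loc.
eapply filter_imp; [|exact (hD x hx)]; intros t ht; now apply nderiv_1, h.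
Qed.

Lemma smooth_on_diffn D f k : smooth_on D f -> diffn D k f.
Proof.
revert f; induction k as [|k IH]; intros f h; [exact I|].
exists (nderiv 1 f); split; [intros x; now apply smooth_on_cderive|].
now apply IH, smooth_on_nderiv1.
Qed.

Lemma diffn_smooth_on D f : open_dom D -> (forall k, diffn D k f) -> smooth_on D f.
Proof.
intros hD h k; specialize (h k); revert f h; induction k as [|k IH]; intros f h x hx;
  [split; exact I|].
destruct h as [g [h1 h2]]; specialize (IH g h2).
destruct k as [|k].
- destruct (h1 x hx) as [d1 d2]; split; [exists (Re (g x))|exists (Im (g x))]; assumption.
- assert (hloc : locally x (fun t => forall j, nderiv (S j) f t = nderiv j g t)).
  { eapply filter_imp; [|exact (hD x hx)]; intros t ht j; now apply nderiv_S_on with D. }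
  destruct (IH x hx) as [[l1 d1] [l2 d2]]; split.
  + exists l1; refine (is_derive_ext_loc _ _ _ _ _ d1).
    eapply filter_imp; [|exact hloc]; intros t ht; exact (eq_sym (f_equal fst (ht k))).
  + exists l2; refine (is_derive_ext_loc _ _ _ _ _ d2).
    eapply filter_imp; [|exact hloc]; intros t ht; exact (eq_sym (f_equal snd (ht k))).
Qed.

Lemma smooth_on_of_derive D f g : open_dom D ->
  (forall x, D x -> is_cderive f x (g x)) -> smooth_on D g -> smooth_on D f.
Proof.
intros hD h hg; apply diffn_smooth_on; [exact hD|]; intros [|k]; [exact I|].
exists g; split; [exact h|now apply smooth_on_diffn].
Qed.

Lemma diffn_le D k f : diffn D (S k) f -> diffn D k f.
Proof.
revert f; induction k as [|k IH]; intros f h; [exact I|].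
destruct h as [g [h1 h2]]; exists g; split; [exact h1|now apply IH].
Qed.

Lemma diffn_ext D k f g : open_dom D -> (forall x, D x -> f x = g x) ->
  diffn D k f -> diffn D k g.
Proof.
intros hD e; destruct k as [|k]; [auto|]; intros [h [h1 h2]].
exists h; split; [|exact h2]; intros x hx; apply is_cderive_ext_loc with (2 := h1 x hx).
eapply filter_imp; [|exact (hD x hx)]; exact e.
Qed.

Lemma diffn_plus D k f g : diffn D k f -> diffn D k g -> diffn D k (fun x => f x + g x)%C.
Proof.
revert f g; induction k as [|k IH]; intros f g hf hg; [exact I|].
destruct hf as [f' [f1 f2]], hg as [g' [g1 g2]].
exists (fun x => f' x + g' x)%C; split; [|now apply IH].
intros x hx; apply is_cderive_plus; auto.
Qed.

Lemma diffn_mult D k f g : diffn D k f -> diffn D k g -> diffn D k (fun x => f x * g x)%C.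
Proof.
revert f g; induction k as [|k IH]; intros f g hf hg; [exact I|].
assert (hf' := diffn_le _ _ _ hf); assert (hg' := diffn_le _ _ _ hg).
destruct hf as [f' [f1 f2]], hg as [g' [g1 g2]].
exists (fun x => f' x * g x + f x * g' x)%C; split.
- intros x hx; apply is_cderive_mult; auto.
- apply diffn_plus; apply IH; auto.
Qed.

Lemma diffn_const D k (c : C) : diffn D k (fun _ => c).
Proof.
revert c; induction k as [|k IH]; intros c; [exact I|].
exists (fun _ => RtoC 0); split; [intros; apply is_cderive_const|apply IH].
Qed.

Lemma diffn_affine D D' k f (u v : R) : (forall x, D x -> D' (u * x + v)) ->
  diffn D' k f -> diffn D k (fun x => f (u * x + v)%R).
Proof.
intros hD; revert f; induction k as [|k IH]; intros f; [auto|].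
intros [f' [h1 h2]]; exists (fun x => RtoC u * f' (u * x + v)%R)%C; split.
- intros x hx; apply (is_cderive_comp f (fun x => u * x + v)).
  + apply h1; auto.
  + auto_derive; [auto|ring].
- apply diffn_mult; [apply diffn_const|apply IH, h2].
Qed.

Lemma smooth_on_ext D f g : open_dom D -> (forall x, D x -> f x = g x) ->
  smooth_on D f -> smooth_on D g.
Proof.
intros hD e h; apply diffn_smooth_on; [exact hD|]; intros k.
apply diffn_ext with f; auto; now apply smooth_on_diffn.
Qed.

Lemma smooth_on_plus D f g : open_dom D -> smooth_on D f -> smooth_on D g ->
  smooth_on D (fun x => f x + g x)%C.
Proof.
intros hD hf hg; apply diffn_smooth_on; [exact hD|]; intros k.
apply diffn_plus; now apply smooth_on_diffn.
Qed.

Lemma smooth_on_mult D f g : open_dom D -> smooth_on D f -> smooth_on D g ->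
  smooth_on D (fun x => f x * g x)%C.
Proof.
intros hD hf hg; apply diffn_smooth_on; [exact hD|]; intros k.
apply diffn_mult; now apply smooth_on_diffn.
Qed.

Lemma smooth_on_const D (c : C) : smooth_on D (fun _ => c).
Proof. intros k x _; split; apply ex_derive_n_const. Qed.

Lemma smooth_on_opp D f : open_dom D -> smooth_on D f -> smooth_on D (fun x => - f x)%C.
Proof.
intros hD hf; apply smooth_on_ext with (fun x => RtoC (-1) * f x)%C; [exact hD| |].
- intros x _; apply C_eq; simpl; unfold Re, Im; ring.
- apply smooth_on_mult; auto using smooth_on_const.
Qed.

Lemma smooth_on_affine D D' f (u v : R) : open_dom D -> (forall x, D x -> D' (u * x + v)) ->
  smooth_on D' f -> smooth_on D (fun x => f (u * x + v)%R).
Proof.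
intros hD hD' hf; apply diffn_smooth_on; [exact hD|]; intros k.
apply diffn_affine with D'; auto; now apply smooth_on_diffn.
Qed.

Lemma smooth_on_id D : open_dom D -> smooth_on D (fun x => RtoC x).
Proof.
intros hD; apply smooth_on_of_derive with (fun _ => RtoC 1); auto using smooth_on_const.
intros x _; apply is_cderive_RtoC; auto_derive; [auto|ring].
Qed.

Lemma RtoC_pow_S x k : RtoC (x ^ S k) = (RtoC x * RtoC (x ^ k))%C.
Proof. simpl; apply RtoC_mult. Qed.

Lemma smooth_on_pow D k : open_dom D -> smooth_on D (fun x => RtoC (x ^ k)).
Proof.
intros hD; induction k as [|k IH].
{ exact (smooth_on_const D (RtoC 1)). }
apply smooth_on_ext with (fun x => RtoC x * RtoC (x ^ k))%C; [exact hD| |].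
- intros x _; now rewrite RtoC_pow_S.
- apply smooth_on_mult; auto using smooth_on_id.
Qed.

Lemma smooth_on_conj D f : open_dom D -> smooth_on D f -> smooth_on D (fun x => Cconj (f x)).
Proof.
intros hD hf; apply diffn_smooth_on; [exact hD|]; intros k.
apply smooth_on_diffn with (k := k) in hf; revert f hf.
induction k as [|k IH]; intros f; [auto|]; intros [g [h1 h2]].
exists (fun x => Cconj (g x)); split; [|now apply IH].
intros x hx; apply is_cderive_conj, h1, hx.
Qed.

Lemma smooth_on_sub D D' f : (forall x, D x -> D' x) -> smooth_on D' f -> smooth_on D f.
Proof. intros s h k x hx; apply h, s, hx. Qed.

(** * Test functions *)

Lemma test_ext a (f g : test a) : (forall x, f x = g x) -> f = g.
Proof.
destruct f as [f hf], g as [g hg]; simpl; intros e.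
assert (e' : f = g) by now apply functional_extensionality.
subst g; f_equal; apply proof_irrelevance.
Qed.

Lemma test_support a f : 0 < a -> is_test a f -> exists b, 0 < b < a /\ supported_in b f.
Proof.
intros ha [_ [b [hb h]]]; exists (Rmax b (a / 2)); split.
- split; [eapply Rlt_le_trans; [|apply Rmax_r]; lra|apply Rmax_lub_lt; lra].
- intros x hx; apply h; eapply Rle_lt_trans; [apply Rmax_l|exact hx].
Qed.

Lemma supported_loc b f x : supported_in b f -> b < Rabs x ->
  locally x (fun t => f t = RtoC 0).
Proof.
intros h hx.
assert (p : 0 < Rabs x - b) by lra.
exists (mkposreal _ p); intros y hy; apply h; change (Rabs (y - x) < Rabs x - b) in hy.
assert (t := Rabs_triang (x - y) y); replace (x - y + y) with x in t by ring.
rewrite Rabs_minus_sym in hy; lra.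
Qed.

Lemma supported_le b c f : b <= c -> supported_in b f -> supported_in c f.
Proof. intros hb h x hx; apply h; lra. Qed.

(** Off the support of f the product is locally zero, whatever the values of g
    outside I. *)
Lemma smooth_mult_supported a b g f : b < a -> smooth_on (interval a) g ->
  smooth_on everywhere f -> supported_in b f ->
  smooth_on everywhere (fun x => g x * f x)%C.
Proof.
intros hb hg hf hs k x _.
destruct (Rlt_le_dec b (Rabs x)) as [hx|hx].
- assert (e : locally x (fun t => (g t * f t)%C = RtoC 0)).
  { eapply filter_imp; [|exact (supported_loc b f x hs hx)]; intros t ->.
    apply Cmult_0_r. }
  split;
    (apply (ex_derive_n_ext_loc (fun _ => 0)); [|apply ex_derive_n_const]);
    (eapply filter_imp; [|exact e]); intros t ->; reflexivity.
- apply (smooth_on_mult (interval a) g f (open_interval a) hg).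
  + now apply smooth_on_sub with everywhere.
  + unfold interval; split; [|apply Rle_lt_trans with (2 := hb);
      apply Rle_trans with (2 := hx); apply Rle_abs].
    assert (h := Rle_abs (- x)); rewrite Rabs_Ropp in h; lra.
Qed.

Lemma is_test_mult a g f : smooth_on (interval a) g -> is_test a f ->
  is_test a (fun x => g x * f x)%C.
Proof.
intros hg [hf [b [hb hs]]]; split; [now apply smooth_mult_supported with a b|].
exists b; split; [exact hb|]; intros x hx; rewrite hs by exact hx; apply Cmult_0_r.
Qed.

Lemma is_test_smooth a f : is_test a f -> smooth_on everywhere f.
Proof. now intros []. Qed.

Lemma is_test_ccont a f x : is_test a f -> ccont f x.
Proof. intros [h _]; exact (smooth_on_ccont _ _ _ h I). Qed.

Lemma is_test_cderive a f x : is_test a f -> is_cderive f x (nderiv 1 f x).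
Proof. intros [h _]; exact (smooth_on_cderive _ _ _ h I). Qed.

Lemma ccont_mult_supported a b g f x : b < a ->
  (forall y, interval a y -> ccont g y) -> (forall y, ccont f y) -> supported_in b f ->
  ccont (fun t => g t * f t)%C x.
Proof.
intros hb hg hf hs.
destruct (Rlt_le_dec b (Rabs x)) as [hx|hx].
- apply ccont_ext_loc with (fun _ => RtoC 0); [|apply ccont_const].
  eapply filter_imp; [|exact (supported_loc b f x hs hx)]; intros t ->.
  now rewrite Cmult_0_r.
- apply ccont_mult; [|apply hf]; apply hg.
  unfold interval; split; [|apply Rle_lt_trans with (2 := hb);
      apply Rle_trans with (2 := hx); apply Rle_abs].
  assert (h := Rle_abs (- x)); rewrite Rabs_Ropp in h; lra.
Qed.

Lemma nderiv_supported b f k : supported_in b f -> supported_in b (nderiv k f).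
Proof.
intros h x hx; rewrite (nderiv_ext_loc f (fun _ => RtoC 0) k x).
- apply nderiv_zero.
- exact (supported_loc b f x h hx).
Qed.

Lemma is_test_nderiv1 a f : is_test a f -> is_test a (nderiv 1 f).
Proof.
intros [h [b [hb hs]]]; split; [now apply smooth_on_nderiv1|].
exists b; split; [exact hb|now apply nderiv_supported].
Qed.

Lemma is_test_ext a f g : (forall x, f x = g x) -> is_test a f -> is_test a g.
Proof. intros e; now replace g with f by now apply functional_extensionality. Qed.

Lemma is_test_nderiv a f k : is_test a f -> is_test a (nderiv k f).
Proof.
intros hf; induction k as [|k IH]; [now rewrite nderiv_0|].
exact (is_test_nderiv1 a _ IH).
Qed.

Lemma is_test_lin_fun a (c : C) f g : is_test a f -> is_test a g ->
  is_test a (fun x => c * f x + g x)%C.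
Proof. intros hf hg; exact (is_test_lin c (Test hf) (Test hg)). Qed.

Lemma is_test_opp a f : is_test a f -> is_test a (fun x => - f x)%C.
Proof.
intros hf; apply is_test_ext with (fun x => RtoC (-1) * f x + RtoC 0)%C.
- intros x; apply C_eq; simpl; unfold Re, Im; ring.
- apply is_test_lin_fun; [exact hf|apply is_test_zero].
Qed.

Lemma is_test_plus a f g : is_test a f -> is_test a g -> is_test a (fun x => f x + g x)%C.
Proof.
intros hf hg; apply is_test_ext with (fun x => RtoC 1 * f x + g x)%C.
- intros x; now rewrite Cmult_1_l.
- now apply is_test_lin_fun.
Qed.

Lemma is_test_scal a (c : C) f : is_test a f -> is_test a (fun x => c * f x)%C.
Proof.
intros hf; apply is_test_mult; [apply smooth_on_const|exact hf].
Qed.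

Lemma is_test_reflect a f : is_test a f -> is_test a (fun x => f (- x)).
Proof.
intros [h [b [hb hs]]]; split.
- apply smooth_on_ext with (fun x => f (-1 * x + 0)); [apply open_everywhere| |].
  + intros x _; f_equal; ring.
  + apply smooth_on_affine with everywhere; [apply open_everywhere|easy|exact h].
- exists b; split; [exact hb|]; intros x hx; apply hs; now rewrite Rabs_Ropp.
Qed.

(** * Null sequences of test functions *)

Definition unull (f : nat -> R -> C) : Prop :=
  forall eps, 0 < eps -> exists N, forall n, (N <= n)%nat -> forall x, Cmod (f n x) < eps.

(** Linear maps are continuous as soon as they are continuous at 0, so null sequences
    replace convergent ones. *)
Definition test_null (a : R) (f : nat -> R -> C) : Prop :=
  (exists b, b < a /\ forall n, supported_in b (f n)) /\
  forall k, unull (fun n => nderiv k (f n)).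

Lemma unull_ext f g : (forall n x, f n x = g n x) -> unull f -> unull g.
Proof.
intros e h eps he; destruct (h eps he) as [N hN]; exists N; intros n hn x.
rewrite <- e; auto.
Qed.

Lemma unull_0 f : unull (fun n => nderiv 0 (f n)) <-> unull f.
Proof. split; apply unull_ext; intros n x; now rewrite nderiv_0. Qed.

Lemma unull_dom f g (M : R) : 0 <= M ->
  (forall n m, (forall x, Cmod (f n x) <= m) -> forall x, Cmod (g n x) <= M * m) ->
  unull f -> unull g.
Proof.
intros hM e h eps he.
assert (he' : 0 < eps / (M + 1)) by (apply Rdiv_lt_0_compat; lra).
destruct (h _ he') as [N hN]; exists N; intros n hn x.
apply Rle_lt_trans with (M * (eps / (M + 1))).
- apply e; intros y; left; auto.
- replace eps with ((M + 1) * (eps / (M + 1))) at 2 by (field; lra).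
  apply Rmult_lt_compat_r; lra.
Qed.

Lemma unull_plus f g : unull f -> unull g -> unull (fun n x => f n x + g n x)%C.
Proof.
intros hf hg eps he.
destruct (hf (eps / 2)) as [N1 h1]; [lra|]; destruct (hg (eps / 2)) as [N2 h2]; [lra|].
exists (max N1 N2); intros n hn x.
eapply Rle_lt_trans; [apply Cmod_triangle|].
specialize (h1 n ltac:(lia) x); specialize (h2 n ltac:(lia) x); lra.
Qed.

Lemma unull_scal (c : C) f : unull f -> unull (fun n x => c * f n x)%C.
Proof.
apply (unull_dom _ _ (Cmod c)); [apply Cmod_ge_0|].
intros n m hm x; rewrite Cmod_mult; apply Rmult_le_compat_l; [apply Cmod_ge_0|auto].
Qed.

Lemma unull_reflect f : unull f -> unull (fun n x => f n (- x)).
Proof.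
intros h eps he; destruct (h eps he) as [N hN]; exists N; intros n hn x; now apply hN.
Qed.

(** The gauge at a point is chosen below the inverse of a local bound of F; compactness
    bounds the gauge from below, hence F from above. *)
Lemma compact_bounded (F : R -> R -> C) a b c d :
  (forall x y, a <= x <= b -> c <= y <= d -> ccont2 F x y) ->
  exists M, 0 <= M /\ forall x y, a <= x <= b -> c <= y <= d -> Cmod (F x y) <= M.
Proof.
intros h.
assert (hd : forall x y, exists e : posreal, a <= x <= b -> c <= y <= d ->
  forall u v, Rabs (u - x) < e -> Rabs (v - y) < e -> Cmod (F u v) <= / e).
{ intros x y.
  destruct (excluded_middle_informative (a <= x <= b /\ c <= y <= d)) as [[hx hy]|hn].
  2:{ exists (mkposreal 1 Rlt_0_1); intros; exfalso; auto. }
  destruct (h x y hx hy) as [h1 h2].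
  destruct (h1 (mkposreal 1 Rlt_0_1)) as [d1 e1], (h2 (mkposreal 1 Rlt_0_1)) as [d2 e2].
  simpl in e1, e2.
  set (m := Rabs (Re (F x y)) + Rabs (Im (F x y)) + 2).
  assert (hm : 0 < m).
  { unfold m; assert (q1 := Rabs_pos (Re (F x y))); assert (q2 := Rabs_pos (Im (F x y))); lra. }
  assert (p : 0 < Rmin (/ m) (Rmin d1 d2)).
  { repeat apply Rmin_glb_lt; try apply cond_pos; now apply Rinv_0_lt_compat. }
  exists (mkposreal _ p); simpl; intros _ _ u v hu hv.
  assert (hu1 := Rlt_le_trans _ _ _ hu (Rle_trans _ _ _ (Rmin_r _ _) (Rmin_l d1 d2))).
  assert (hv1 := Rlt_le_trans _ _ _ hv (Rle_trans _ _ _ (Rmin_r _ _) (Rmin_l d1 d2))).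
  assert (hu2 := Rlt_le_trans _ _ _ hu (Rle_trans _ _ _ (Rmin_r _ _) (Rmin_r d1 d2))).
  assert (hv2 := Rlt_le_trans _ _ _ hv (Rle_trans _ _ _ (Rmin_r _ _) (Rmin_r d1 d2))).
  specialize (e1 u v hu1 hv1); specialize (e2 u v hu2 hv2).
  apply Rle_trans with m.
  - eapply Rle_trans; [apply Cmod_le_sum|].
    assert (t1 := Rabs_triang (Re (F u v) - Re (F x y)) (Re (F x y))).
    assert (t2 := Rabs_triang (Im (F u v) - Im (F x y)) (Im (F x y))).
    replace (Re (F u v) - Re (F x y) + Re (F x y)) with (Re (F u v)) in t1 by ring.
    replace (Im (F u v) - Im (F x y) + Im (F x y)) with (Im (F u v)) in t2 by ring.
    unfold m; lra.
  - rewrite <- (Rinv_inv m) at 1; apply Rinv_le_contravar; [exact p|apply Rmin_l]. }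
set (delta := fun x y => proj1_sig (constructive_indefinite_description _ (hd x y))).
destruct (compactness_value_2d a b c d delta) as [e he].
exists (/ e); split; [left; apply Rinv_0_lt_compat, cond_pos|].
intros x y hx hy; apply Rnot_lt_le; intros hlt; apply (he x y hx hy).
intros [u [v [hu [hv [h1 [h2 h3]]]]]].
unfold delta in *; destruct (constructive_indefinite_description _ (hd u v)) as [s hs].
simpl in *; specialize (hs hu hv x y h1 h2).
assert (hi : / s <= / e) by (apply Rinv_le_contravar; [apply cond_pos|exact h3]); lra.
Qed.

Lemma compact_bounded1 (f : R -> C) a b :
  (forall x, a <= x <= b -> ccont f x) ->
  exists M, 0 <= M /\ forall x, a <= x <= b -> Cmod (f x) <= M.
Proof.
intros h; destruct (compact_bounded (fun x _ => f x) a b 0 0) as [M [hM1 hM2]].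
- intros x y hx _; apply (ccont2_comp1 f (fun x _ => x)); [auto|apply continuity_2d_pt_id1].
- exists M; split; [exact hM1|]; intros x hx; apply (hM2 x 0); lra.
Qed.

Lemma null_support a f : 0 < a -> test_null a f ->
  exists b, 0 < b < a /\ forall n, supported_in b (f n).
Proof.
intros ha [[b [hb hs]] _]; exists (Rmax b (a / 2)); split.
- split; [apply Rlt_le_trans with (a / 2); [lra|apply Rmax_r]|apply Rmax_lub_lt; lra].
- intros n; apply supported_le with b; [apply Rmax_l|apply hs].
Qed.

Lemma test_null_nderiv1 a f : test_null a f -> test_null a (fun n => nderiv 1 (f n)).
Proof.
intros [[b [hb hs]] h]; split.
- exists b; split; [exact hb|]; intros n; now apply nderiv_supported.
- intros k; apply unull_ext with (2 := h (S k)); intros n x; apply nderiv_S.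
Qed.

Lemma nderiv_lin_test a (c : C) f g k x : is_test a f -> is_test a g ->
  nderiv k (fun t => c * f t + g t)%C x = (c * nderiv k f x + nderiv k g x)%C.
Proof. intros [hf _] [hg _]; now apply nderiv_lin. Qed.

Lemma nderiv_scal_test a (c : C) f k x : is_test a f ->
  nderiv k (fun t => c * f t)%C x = (c * nderiv k f x)%C.
Proof.
intros hf; rewrite (nderiv_ext _ (fun t => c * f t + RtoC 0)%C) by (intros; ring).
rewrite nderiv_lin_test with (a := a) by (auto using is_test_zero).
rewrite nderiv_zero; ring.
Qed.

Lemma test_null_lin a (c : C) f g : (forall n, is_test a (f n)) -> (forall n, is_test a (g n)) ->
  test_null a f -> test_null a g -> test_null a (fun n x => c * f n x + g n x)%C.
Proof.
intros tf tg [[b [hb hs]] h] [[b' [hb' hs']] h']; split.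
- exists (Rmax b b'); split; [now apply Rmax_lub_lt|].
  intros n x hx; rewrite hs, hs'; [ring| |];
    (eapply Rle_lt_trans; [|exact hx]); [apply Rmax_r|apply Rmax_l].
- intros k; apply unull_ext with (fun n x => c * nderiv k (f n) x + nderiv k (g n) x)%C.
  + intros n x; symmetry; now apply nderiv_lin_test with a.
  + apply unull_plus; [now apply unull_scal|apply h'].
Qed.

Lemma test_null_zero a : test_null a (fun _ _ => RtoC 0).
Proof.
split; [exists (a - 1); split; [lra|now intros n x _]|].
intros k eps he; exists O; intros n _ x.
rewrite nderiv_zero, Cmod_0; exact he.
Qed.

Lemma test_null_ext a f g : (forall n x, f n x = g n x) -> test_null a f -> test_null a g.
Proof.
intros e; replace g with f; [auto|].
now apply functional_extensionality; intros n; apply functional_extensionality.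
Qed.

Lemma test_null_scal a (c : C) f : (forall n, is_test a (f n)) ->
  test_null a f -> test_null a (fun n x => c * f n x)%C.
Proof.
intros tf h; apply test_null_ext with (fun n x => c * f n x + RtoC 0)%C.
- intros; apply Cplus_0_r.
- apply (test_null_lin a c f (fun _ _ => RtoC 0)); auto using test_null_zero.
  intros; apply is_test_zero.
Qed.

Lemma nderiv_reflect a f k x : is_test a f ->
  nderiv k (fun t => f (- t)) x = (RtoC ((-1) ^ k) * nderiv k f (- x))%C.
Proof.
revert f x; induction k as [|k IH]; intros f x hf.
- rewrite !nderiv_0; simpl; ring.
- rewrite (nderiv_S_on everywhere _ (fun t => RtoC (-1) * nderiv 1 f (- t))%C);
    [|apply open_everywhere| |exact I].
  2:{ intros y _; apply (is_cderive_comp f (fun t => - t)).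
      - now apply is_test_cderive with a.
      - auto_derive; [auto|ring]. }
  assert (hf' := is_test_nderiv1 _ _ hf).
  rewrite nderiv_scal_test with (a := a) by (now apply is_test_reflect).
  rewrite IH, <- nderiv_S, Cmult_assoc, <- RtoC_mult by exact hf'; reflexivity.
Qed.

Lemma test_null_reflect a f : (forall n, is_test a (f n)) -> test_null a f ->
  test_null a (fun n x => f n (- x)).
Proof.
intros tf [[b [hb hs]] h]; split.
- exists b; split; [exact hb|]; intros n x hx; apply hs; now rewrite Rabs_Ropp.
- intros k; apply unull_ext with (fun n x => RtoC ((-1) ^ k) * nderiv k (f n) (- x))%C.
  + intros n x; symmetry; now apply nderiv_reflect with a.
  + apply unull_scal, (unull_reflect (fun n => nderiv k (f n))), h.
Qed.

Lemma unull_mult a b g f : b < a -> (forall x, interval a x -> ccont g x) ->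
  (forall n, supported_in b (f n)) -> unull f -> unull (fun n x => g x * f n x)%C.
Proof.
intros hb hg hs.
destruct (compact_bounded1 g (- b) b) as [M [hM1 hM2]].
{ intros x hx; apply hg; unfold interval; lra. }
apply (unull_dom _ _ M hM1); intros n m hm x.
destruct (Rlt_le_dec b (Rabs x)) as [hx|hx].
- rewrite hs by exact hx; rewrite Cmult_0_r, Cmod_0.
  apply Rmult_le_pos; [exact hM1|].
  apply Rle_trans with (2 := hm 0); apply Cmod_ge_0.
- rewrite Cmod_mult; apply Rmult_le_compat; auto using Cmod_ge_0.
  apply hM2; apply Rabs_le_between; exact hx.
Qed.

(** By induction on the order, since (g f)' = g' f + g f' and both g' and f' are of the
    same kind as g and f. *)
Lemma test_null_mult a g f : smooth_on (interval a) g -> (forall n, is_test a (f n)) ->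
  test_null a f -> test_null a (fun n x => g x * f n x)%C.
Proof.
intros hg tf hf; destruct hf as [[b [hb hs]] h]; split.
- exists b; split; [exact hb|]; intros n x hx; rewrite hs by exact hx; apply Cmult_0_r.
- intros k; revert g hg f tf hs h; induction k as [|k IH]; intros g hg f tf hs h.
  + apply unull_0, (unull_mult a b); auto.
    * intros x; now apply smooth_on_ccont.
    * exact (proj1 (unull_0 f) (h O)).
  + apply (unull_ext (fun n x => RtoC 1 * nderiv k (fun t => nderiv 1 g t * f n t)%C x
                        + nderiv k (fun t => g t * nderiv 1 (f n) t)%C x)%C).
    * intros n x.
      rewrite <- nderiv_lin_test with (a := a);
        [|apply is_test_mult; [now apply smooth_on_nderiv1|auto]
         |apply is_test_mult; [auto|now apply is_test_nderiv1]].
      rewrite nderiv_S; apply nderiv_ext; intros t; symmetry.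
      apply nderiv_1.
      destruct (Rlt_le_dec b (Rabs t)) as [ht|ht].
      -- rewrite (hs n t ht), (nderiv_supported b (f n) 1 (hs n) t ht).
         apply is_cderive_eq with (RtoC 0); [|ring].
         apply is_cderive_ext_loc with (fun _ => RtoC 0); [|apply is_cderive_const].
         eapply filter_imp; [|exact (supported_loc b (f n) t (hs n) ht)]; intros y ->; ring.
      -- rewrite Cmult_1_l; apply is_cderive_mult; [|now apply is_test_cderive with a].
         apply smooth_on_cderive with (interval a); [exact hg|].
         apply Rabs_le_between in ht; unfold interval; lra.
    * apply unull_plus; [apply unull_scal|]; apply IH; auto using smooth_on_nderiv1.
      -- intros n; now apply is_test_nderiv1.
      -- intros n; now apply nderiv_supported.
      -- intros j; apply unull_ext with (2 := h (S j)); intros n x; apply nderiv_S.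
Qed.

(** * Distributions as functionals on functions *)

Definition tends (z : nat -> C) (l : C) : Prop :=
  forall eps, 0 < eps -> exists N, forall n, (N <= n)%nat -> Cmod (z n - l)%C < eps.

Lemma cvE z l : cv z l <-> tends z l.
Proof.
split.
- intros h eps he.
  assert (he' : 0 < eps / 2) by lra.
  destruct (h (ball (M := C_UniformSpace) l (mkposreal _ he'))) as [N hN].
  { apply (locally_ball (T := C_UniformSpace)). }
  exists N; intros n hn; destruct (hN n hn) as [h1 h2].
  eapply Rle_lt_trans; [apply Cmod_le_sum|].
  assert (h1' : Rabs (Re (z n - l)%C) < eps / 2) by exact h1.
  assert (h2' : Rabs (Im (z n - l)%C) < eps / 2) by exact h2.
  lra.
- intros h P [eps hP]; destruct (h eps (cond_pos eps)) as [N hN].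
  exists N; intros n hn; apply hP; specialize (hN n hn); split.
  + change (Rabs (Re (z n - l)%C) < eps); eapply Rle_lt_trans; [apply Re_le_Cmod|exact hN].
  + change (Rabs (Im (z n - l)%C) < eps); eapply Rle_lt_trans; [apply Im_le_Cmod|exact hN].
Qed.

Lemma tends_unique z l l' : tends z l -> tends z l' -> l = l'.
Proof.
intros h h'.
assert (e : Cmod (l - l')%C = 0).
{ apply Rle_antisym; [|apply Cmod_ge_0].
  apply le_epsilon; intros eps he.
  destruct (h (eps / 2)) as [N1 h1]; [lra|]; destruct (h' (eps / 2)) as [N2 h2]; [lra|].
  specialize (h1 (max N1 N2) ltac:(lia)); specialize (h2 (max N1 N2) ltac:(lia)).
  set (w := z (max N1 N2)) in *.
  replace (l - l')%C with ((w - l') + - (w - l))%C by ring.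
  eapply Rle_trans; [apply Cmod_triangle|]; rewrite Cmod_opp; lra. }
apply Cmod_eq_0 in e.
replace l with ((l - l') + l')%C by ring; rewrite e; ring.
Qed.

Lemma tends_plus z w l m : tends z l -> tends w m -> tends (fun n => z n + w n)%C (l + m)%C.
Proof.
intros h h' eps he.
destruct (h (eps / 2)) as [N1 h1]; [lra|]; destruct (h' (eps / 2)) as [N2 h2]; [lra|].
exists (max N1 N2); intros n hn.
replace (z n + w n - (l + m))%C with ((z n - l) + (w n - m))%C by ring.
eapply Rle_lt_trans; [apply Cmod_triangle|].
specialize (h1 n ltac:(lia)); specialize (h2 n ltac:(lia)); lra.
Qed.

Lemma tends_const l : tends (fun _ => l) l.
Proof.
intros eps he; exists O; intros n _; replace (l - l)%C with (RtoC 0) by ring.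
now rewrite Cmod_0.
Qed.

Lemma tends_eventually z l (N : nat) : (forall n, (N <= n)%nat -> z n = l) -> tends z l.
Proof.
intros h eps he; exists N; intros n hn; rewrite h by exact hn.
replace (l - l)%C with (RtoC 0) by ring; now rewrite Cmod_0.
Qed.

Lemma tends_ext z w l : (forall n, z n = w n) -> tends z l -> tends w l.
Proof.
intros e h eps he; destruct (h eps he) as [N hN]; exists N; intros n hn; rewrite <- e; auto.
Qed.

(** The bracket <u, f> for a plain function f, so that terms do not carry proofs of
    [is_test a f]. *)
Definition pairing (a : R) (u : distribution a) (f : R -> C) : C := u (test_of a f).

Lemma test_of_test a (f : test a) : test_of a f = f.
Proof. apply test_ext; intros x; apply test_ofE, testP. Qed.

Lemma pairing_test a (u : distribution a) (f : test a) : u f = pairing a u f.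
Proof. unfold pairing; now rewrite test_of_test. Qed.

Lemma pairing_ext a (u : distribution a) f g : (forall x, f x = g x) ->
  pairing a u f = pairing a u g.
Proof. intros e; now replace g with f by now apply functional_extensionality. Qed.

Lemma distr_eq a (u v : distribution a) :
  (forall f, is_test a f -> pairing a u f = pairing a v f) -> u = v.
Proof. intros h; apply distr_ext; intros f; rewrite !pairing_test; apply h, testP. Qed.

Lemma pairing_lin a (u : distribution a) c f g : is_test a f -> is_test a g ->
  pairing a u (fun x => c * f x + g x)%C = (c * pairing a u f + pairing a u g)%C.
Proof.
intros hf hg; unfold pairing; rewrite <- (proj1 (distrP u)); f_equal.
apply test_ext; intros x; simpl.
rewrite !test_ofE; auto; now apply is_test_lin_fun.
Qed.

Lemma pairing_zero a (u : distribution a) : pairing a u (fun _ => RtoC 0) = RtoC 0.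
Proof.
assert (h := pairing_lin a u (RtoC (-1)) _ _ (is_test_zero a) (is_test_zero a)).
rewrite (pairing_ext _ _ _ (fun _ => RtoC 0)) in h by (intros; ring).
rewrite h; ring.
Qed.

Lemma pairing_scal a (u : distribution a) c f : is_test a f ->
  pairing a u (fun x => c * f x)%C = (c * pairing a u f)%C.
Proof.
intros hf; rewrite (pairing_ext _ _ _ (fun x => c * f x + RtoC 0)%C) by (intros; ring).
rewrite (pairing_lin a u c f (fun _ => RtoC 0)), pairing_zero by (auto using is_test_zero); ring.
Qed.

Lemma pairing_minus a (u : distribution a) f g : is_test a f -> is_test a g ->
  pairing a u (fun x => f x - g x)%C = (pairing a u f - pairing a u g)%C.
Proof.
intros hf hg; rewrite (pairing_ext _ _ _ (fun x => RtoC (-1) * g x + f x)%C).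
- rewrite pairing_lin by assumption; ring.
- intros x; ring.
Qed.

Lemma pairing_distr_lin a c (u v : distribution a) f :
  pairing a (distr_lin c u v) f = (c * pairing a u f + pairing a v f)%C.
Proof. reflexivity. Qed.

Lemma pairing_distr_zero a f : pairing a (distr_zero a) f = RtoC 0.
Proof. reflexivity. Qed.

Lemma pairing_distr_add a (u v : distribution a) f :
  pairing a (distr_add u v) f = (pairing a u f + pairing a v f)%C.
Proof. unfold distr_add; rewrite pairing_distr_lin; ring. Qed.

Lemma pairing_distr_scal a c (u : distribution a) f :
  pairing a (distr_scal c u) f = (c * pairing a u f)%C.
Proof. unfold distr_scal; rewrite pairing_distr_lin, pairing_distr_zero; ring. Qed.

Lemma pairing_distr_sub a (u v : distribution a) f :
  pairing a (distr_sub u v) f = (pairing a u f - pairing a v f)%C.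
Proof. unfold distr_sub; rewrite pairing_distr_lin; ring. Qed.

Lemma test_cv_null a (f : nat -> test a) (g : test a) : test_cv f g ->
  test_null a (fun n x => RtoC (-1) * g x + f n x)%C.
Proof.
intros [[b [hb [hg hf]]] h]; split.
- exists b; split; [exact hb|]; intros n x hx; rewrite hg, hf by exact hx; ring.
- intros k eps he; destruct (h k eps he) as [N hN]; exists N; intros n hn x.
  rewrite nderiv_lin_test with (a := a) by apply testP.
  replace (RtoC (-1) * nderiv k g x + nderiv k (f n) x)%C
    with (nderiv k (f n) x - nderiv k g x)%C by ring.
  now apply hN.
Qed.

Lemma null_test_cv a (f : nat -> test a) (g : test a) :
  test_null a (fun n x => RtoC (-1) * g x + f n x)%C -> test_cv f g.
Proof.
intros [[b [hb hs]] h]; destruct (proj2 (testP g)) as [b' [hb' hs']]; split.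
- exists (Rmax b b'); split; [now apply Rmax_lub_lt|]; split.
  + now apply supported_le with b'; [apply Rmax_r|].
  + intros n x hx.
    assert (h1 := hs n x (Rle_lt_trans _ _ _ (Rmax_l _ _) hx)); cbv beta in h1.
    rewrite (hs' x (Rle_lt_trans _ _ _ (Rmax_r _ _) hx)), Cmult_0_r, Cplus_0_l in h1.
    exact h1.
- intros k eps he; destruct (h k eps he) as [N hN]; exists N; intros n hn x.
  specialize (hN n hn x); rewrite nderiv_lin_test with (a := a) in hN by apply testP.
  replace (nderiv k (f n) x - nderiv k g x)%C
    with (RtoC (-1) * nderiv k g x + nderiv k (f n) x)%C by ring.
  exact hN.
Qed.

Lemma pairing_null a (u : distribution a) f : (forall n, is_test a (f n)) ->
  test_null a f -> tends (fun n => pairing a u (f n)) (RtoC 0).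
Proof.
intros tf hf.
assert (h : test_cv (fun n => test_of a (f n)) (test_zero a)).
{ apply null_test_cv; simpl; apply test_null_ext with f; [|exact hf].
  intros n x; rewrite test_ofE by auto; ring. }
apply (proj2 (distrP u)) in h; apply cvE in h.
replace (u (test_zero a)) with (RtoC 0) in h; [exact h|].
rewrite pairing_test; symmetry; apply pairing_zero.
Qed.

Lemma is_distr_of_null a (U : (R -> C) -> C) :
  (forall c f g, is_test a f -> is_test a g ->
     U (fun x => c * f x + g x)%C = (c * U f + U g)%C) ->
  (forall f, (forall n, is_test a (f n)) -> test_null a f ->
     tends (fun n => U (f n)) (RtoC 0)) ->
  is_distr (fun f : test a => U f).
Proof.
intros hl hn; split.
- intros c f g; apply hl; apply testP.
- intros f g h; apply test_cv_null in h; apply hn in h.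
  + apply cvE.
    apply tends_ext with (fun n => RtoC 1 * U g + U (fun x => RtoC (-1) * g x + f n x))%C.
    * intros n; rewrite hl by apply testP; ring.
    * assert (h' := tends_plus _ _ _ _ (tends_const (RtoC 1 * U g)%C) h).
      replace (RtoC 1 * U g + RtoC 0)%C with (U g) in h' by ring; exact h'.
  + intros n; apply is_test_lin_fun; apply testP.
Qed.

Lemma pairing_distr_of a (U : (R -> C) -> C) f :
  is_distr (fun f : test a => U f) -> is_test a f ->
  pairing a (distr_of (fun f : test a => U f)) f = U f.
Proof.
intros h hf; unfold pairing; rewrite distr_ofE by exact h; f_equal.
apply functional_extensionality; now apply test_ofE.
Qed.

(** * Continuous linear operators on test functions *)

(** What transposition requires of an operator on test functions. *)
Record good_op (a : R) (S : (R -> C) -> R -> C) : Prop := GoodOp {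
  good_test : forall f, is_test a f -> is_test a (S f);
  good_lin : forall c f g x, is_test a f -> is_test a g ->
    S (fun t => c * f t + g t)%C x = (c * S f x + S g x)%C;
  good_null : forall f, (forall n, is_test a (f n)) -> test_null a f ->
    test_null a (fun n => S (f n)) }.

Lemma pairing_transpose a S (u : distribution a) f : good_op a S -> is_test a f ->
  pairing a (transpose S u) f = pairing a u (S f).
Proof.
intros hS hf; unfold transpose.
apply (pairing_distr_of a (fun f => pairing a u (S f))); [|exact hf].
apply (is_distr_of_null a (fun f => pairing a u (S f))).
- intros c g h hg hh.
  rewrite <- pairing_lin by (apply hS; assumption).
  apply pairing_ext; intros x; now apply hS.
- intros g tg hg; apply pairing_null; [intros n; now apply hS|now apply hS].
Qed.

Lemma continuous_transpose a S : good_op a S -> continuous_op (transpose (a := a) S).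
Proof.
intros hS u v h f; rewrite pairing_test, pairing_transpose by (auto; apply testP).
refine (filterlim_ext _ _ _ (h (test_of a (S f)))).
intros n; rewrite pairing_test, (pairing_test a (transpose S (u n))).
rewrite pairing_transpose by (auto; apply testP).
apply pairing_ext; intros x; apply test_ofE, hS, testP.
Qed.

Lemma continuous_op_comp a (F G : distribution a -> distribution a) :
  continuous_op F -> continuous_op G -> continuous_op (fun u => F (G u)).
Proof. intros hF hG u v h; now apply (hF (fun n => G (u n))), hG. Qed.

Lemma distr_cvE a (u : nat -> distribution a) v :
  distr_cv u v <-> forall f, is_test a f -> tends (fun n => pairing a (u n) f) (pairing a v f).
Proof.
split.
- intros h f hf; apply cvE, h.
- intros h f; apply cvE; rewrite pairing_test.
  apply tends_ext with (fun n => pairing a (u n) f); [|apply h, testP].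
  intros n; now rewrite pairing_test.
Qed.

Lemma good_neg_deriv a : good_op a (fun f x => (- nderiv 1 f x)%C).
Proof.
split.
- intros f hf; now apply is_test_opp, is_test_nderiv1.
- intros c f g x hf hg; rewrite nderiv_lin_test with (a := a) by assumption; ring.
- intros f tf hf.
  apply test_null_ext with (fun n x => RtoC (-1) * nderiv 1 (f n) x)%C.
  + intros; apply C_eq; simpl; unfold Re, Im; ring.
  + apply test_null_scal; [|now apply test_null_nderiv1].
    intros n; now apply is_test_nderiv1.
Qed.

Lemma good_mul a q : smooth_on (interval a) q -> good_op a (fun f x => (q x * f x)%C).
Proof.
intros hq; split.
- intros f; now apply is_test_mult.
- intros; ring.
- intros f; now apply test_null_mult.
Qed.

Lemma half_neq : RtoC 2 <> RtoC 0.
Proof. intros e; apply RtoC_inj in e; lra. Qed.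

Lemma even_partE f x : even_part f x = (RtoC (/ 2) * f x + RtoC (/ 2) * f (- x)%R)%C.
Proof. unfold even_part; rewrite RtoC_inv by lra; field; apply half_neq. Qed.

Lemma odd_partE f x : odd_part f x = (RtoC (/ 2) * f x + RtoC (- / 2) * f (- x)%R)%C.
Proof.
unfold odd_part; rewrite RtoC_opp, RtoC_inv by lra; field; apply half_neq.
Qed.

Lemma good_reflection_comb a (c d : C) S :
  (forall f x, S f x = (c * f x + d * f (- x)%R)%C) -> good_op a S.
Proof.
intros e; split.
- intros f hf; apply is_test_ext with (fun x => c * f x + d * f (- x)%R)%C;
    [intros; symmetry; apply e|].
  apply is_test_lin_fun; [exact hf|now apply is_test_scal, is_test_reflect].
- intros; rewrite !e; ring.
- intros f tf hf.
  apply test_null_ext with (fun n x => c * f n x + d * f n (- x)%R)%C;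
    [intros; symmetry; apply e|].
  apply test_null_lin; auto.
  + intros n; now apply is_test_scal, is_test_reflect.
  + apply (test_null_scal a d (fun n x => f n (- x))); [|now apply test_null_reflect].
    intros n; now apply is_test_reflect.
Qed.

Lemma good_even_part a : good_op a even_part.
Proof. exact (good_reflection_comb a _ _ _ even_partE). Qed.

Lemma good_odd_part a : good_op a odd_part.
Proof. exact (good_reflection_comb a _ _ _ odd_partE). Qed.

Lemma odd_part_reflect f x : odd_part f (- x) = (- odd_part f x)%C.
Proof. unfold odd_part; rewrite Ropp_involutive; field; apply half_neq. Qed.

Lemma ccont_reflect f x : ccont f (- x) -> ccont (fun t => f (- t)) x.
Proof. intros h; apply (ccont_comp f Ropp); [exact h|apply continuous_Ropp_id]. Qed.

Lemma RI_neg f a b : ccont_seg f (- a) (- b) ->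
  RI (fun x => f (- x)) a b = (- RI f (- a) (- b))%C.
Proof.
intros h; assert (e := RI_comp_affine f (-1) 0 a b).
replace (-1 * a + 0) with (- a) in e by ring; replace (-1 * b + 0) with (- b) in e by ring.
rewrite <- e by exact h.
rewrite (RI_ext (fun x => f (- x)) (fun y => f (-1 * y + 0))).
- ring.
- intros z _; f_equal; ring.
Qed.

Lemma ccont_seg_sub f a b c d : ccont_seg f a b ->
  Rmin a b <= c <= Rmax a b -> Rmin a b <= d <= Rmax a b -> ccont_seg f c d.
Proof.
intros h hc hd z hz; apply h; revert hz.
unfold Rmin at 1, Rmax at 1; destruct (Rle_dec c d); lra.
Qed.

Lemma RI_fold f b : 0 <= b -> ccont_seg f (- b) b ->
  RI f (- b) b = RI (fun x => f x + f (- x)%R)%C 0 b.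
Proof.
intros hb h.
assert (e1 : Rmin (- b) b = - b) by (apply Rmin_left; lra).
assert (e2 : Rmax (- b) b = b) by (apply Rmax_right; lra).
assert (h1 : ccont_seg f (- b) 0) by (apply ccont_seg_sub with (1 := h); rewrite e1, e2; lra).
assert (h2 : ccont_seg f 0 b) by (apply ccont_seg_sub with (1 := h); rewrite e1, e2; lra).
assert (h3 : ccont_seg f (- 0) (- b)).
{ apply ccont_seg_sub with (1 := h); rewrite e1, e2; lra. }
assert (h4 : ccont_seg (fun x => f (- x)) 0 b).
{ intros z hz; apply ccont_reflect, h; rewrite e1, e2.
  rewrite Rmin_left, Rmax_right in hz by lra; lra. }
rewrite <- (RI_Chasles f _ 0) by assumption.
rewrite RI_plus by assumption; rewrite RI_neg by assumption.
rewrite Ropp_0, (RI_swap f (- b) 0) by assumption; ring.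
Qed.

Lemma RI_odd f b : 0 <= b -> ccont_seg f (- b) b -> (forall x, f (- x) = (- f x)%C) ->
  RI f (- b) b = RtoC 0.
Proof.
intros hb h e; rewrite RI_fold by assumption.
rewrite (RI_ext _ (fun _ => RtoC 0)); [apply RI_zero|].
intros z _; rewrite e; ring.
Qed.

Lemma ccont_global_seg f a b : (forall x, ccont f x) -> ccont_seg f a b.
Proof. intros h z _; apply h. Qed.

Lemma is_test_seg a f c d : is_test a f -> ccont_seg f c d.
Proof. intros h; apply ccont_global_seg; intros x; now apply is_test_ccont with a. Qed.

Lemma RI_supported b f c d : supported_in b f -> b <= c -> b <= d -> RI f c d = RtoC 0.
Proof.
intros h hc hd; rewrite (RI_ext _ (fun _ => RtoC 0)); [apply RI_zero|].
intros z hz; apply h; assert (h' := Rle_abs z).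
revert hz; unfold Rmin; destruct (Rle_dec c d); lra.
Qed.

Lemma RI_supported_neg b f c d : supported_in b f -> c <= - b -> d <= - b -> RI f c d = RtoC 0.
Proof.
intros h hc hd; rewrite (RI_ext _ (fun _ => RtoC 0)); [apply RI_zero|].
intros z hz; apply h; assert (h' := Rle_abs (- z)); rewrite Rabs_Ropp in h'.
revert hz; unfold Rmax; destruct (Rle_dec c d); lra.
Qed.

Lemma RI_supported_eq a b f : 0 <= b <= a -> supported_in b f -> (forall x, ccont f x) ->
  RI f (- a) a = RI f (- b) b.
Proof.
intros hb hs hc.
rewrite <- (RI_Chasles f (- a) (- b)), <- (RI_Chasles f (- b) b a)
  by (apply ccont_global_seg, hc).
rewrite (RI_supported b f b a), (RI_supported_neg b f (- a) (- b)) by (auto; lra); ring.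
Qed.

(** The two branches of [Asq] are the same primitive because the integral of an odd
    function vanishes. *)
Lemma AsqE a f x : 0 < a -> is_test a f -> (forall t, f (- t) = (- f t)%C) ->
  Asq a f x = (- RI f (- a) x)%C.
Proof.
intros ha hf ho; unfold Asq.
rewrite !CInt_RI by now apply is_test_seg with a.
destruct (Rle_dec x 0) as [hx|hx]; [reflexivity|].
assert (e : (RI f (- a) x + RI f x a)%C = RtoC 0).
{ rewrite RI_Chasles by (now apply is_test_seg with a).
  apply RI_odd; [lra|now apply is_test_seg with a|exact ho]. }
replace (RI f x a) with ((RI f (- a) x + RI f x a) - RI f (- a) x)%C by ring.
rewrite e; ring.
Qed.

Lemma Asq_supported a b f : 0 < a -> 0 < b < a -> supported_in b f -> is_test a f ->
  (forall t, f (- t) = (- f t)%C) -> supported_in b (Asq a f).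
Proof.
intros ha hb hs hf ho x hx; rewrite AsqE by assumption.
destruct (Rle_dec x 0) as [h|h].
- rewrite (RI_supported_neg b); [ring|exact hs|lra|].
  rewrite Rabs_left1 in hx by lra; lra.
- rewrite <- (RI_Chasles f (- a) a x) by (now apply is_test_seg with a).
  rewrite RI_odd; [|lra|now apply is_test_seg with a|exact ho].
  rewrite (RI_supported b); [ring|exact hs|lra|].
  rewrite Rabs_right in hx by lra; lra.
Qed.

Lemma is_cderive_Asq a f x : 0 < a -> is_test a f -> (forall t, f (- t) = (- f t)%C) ->
  is_cderive (Asq a f) x (- f x)%C.
Proof.
intros ha hf ho.
apply is_cderive_ext with (fun y => - RI f (- a) y)%C.
- intros t; symmetry; now apply AsqE.
- apply is_cderive_opp, is_cderive_RI_global; intros z; now apply is_test_ccont with a.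
Qed.

Lemma good_Asq_odd a : 0 < a -> good_op a (fun f => Asq a (odd_part f)).
Proof.
intros ha.
assert (ho : forall f, is_test a f -> is_test a (odd_part f)).
{ intros f; apply good_odd_part. }
split.
- intros f hf; split.
  + apply smooth_on_of_derive with (fun x => - odd_part f x)%C; [apply open_everywhere| |].
    * intros x _; apply is_cderive_Asq; auto; apply odd_part_reflect.
    * apply smooth_on_opp; [apply open_everywhere|]; apply is_test_smooth with a; auto.
  + destruct (test_support a _ ha (ho f hf)) as [b [hb hs]].
    exists b; split; [lra|].
    apply Asq_supported; auto; apply odd_part_reflect.
- intros c f g x hf hg.
  rewrite !AsqE; auto using odd_part_reflect, is_test_lin_fun.
  rewrite (RI_ext _ (fun t => c * odd_part f t + odd_part g t)%C).
  + rewrite RI_plus, RI_scal; [ring| | |];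
      try (apply is_test_seg with a; auto).
    apply (is_test_scal a c (odd_part f)); auto.
  + intros z _; unfold odd_part; field; apply half_neq.
- intros f tf hf.
  assert (ho' := good_null _ _ (good_odd_part a) f tf hf).
  destruct (null_support a _ ha ho') as [b [hb hs]]; destruct ho' as [_ hn].
  split.
  + exists b; split; [lra|]; intros n.
    apply Asq_supported; auto; apply odd_part_reflect.
  + intros [|k].
    * apply unull_0, (unull_dom (fun n => odd_part (f n)) _ (4 * a)); [lra| |].
      -- intros n m hm x.
         destruct (Rlt_le_dec b (Rabs x)) as [hx|hx].
         ++ rewrite (Asq_supported a b); auto using odd_part_reflect.
            rewrite Cmod_0; apply Rmult_le_pos; [lra|].
            apply Rle_trans with (2 := hm 0); apply Cmod_ge_0.
         ++ rewrite AsqE, Cmod_opp; auto using odd_part_reflect.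
            eapply Rle_trans; [apply RI_bound with (M := m)|].
            ** apply is_test_seg with a; auto.
            ** auto.
            ** apply Rabs_le_between in hx; rewrite Rabs_right by lra.
               replace (4 * a * m) with (2 * m * (2 * a)) by ring.
               apply Rmult_le_compat_l; [|lra].
               assert (0 <= m) by (apply Rle_trans with (2 := hm 0); apply Cmod_ge_0); lra.
      -- exact (proj1 (unull_0 (fun n => odd_part (f n))) (hn O)).
    * apply unull_ext with (fun n x => RtoC (-1) * nderiv k (odd_part (f n)) x)%C.
      -- intros n x; symmetry.
         rewrite (nderiv_S_on everywhere _ (fun x => RtoC (-1) * odd_part (f n) x)%C);
           [|apply open_everywhere| |exact I].
         ++ apply nderiv_scal_test with a; auto.
         ++ intros y _; apply is_cderive_eq with (- odd_part (f n) y)%C; [|ring].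
            apply is_cderive_Asq; auto using odd_part_reflect.
      -- apply unull_scal, hn.
Qed.

(** * Regular distributions *)

Lemma pairing_regular a g f : 0 < a -> (forall x, interval a x -> ccont g x) -> is_test a f ->
  pairing a (regular a g) f = RI (fun x => g x * f x)%C (- a) a.
Proof.
intros ha hg.
assert (hc : forall f, is_test a f -> forall x, ccont (fun t => g t * f t)%C x).
{ intros h hh x; destruct (test_support a h ha hh) as [b [hb hs]].
  apply ccont_mult_supported with a b; auto; [lra|].
  intros y; now apply is_test_ccont with a. }
assert (he : forall f, is_test a f ->
  CInt (fun x => g x * f x)%C (- a) a = RI (fun x => g x * f x)%C (- a) a).
{ intros h hh; apply CInt_RI, ccont_global_seg; auto. }
intros hf; unfold regular.
rewrite (pairing_distr_of a (fun f => CInt (fun x => (g x * f x)%C) (- a) a));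
  [now apply he| |exact hf].
apply (is_distr_of_null a (fun f => CInt (fun x => (g x * f x)%C) (- a) a)).
- intros c h k hh hk; rewrite !he; auto using is_test_lin_fun.
  rewrite (RI_ext _ (fun x => c * (g x * h x) + g x * k x)%C) by (intros; ring).
  rewrite (RI_plus (fun x => c * (g x * h x))%C), RI_scal; auto;
    try (apply ccont_global_seg; auto).
  intros x; apply ccont_mult; [apply ccont_const|auto].
- intros h th hn; destruct (null_support a h ha hn) as [b [hb hs]].
  assert (hu : unull (fun n x => g x * h n x)%C).
  { apply (unull_mult a b); auto; [lra|].
    exact (proj1 (unull_0 h) (proj2 hn O)). }
  intros eps heps.
  assert (he' : 0 < eps / (8 * a)) by (apply Rdiv_lt_0_compat; lra).
  destruct (hu _ he') as [N hN]; exists N; intros n hn'.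
  replace (CInt (fun x => g x * h n x)%C (- a) a - RtoC 0)%C
    with (RI (fun x => g x * h n x)%C (- a) a) by (rewrite he by auto; ring).
  eapply Rle_lt_trans; [apply RI_bound with (M := eps / (8 * a))|].
  + apply ccont_global_seg; auto.
  + intros z _; left; now apply hN.
  + rewrite Rabs_right by lra.
    replace (2 * (eps / (8 * a)) * (a - - a)) with (eps / 2) by (field; lra); lra.
Qed.

(** * The Goursat kernel and the transmutation of functions *)

Lemma is_derive_curve (F Fu : R -> R -> R) (fv : R) (g h : R -> R) (x g' h' : R) :
  locally_2d (fun u v => is_derive (fun z => F z v) u (Fu u v)) (g x) (h x) ->
  continuity_2d_pt Fu (g x) (h x) ->
  is_derive (fun z => F (g x) z) (h x) fv ->
  is_derive g x g' -> is_derive h x h' ->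
  is_derive (fun t => F (g t) (h t)) x (Fu (g x) (h x) * g' + fv * h').
Proof.
intros h1 h2 h3 hg hh; apply is_derive_Reals.
apply derivable_pt_lim_comp_2d; [|now apply is_derive_Reals|now apply is_derive_Reals].
apply filterdiff_differentiable_pt_lim.
apply (is_derive_filterdiff F (g x) (h x) Fu fv).
- now apply locally_2d_locally in h1.
- exact h3.
- now apply continuity_2d_pt_filterlim in h2.
Qed.

Lemma is_cderive_curve (F Fu : R -> R -> C) (fv : C) (g h : R -> R) (x g' h' : R) :
  locally_2d (fun u v => is_cderive (fun z => F z v) u (Fu u v)) (g x) (h x) ->
  ccont2 Fu (g x) (h x) ->
  is_cderive (fun z => F (g x) z) (h x) fv ->
  is_derive g x g' -> is_derive h x h' ->
  is_cderive (fun t => F (g t) (h t)) x (RtoC g' * Fu (g x) (h x) + RtoC h' * fv)%C.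
Proof.
intros [d h1] [h2 h2'] [h3 h3'] hg hh; split.
- refine (eq_ind _ (is_derive _ x) (is_derive_curve (fun u v => Re (F u v))
    (fun u v => Re (Fu u v)) (Re fv) g h x g' h' _ h2 h3 hg hh) _ _).
  + exists d; intros u v hu hv; now apply h1.
  + simpl; unfold Re, Im; ring.
- refine (eq_ind _ (is_derive _ x) (is_derive_curve (fun u v => Im (F u v))
    (fun u v => Im (Fu u v)) (Im fv) g h x g' h' _ h2' h3' hg hh) _ _).
  + exists d; intros u v hu hv; now apply h1.
  + simpl; unfold Re, Im; ring.
Qed.

Section Kernel.

Variables (a : R) (q : R -> C) (H : R -> R -> C).
Hypothesis a_pos : 0 < a.
Hypothesis q_smooth : smooth_on (interval a) q.
Hypothesis H_goursat : goursat_solution a q H.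

Definition diamond (u v : R) : Prop := Rabs u + Rabs v < a.

Lemma diamond_sum u v : diamond u v -> interval a (u + v).
Proof.
intros h; unfold diamond in h; assert (t := Rabs_triang u v).
apply Rabs_lt_between; lra.
Qed.

Lemma interval_abs x : interval a x <-> Rabs x < a.
Proof.
split; [intros [h1 h2]; now apply Rabs_def1|intros h; apply Rabs_def2 in h; split; lra].
Qed.

Lemma abs_between_0 y t r : 0 <= r ->
  Rmin 0 y - r <= t <= Rmax 0 y + r -> Rabs t <= Rabs y + r.
Proof.
intros hr ht; apply Rabs_le; assert (h1 := Rle_abs y); assert (h2 := Rle_abs (- y)).
rewrite Rabs_Ropp in h2; revert ht; unfold Rmin, Rmax; destruct (Rle_dec 0 y); lra.
Qed.

Lemma diamond_tube x0 y0 x t : diamond x0 y0 ->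
  in_tube 0 x0 y0 ((a - Rabs x0 - Rabs y0) / 4) x t -> diamond x t.
Proof.
unfold diamond; intros h [h1 h2].
assert (ht : Rabs t <= Rabs y0 + (a - Rabs x0 - Rabs y0) / 4).
{ apply abs_between_0; lra. }
assert (hx := Rabs_triang (x - x0) x0); replace (x - x0 + x0) with x in hx by ring.
lra.
Qed.

Lemma diamond_open u v : diamond u v -> locally_2d diamond u v.
Proof.
unfold diamond; intros h.
assert (p : 0 < (a - Rabs u - Rabs v) / 2) by lra.
exists (mkposreal _ p); simpl; intros x y hx hy.
assert (tx := Rabs_triang (x - u) u); replace (x - u + u) with x in tx by ring.
assert (ty := Rabs_triang (y - v) v); replace (y - v + v) with y in ty by ring.
lra.
Qed.

Lemma q_ccont x : interval a x -> ccont q x.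
Proof. now apply smooth_on_ccont. Qed.

Lemma H_ccont2 u v : diamond u v -> ccont2 H u v.
Proof.
intros h; destruct (H_goursat u v h) as [hc _]; split; apply continuity_2d_pt_filterlim.
- apply (continuous_comp (fun p : R * R => H (fst p) (snd p)) (fun z : C => Re z) (u, v) hc).
  apply (continuous_fst (U := R_UniformSpace) (V := R_UniformSpace)).
- apply (continuous_comp (fun p : R * R => H (fst p) (snd p)) (fun z : C => Im z) (u, v) hc).
  apply (continuous_snd (U := R_UniformSpace) (V := R_UniformSpace)).
Qed.

Definition qH (u v : R) : C := (q (u + v)%R * H u v)%C.

Lemma qH_ccont2 u v : diamond u v -> ccont2 qH u v.
Proof.
intros h; apply ccont2_mult; [|now apply H_ccont2].
apply (ccont2_comp1 q Rplus); [now apply q_ccont, diamond_sum|].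
apply continuity_2d_pt_plus; [apply continuity_2d_pt_id1|apply continuity_2d_pt_id2].
Qed.

Lemma diamond_inner u v x y : diamond u v ->
  Rmin 0 u <= x <= Rmax 0 u -> Rmin 0 v <= y <= Rmax 0 v -> diamond x y.
Proof.
unfold diamond; intros h hx hy.
assert (h1 := abs_between_0 u x 0); assert (h2 := abs_between_0 v y 0); lra.
Qed.

Lemma RI_qH_ccont2 u v : diamond u v -> ccont2 (fun x y => RI (qH x) 0 y) u v.
Proof.
intros h; apply ccont2_RI with ((a - Rabs u - Rabs v) / 4); [unfold diamond in h; lra|].
intros x t ht; now apply qH_ccont2, (diamond_tube u v).
Qed.

Lemma RI_qH_ccont u v : diamond u v -> ccont (fun x => RI (qH x) 0 v) u.
Proof.
intros h; apply (ccont2_curve (fun x y => RI (qH x) 0 y) (fun x => x) (fun _ => v)).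
- now apply RI_qH_ccont2.
- apply continuous_id.
- apply continuous_const.
Qed.

Lemma mid_in x : Rmin 0 x <= 0 <= Rmax 0 x /\ Rmin 0 x <= x <= Rmax 0 x.
Proof. unfold Rmin, Rmax; destruct (Rle_dec 0 x); lra. Qed.

Lemma H_eq u v : diamond u v ->
  H u v = (RtoC (/ 2) * RI q 0 u + RI (fun x => RI (qH x) 0 v) 0 u)%C.
Proof.
intros h; destruct (H_goursat u v h) as [_ e]; rewrite e; f_equal.
- rewrite CInt_RI; [rewrite RtoC_inv by lra; field; apply half_neq|].
  intros z hz; apply q_ccont, interval_abs.
  assert (hd := diamond_inner u v z 0 h hz (proj1 (mid_in v))); unfold diamond in hd.
  rewrite Rabs_R0 in hd; lra.
- rewrite (CInt_ext _ (fun x => RI (qH x) 0 v)).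
  + apply CInt_RI; intros z hz; apply RI_qH_ccont.
    apply (diamond_inner u v); [exact h|exact hz|apply mid_in].
  + intros z hz; apply CInt_RI; intros t ht.
    apply (ccont2_slice qH), qH_ccont2, (diamond_inner u v); [exact h|lra|exact ht].
Qed.

(** The partial derivatives of H, read off the integral equation; the second derivative that
    occurs below is d(Hu)/dv = q(u+v) H. *)
Definition Hu (u v : R) : C := (RtoC (/ 2) * q u + RI (qH u) 0 v)%C.
Definition Hv (u v : R) : C := RI (fun x => qH x v) 0 u.

Lemma Hu_derive u v : diamond u v -> is_cderive (fun z => H z v) u (Hu u v).
Proof.
intros h; assert (h' := h); unfold diamond in h'.
assert (hv := Rabs_pos v); assert (hu := Rabs_pos u).
apply is_cderive_ext_loc with
  (fun z => RtoC (/ 2) * RI q 0 z + RI (fun x => RI (qH x) 0 v) 0 z)%C.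
- destruct (diamond_open u v h) as [d hd]; exists d; intros z hz.
  symmetry; apply H_eq, hd; [exact hz|rewrite Rminus_diag, Rabs_R0; apply cond_pos].
-   assert (hu' : - (a - Rabs v) < u < a - Rabs v) by (apply Rabs_lt_between; lra).
  apply is_cderive_plus; [apply is_cderive_scal|].
  + apply is_cderive_RI with (- (a - Rabs v)) (a - Rabs v); try lra.
    intros z hz; apply q_ccont; unfold interval; lra.
  + apply (is_cderive_RI (fun x => RI (qH x) 0 v) 0 u (- (a - Rabs v)) (a - Rabs v)); try lra.
    intros z hz; apply RI_qH_ccont; unfold diamond.
    assert (hz' : Rabs z < a - Rabs v) by (apply Rabs_def1; lra); lra.
Qed.

Lemma Huv_derive u v : diamond u v -> is_cderive (fun z => Hu u z) v (qH u v).
Proof.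
intros h; unfold diamond in h; assert (hv := Rabs_pos v); assert (hu := Rabs_pos u).
assert (hv' : - (a - Rabs u) < v < a - Rabs u) by (apply Rabs_lt_between; lra).
apply is_cderive_eq with (RtoC 0 + qH u v)%C; [|ring].
apply is_cderive_plus; [apply is_cderive_const|].
apply (is_cderive_RI (qH u) 0 v (- (a - Rabs u)) (a - Rabs u)); try lra.
intros z hz; apply ccont2_slice, qH_ccont2; unfold diamond.
assert (hz' : Rabs z < a - Rabs u) by (apply Rabs_def1; lra); lra.
Qed.

Lemma diamond_swap u v : diamond u v -> diamond v u.
Proof. unfold diamond; lra. Qed.

Lemma ccont2_swap F u v : ccont2 F u v -> ccont2 (fun x y => F y x) v u.
Proof.
intros h; apply (ccont2_comp F (fun x y => y) (fun x y => x)); [exact h| |].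
- apply continuity_2d_pt_id2.
- apply continuity_2d_pt_id1.
Qed.

Lemma Hv_derive u v : diamond u v -> is_cderive (fun z => H u z) v (Hv u v).
Proof.
intros h; assert (h' := h); unfold diamond in h'.
apply is_cderive_ext_loc with
  (fun z => RtoC (/ 2) * RI q 0 u + RI (fun x => RI (qH x) 0 z) 0 u)%C.
- destruct (diamond_open u v h) as [d hd]; exists d; intros z hz.
  symmetry; apply H_eq, hd; [rewrite Rminus_diag, Rabs_R0; apply cond_pos|exact hz].
- apply is_cderive_eq with (RtoC 0 + (Hv u v + RtoC 0 * RI (qH u) 0 v))%C; [|ring].
  apply is_cderive_plus; [apply is_cderive_const|].
  apply (is_cderive_RI_tube (fun z x => RI (qH x) 0 z) (fun z x => qH x z) 0 v u
    ((a - Rabs v - Rabs u) / 4) (fun _ => u) 0); [lra| | | |reflexivity|].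
  + intros x t ht; apply diamond_tube, diamond_swap in ht; [|now apply diamond_swap].
    assert (ht' := ht); unfold diamond in ht'.
    assert (p1 := Rabs_pos x); assert (p2 := Rabs_pos t).
    assert (hx : - (a - Rabs t) < x < a - Rabs t) by (apply Rabs_lt_between; lra).
    apply (is_cderive_RI (qH t) 0 x (- (a - Rabs t)) (a - Rabs t)); try lra.
    intros z hz; apply ccont2_slice, qH_ccont2; unfold diamond.
    assert (hz' : Rabs z < a - Rabs t) by (apply Rabs_def1; lra); lra.
  + intros x t ht; apply diamond_tube, diamond_swap in ht; [|now apply diamond_swap].
    now apply (ccont2_swap qH), qH_ccont2.
  + intros x t ht; apply diamond_tube, diamond_swap in ht; [|now apply diamond_swap].
    now apply RI_qH_ccont.
  + apply is_derive_Rconst.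
Qed.

Lemma Hu_ccont2 u v : diamond u v -> ccont2 Hu u v.
Proof.
intros h; apply ccont2_plus; [|now apply RI_qH_ccont2].
apply ccont2_mult; [apply ccont2_const|].
apply (ccont2_comp1 q (fun u _ => u)); [|apply continuity_2d_pt_id1].
apply q_ccont, interval_abs; assert (p := Rabs_pos v); unfold diamond in h; lra.
Qed.

Lemma Hv_ccont2 u v : diamond u v -> ccont2 Hv u v.
Proof.
intros h; apply (ccont2_swap (fun x y => RI (fun t => qH t x) 0 y) v u).
apply (ccont2_RI (fun x t => qH t x)) with ((a - Rabs v - Rabs u) / 4);
  [unfold diamond in h; lra|].
intros x t ht; apply diamond_tube, diamond_swap in ht; [|now apply diamond_swap].
now apply (ccont2_swap qH), qH_ccont2.
Qed.

Lemma H_0_v v : interval a v -> H 0 v = RtoC 0.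
Proof.
intros h; apply interval_abs in h; rewrite H_eq; [rewrite !RI_point; ring|].
unfold diamond; rewrite Rabs_R0; lra.
Qed.

Lemma Hu_u_0 u : Hu u 0 = (RtoC (/ 2) * q u)%C.
Proof. unfold Hu; rewrite RI_point; ring. Qed.

(** ** The operator on functions *)

(** Half of the integral of K(x,t) g(t) over (-x, x), after the substitution t = x - 2v. In
    this form d/dx falls on the first argument of H. *)
Definition Ht (g : R -> C) (x : R) : C :=
  RI (fun v => (H (x - v) v * g (x - 2 * v)%R)%C) 0 x.
Definition Tfun (g : R -> C) (x : R) : C := (g x + RtoC 2 * Ht g x)%C.

Lemma line_tube x0 x v : interval a x0 ->
  in_tube 0 x0 x0 ((a - Rabs x0) / 4) x v ->
  diamond (x - v) v /\ diamond v (x - v) /\ interval a (x - 2 * v) /\ interval a (2 * v - x).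
Proof.
intros h [h1 h2]; apply interval_abs in h.
assert (hd : diamond (x - v) v).
{ unfold diamond; assert (p : 0 < (a - Rabs x0) / 4) by lra.
  set (r := (a - Rabs x0) / 4) in *.
  assert (e : Rabs (x0 - v) + Rabs v <= Rabs x0 + 2 * r).
  { revert h2; unfold Rmin, Rmax; destruct (Rle_dec 0 x0); unfold Rabs;
      repeat destruct Rcase_abs; lra. }
  assert (t := Rabs_triang (x - x0) (x0 - v)).
  replace (x - x0 + (x0 - v)) with (x - v) in t by ring.
  unfold r in *; lra. }
split; [exact hd|]; split; [now apply diamond_swap|].
unfold diamond in hd; rewrite !interval_abs.
assert (t := Rabs_triang (x - v) (- v)); rewrite Rabs_Ropp in t.
replace (x - v + - v) with (x - 2 * v) in t by ring.
rewrite (Rabs_minus_sym (2 * v) x); lra.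
Qed.

Lemma line_seg x v : interval a x -> Rmin 0 x <= v <= Rmax 0 x ->
  diamond (x - v) v /\ diamond v (x - v) /\ interval a (x - 2 * v) /\ interval a (2 * v - x).
Proof.
intros hx hv; apply (line_tube x x v hx).
assert (h := proj1 (interval_abs x) hx).
split; [rewrite Rminus_diag, Rabs_R0; lra|lra].
Qed.

Lemma ccont2_line F x v : ccont2 F (x - v) v -> ccont2 (fun x v => F (x - v)%R v) x v.
Proof.
intros h; apply (ccont2_comp F (fun x v => x - v) (fun _ v => v)); [exact h| |]; cont2_affine.
Qed.

Lemma ccont2_line' F x v : ccont2 F v (x - v) -> ccont2 (fun x v => F v (x - v)%R) x v.
Proof.
intros h; apply (ccont2_comp F (fun _ v => v) (fun x v => x - v)); [exact h| |]; cont2_affine.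
Qed.

Lemma ccont2_arg g x v : ccont g (x - 2 * v) -> ccont2 (fun x v => g (x - 2 * v)%R) x v.
Proof. intros h; apply (ccont2_comp1 g (fun x v => x - 2 * v)); [exact h|]; cont2_affine. Qed.

Lemma ccont2_arg' g x v : ccont g (2 * v - x) -> ccont2 (fun x v => g (2 * v - x)%R) x v.
Proof. intros h; apply (ccont2_comp1 g (fun x v => 2 * v - x)); [exact h|]; cont2_affine. Qed.

Definition ccont_I (g : R -> C) : Prop := forall x, interval a x -> ccont g x.

Lemma tube_pos x : interval a x -> 0 < (a - Rabs x) / 4.
Proof. rewrite interval_abs; lra. Qed.

Lemma Ht_ccont g : ccont_I g -> ccont_I (Ht g).
Proof.
intros hg x hx.
apply (ccont2_curve (fun x y => RI (fun v => (H (x - v) v * g (x - 2 * v)%R)%C) 0 y)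
  (fun x => x) (fun x => x)); try apply continuous_id.
apply (ccont2_RI (fun x v => (H (x - v) v * g (x - 2 * v)%R)%C)) with ((a - Rabs x) / 4);
  [now apply tube_pos|].
intros y v hv; destruct (line_tube x y v hx hv) as [h1 [_ [h2 _]]].
apply ccont2_mult; [now apply ccont2_line, H_ccont2|now apply ccont2_arg, hg].
Qed.

Lemma Tfun_ccont g : ccont_I g -> ccont_I (Tfun g).
Proof.
intros hg x hx; apply ccont_plus; [now apply hg|].
apply ccont_mult; [apply ccont_const|now apply Ht_ccont].
Qed.

Lemma RI_line (f : R -> C) x : ccont_seg f 0 x ->
  RI (fun v => f (x - v)%R) 0 x = RI f 0 x.
Proof.
intros h; assert (e := RI_comp_affine f (-1) x 0 x).
replace (-1 * 0 + x) with x in e by ring; replace (-1 * x + x) with 0 in e by ring.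
rewrite (RI_swap f 0 x) in e by exact h.
rewrite (RI_ext _ (fun y => f (-1 * y + x))) by (intros; f_equal; ring).
assert (e' : (RtoC (-1) * RI (fun y => f (-1 * y + x)%R) 0 x)%C = (- RI f 0 x)%C).
{ apply e; intros z hz; apply h; now rewrite Rmin_comm, Rmax_comm in hz. }
replace (RI (fun y => f (-1 * y + x)%R) 0 x)
  with (- (RtoC (-1) * RI (fun y => f (-1 * y + x)%R) 0 x))%C by ring.
rewrite e'; ring.
Qed.

(** With u = x - v as variable, d/dx falls on the second argument of H instead. *)
Lemma Ht_line g x : ccont_I g -> interval a x ->
  Ht g x = RI (fun u => (H u (x - u) * g (2 * u - x)%R)%C) 0 x.
Proof.
intros hg hx; rewrite <- RI_line.
- apply RI_ext; intros v _; f_equal; [f_equal|f_equal]; ring.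
- intros u hu; destruct (line_seg x u hx hu) as [_ [h1 [_ h2]]].
  apply (ccont2_slice (fun x u => (H u (x - u) * g (2 * u - x)%R)%C)).
  apply ccont2_mult; [now apply ccont2_line', H_ccont2|now apply ccont2_arg', hg].
Qed.

(** The derivative of [Ht g] when g' is the derivative of g; the boundary term vanishes
    because H(0,x) = 0. *)
Definition dHt (g g' : R -> C) (x : R) : C :=
  RI (fun v => (Hu (x - v) v * g (x - 2 * v)%R + H (x - v) v * g' (x - 2 * v)%R)%C) 0 x.

Lemma Ht_derive g g' x : (forall y, interval a y -> is_cderive g y (g' y)) -> ccont_I g' ->
  interval a x -> is_cderive (Ht g) x (dHt g g' x).
Proof.
intros hg hg' hx.
assert (hgc : ccont_I g) by (intros y hy; eapply is_cderive_ccont, hg, hy).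
eapply is_cderive_eq.
- apply (is_cderive_RI_tube (fun x v => (H (x - v) v * g (x - 2 * v)%R)%C)
    (fun x v => (Hu (x - v) v * g (x - 2 * v)%R + H (x - v) v * g' (x - 2 * v)%R)%C)
    0 x x ((a - Rabs x) / 4) (fun y => y) 1); [now apply tube_pos| | | |reflexivity|].
  + intros y v hv; destruct (line_tube x y v hx hv) as [h1 [_ [h2 _]]].
    apply (is_cderive_mult (fun z => H (z - v) v) (fun z => g (z - 2 * v)%R)).
    * apply is_cderive_eq with (RtoC 1 * Hu (y - v) v)%C; [|ring].
      apply (is_cderive_comp (fun z => H z v) (fun y => y - v)); [now apply Hu_derive|].
      auto_derive; [auto|ring].
    * apply is_cderive_eq with (RtoC 1 * g' (y - 2 * v)%R)%C; [|ring].
      apply (is_cderive_comp g (fun y => y - 2 * v)); [now apply hg|].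
      auto_derive; [auto|ring].
  + intros y v hv; destruct (line_tube x y v hx hv) as [h1 [_ [h2 _]]].
    apply ccont2_plus; apply ccont2_mult.
    * now apply ccont2_line, Hu_ccont2.
    * now apply ccont2_arg, hgc.
    * now apply ccont2_line, H_ccont2.
    * now apply ccont2_arg, hg'.
  + intros y v hv; destruct (line_tube x y v hx hv) as [h1 [_ [h2 _]]].
    apply (ccont2_slice (fun y v => (H (y - v) v * g (y - 2 * v)%R)%C)).
    apply ccont2_mult; [now apply ccont2_line, H_ccont2|now apply ccont2_arg, hgc].
  + apply (is_derive_id (K := R_AbsRing)).
- rewrite Rminus_diag, H_0_v by exact hx; unfold dHt; ring.
Qed.

Lemma dHt_line g g' x : ccont_I g -> ccont_I g' -> interval a x ->
  dHt g g' x = RI (fun u => (Hu u (x - u) * g (2 * u - x)%R + H u (x - u) * g' (2 * u - x)%R)%C) 0 x.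
Proof.
intros hg hg' hx; rewrite <- RI_line.
- apply RI_ext; intros v _; f_equal; f_equal; f_equal; ring.
- intros u hu; destruct (line_seg x u hx hu) as [_ [h1 [_ h2]]].
  apply (ccont2_slice (fun x u =>
    (Hu u (x - u) * g (2 * u - x)%R + H u (x - u) * g' (2 * u - x)%R)%C)).
  apply ccont2_plus; apply ccont2_mult.
  + now apply ccont2_line', Hu_ccont2.
  + now apply ccont2_arg', hg.
  + now apply ccont2_line', H_ccont2.
  + now apply ccont2_arg', hg'.
Qed.

(** The second derivative: once u is the variable of integration, d/dx acts on the
    second argument of Hu, where H_uv = q(u+v) H, and what is left over is the
    derivative of H(u,x-u) g'(2u-x) along the segment. *)
Lemma dHt_derive g g' g'' x :
  (forall y, interval a y -> is_cderive g y (g' y)) ->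
  (forall y, interval a y -> is_cderive g' y (g'' y)) -> ccont_I g'' ->
  interval a x ->
  is_cderive (dHt g g') x (RtoC (/ 2) * q x * g x + q x * Ht g x + Ht g'' x)%C.
Proof.
intros hg hg' hg'' hx.
assert (hgc : ccont_I g) by (intros y hy; eapply is_cderive_ccont, hg, hy).
assert (hgc' : ccont_I g') by (intros y hy; eapply is_cderive_ccont, hg', hy).
set (A := fun x u : R => (qH u (x - u) * g (2 * u - x)%R)%C).
set (B := fun x u : R => (H u (x - u) * g'' (2 * u - x)%R)%C).
set (E := fun x u : R => (H u (x - u) * g' (2 * u - x)%R)%C).
set (E' := fun x u : R => ((Hu u (x - u) - Hv u (x - u)) * g' (2 * u - x)%R
                          + RtoC 2 * B x u)%C).
assert (cA : forall y v, diamond v (y - v) -> interval a (2 * v - y) -> ccont2 A y v).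
{ intros y v h1 h2; apply ccont2_mult; [now apply ccont2_line', qH_ccont2|now apply ccont2_arg', hgc]. }
assert (cB : forall y v, diamond v (y - v) -> interval a (2 * v - y) -> ccont2 B y v).
{ intros y v h1 h2; apply ccont2_mult; [now apply ccont2_line', H_ccont2|now apply ccont2_arg', hg'']. }
assert (cE' : forall y v, diamond v (y - v) -> interval a (2 * v - y) -> ccont2 E' y v).
{ intros y v h1 h2; apply ccont2_plus; apply ccont2_mult.
  - apply ccont2_minus; [now apply ccont2_line', Hu_ccont2|now apply ccont2_line', Hv_ccont2].
  - now apply ccont2_arg', hgc'.
  - apply ccont2_const.
  - now apply cB. }
assert (seg : forall F : R -> R -> C,
  (forall y v, diamond v (y - v) -> interval a (2 * v - y) -> ccont2 F y v) ->
  ccont_seg (F x) 0 x).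
{ intros F hF u hu; destruct (line_seg x u hx hu) as [_ [h1 [_ h2]]].
  now apply ccont2_slice, hF. }
assert (eE : RI (E' x) 0 x = (H x 0 * g' x)%C).
{ rewrite (RI_FTC (E x)); [|intros u hu|now apply seg].
  - unfold E; rewrite Rminus_diag, Rminus_0_r, H_0_v by exact hx.
    replace (2 * x - x) with x by ring; ring.
  - destruct (line_seg x u hx hu) as [_ [h1 [_ h2]]].
    eapply is_cderive_eq.
    + apply (is_cderive_mult (fun u => H u (x - u)) (fun u => g' (2 * u - x)%R)).
      * apply (is_cderive_curve H Hu (Hv u (x - u)) (fun u => u) (fun u => x - u) u 1 (-1)).
        -- destruct (diamond_open u (x - u) h1) as [d hd]; exists d.
           intros y z hy hz; apply Hu_derive; now apply hd.
        -- now apply Hu_ccont2.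
        -- now apply Hv_derive.
        -- apply (is_derive_id (K := R_AbsRing)).
        -- auto_derive; [auto|ring].
      * apply (is_cderive_comp g' (fun u => 2 * u - x) u (g'' (2 * u - x)%R) 2); [now apply hg'|].
        auto_derive; [auto|ring].
    + unfold E', B; ring. }
apply is_cderive_ext_loc with
  (fun x => RI (fun u => (Hu u (x - u) * g (2 * u - x)%R + H u (x - u) * g' (2 * u - x)%R)%C) 0 x).
{ eapply filter_imp; [|exact (open_interval a x hx)]; intros y hy; symmetry.
  now apply dHt_line. }
eapply is_cderive_eq.
- apply (is_cderive_RI_tube
    (fun x u => (Hu u (x - u) * g (2 * u - x)%R + H u (x - u) * g' (2 * u - x)%R)%C)
    (fun x u => (A x u + (B x u - E' x u))%C)
    0 x x ((a - Rabs x) / 4) (fun y => y) 1); [now apply tube_pos| | | |reflexivity|].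
  + intros y u hu; destruct (line_tube x y u hx hu) as [_ [h1 [_ h2]]].
    eapply is_cderive_eq.
    * apply (is_cderive_plus (fun y => Hu u (y - u) * g (2 * u - y)%R)%C
               (fun y => H u (y - u) * g' (2 * u - y)%R)%C); apply is_cderive_mult.
      -- apply (is_cderive_comp (fun z => Hu u z) (fun y => y - u) y (qH u (y - u)) 1);
           [now apply Huv_derive|auto_derive; [auto|ring]].
      -- apply (is_cderive_comp g (fun y => 2 * u - y) y (g' (2 * u - y)%R) (-1));
           [now apply hg|auto_derive; [auto|ring]].
      -- apply (is_cderive_comp (fun z => H u z) (fun y => y - u) y (Hv u (y - u)) 1);
           [now apply Hv_derive|auto_derive; [auto|ring]].
      -- apply (is_cderive_comp g' (fun y => 2 * u - y) y (g'' (2 * u - y)%R) (-1));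
           [now apply hg'|auto_derive; [auto|ring]].
    * unfold A, B, E'; unfold B; ring.
  + intros y u hu; destruct (line_tube x y u hx hu) as [_ [h1 [_ h2]]].
    apply ccont2_plus; [now apply cA|]; apply ccont2_minus; [now apply cB|now apply cE'].
  + intros y u hu; destruct (line_tube x y u hx hu) as [_ [h1 [_ h2]]].
    apply (ccont2_slice (fun x u =>
      (Hu u (x - u) * g (2 * u - x)%R + H u (x - u) * g' (2 * u - x)%R)%C)).
    apply ccont2_plus; apply ccont2_mult.
    * now apply ccont2_line', Hu_ccont2.
    * now apply ccont2_arg', hgc.
    * now apply ccont2_line', H_ccont2.
    * now apply ccont2_arg', hgc'.
  + apply (is_derive_id (K := R_AbsRing)).
- assert (sA := seg A cA); assert (sB := seg B cB); assert (sE := seg E' cE').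
  rewrite RI_plus; [|exact sA|apply ccont_seg_plus; [exact sB|now apply ccont_seg_opp]].
  rewrite RI_minus by assumption; rewrite eE.
  rewrite Rminus_diag, Hu_u_0; replace (2 * x - x) with x by ring.
  rewrite (Ht_line g), (Ht_line g'') by assumption.
  replace (RI (A x) 0 x) with (q x * RI (fun u => (H u (x - u) * g (2 * u - x)%R)%C) 0 x)%C.
  + unfold B; ring.
  + rewrite <- RI_scal.
    * apply RI_ext; intros u _; unfold A, qH.
      replace (u + (x - u)) with x by ring; ring.
    * apply (seg (fun x u => (H u (x - u) * g (2 * u - x)%R)%C)).
      intros y v h1 h2; apply ccont2_mult;
        [now apply ccont2_line', H_ccont2|now apply ccont2_arg', hgc].
Qed.

Definition dTfun (g g' : R -> C) (x : R) : C := (g' x + RtoC 2 * dHt g g' x)%C.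

Lemma Tfun_derive g g' x : (forall y, interval a y -> is_cderive g y (g' y)) -> ccont_I g' ->
  interval a x -> is_cderive (Tfun g) x (dTfun g g' x).
Proof.
intros hg hg' hx; apply is_cderive_plus; [now apply hg|].
now apply is_cderive_scal, Ht_derive.
Qed.

(** The term q g of (T g)'' is twice the value Hu(x,0) = q(x)/2 at the end of the segment,
    times g(x). *)
Lemma dTfun_derive g g' g'' x :
  (forall y, interval a y -> is_cderive g y (g' y)) ->
  (forall y, interval a y -> is_cderive g' y (g'' y)) -> ccont_I g'' ->
  interval a x ->
  is_cderive (dTfun g g') x (q x * Tfun g x + Tfun g'' x)%C.
Proof.
intros hg hg' hg'' hx; eapply is_cderive_eq.
- apply is_cderive_plus; [now apply hg'|].
  apply is_cderive_scal; now apply dHt_derive with (g'' := g'').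
- unfold Tfun.
  replace (RtoC 2 * (RtoC (/ 2) * q x * g x + q x * Ht g x + Ht g'' x))%C with
    (RtoC 2 * RtoC (/ 2) * (q x * g x) + RtoC 2 * (q x * Ht g x + Ht g'' x))%C by ring.
  rewrite <- RtoC_mult, Rinv_r by lra; ring.
Qed.

Lemma Tfun_0 g : Tfun g 0 = g 0.
Proof. unfold Tfun, Ht; rewrite RI_point; ring. Qed.

Lemma dTfun_0 g g' : dTfun g g' 0 = g' 0.
Proof. unfold dTfun, dHt; rewrite RI_point; ring. Qed.

(** Two derivatives of T g are expressed by T g and T(g''), so the order of
    differentiability climbs by two at each step. *)
Lemma Tfun_smooth g : smooth_on (interval a) g -> smooth_on (interval a) (Tfun g).
Proof.
intros hg; apply diffn_smooth_on; [apply open_interval|].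
intros k; assert (h : forall g, smooth_on (interval a) g ->
  diffn (interval a) k (Tfun g) /\ diffn (interval a) (S k) (Tfun g)); [|now apply h].
clear g hg; induction k as [|k IH]; intros g hg.
- split; [exact I|]; exists (dTfun g (nderiv 1 g)); split; [|exact I].
  intros x hx; apply Tfun_derive; [|intros y; apply smooth_on_ccont|exact hx].
  + intros y hy; now apply smooth_on_cderive with (interval a).
  + now apply smooth_on_nderiv1.
- split; [now apply IH|].
  assert (h1 := smooth_on_nderiv1 _ _ hg); assert (h2 := smooth_on_nderiv1 _ _ h1).
  exists (dTfun g (nderiv 1 g)); split.
  + intros x hx; apply Tfun_derive; [|intros y; now apply smooth_on_ccont|exact hx].
    intros y hy; now apply smooth_on_cderive with (interval a).
  + exists (fun x => q x * Tfun g x + Tfun (nderiv 1 (nderiv 1 g)) x)%C; split.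
    * intros x hx; apply dTfun_derive; auto.
      -- intros y hy; now apply smooth_on_cderive with (interval a).
      -- intros y hy; now apply smooth_on_cderive with (interval a).
      -- intros y hy; now apply smooth_on_ccont with (interval a).
    * apply diffn_plus; [apply diffn_mult|]; [now apply smooth_on_diffn| |]; now apply IH.
Qed.

Lemma kernel_ccont2 x t : interval a x -> interval a t -> ccont2 (kernel H) x t.
Proof.
intros hx ht; unfold kernel.
apply (ccont2_comp H (fun x t => (x + t) / 2) (fun x t => (x - t) / 2)).
- apply H_ccont2; unfold diamond; destruct hx, ht; unfold Rabs; repeat destruct Rcase_abs; lra.
- apply continuity_2d_pt_mult; cont2_affine.
- apply continuity_2d_pt_mult; cont2_affine.
Qed.

Lemma Tfun_kernel g x : ccont_I g -> interval a x ->
  Tfun g x = (g x + RI (fun t => (kernel H x t * g t)%C) (- x) x)%C.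
Proof.
intros hg hx; unfold Tfun; f_equal.
assert (hc : ccont_seg (fun t => (kernel H x t * g t)%C) (- x) x).
{ intros z hz.
  assert (hz' : interval a z).
  { destruct hx; revert hz; unfold Rmin, Rmax, interval; destruct (Rle_dec (- x) x); lra. }
  apply ccont_mult; [|now apply hg].
  now apply (ccont2_slice (kernel H)), kernel_ccont2. }
assert (e := RI_comp_affine (fun t => (kernel H x t * g t)%C) (-2) x 0 x).
replace (-2 * 0 + x) with x in e by ring; replace (-2 * x + x) with (- x) in e by ring.
rewrite (RI_swap _ (- x) x) in e by exact hc.
assert (e2 : Ht g x = RI (fun y => (kernel H x (-2 * y + x) * g (-2 * y + x)%R)%C) 0 x).
{ apply RI_ext; intros v _; unfold kernel.
  f_equal; [|f_equal; ring]; f_equal; field. }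
assert (e3 : (RtoC (-2) * Ht g x)%C = (- RI (fun t => (kernel H x t * g t)%C) (- x) x)%C).
{ rewrite e2; apply e; intros z hz; apply hc; now rewrite Rmin_comm, Rmax_comm in hz. }
replace (RI (fun t => (kernel H x t * g t)%C) (- x) x) with (- (RtoC (-2) * Ht g x))%C
  by (rewrite e3; ring).
replace (RtoC (-2)) with (- RtoC 2)%C by (apply C_eq; simpl; ring).
ring.
Qed.

End Kernel.

(** * Duality between the two operators *)

Definition ccont_I2 (a : R) (n : R -> R -> C) : Prop :=
  forall x y, interval a x -> interval a y -> ccont2 n x y.

Lemma ccont2_RI_box a n x y : ccont_I2 a n -> interval a x -> interval a y ->
  ccont2 (fun x y => RI (n x) 0 y) x y.
Proof.
intros hn hx hy; apply interval_abs in hx, hy.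
assert (q1 := Rmin_l (a - Rabs x) (a - Rabs y)).
assert (q2 := Rmin_r (a - Rabs x) (a - Rabs y)).
assert (p : 0 < Rmin (a - Rabs x) (a - Rabs y)) by (apply Rmin_glb_lt; lra).
apply (ccont2_RI n) with (Rmin (a - Rabs x) (a - Rabs y)); [exact p|].
set (r := Rmin (a - Rabs x) (a - Rabs y)) in *.
intros u t [h1 h2]; apply hn.
- apply interval_abs; assert (s := Rabs_triang (u - x) x).
  replace (u - x + x) with u in s by ring; lra.
- assert (h3 := Rle_abs y); assert (h4 := Rle_abs (- y)); rewrite Rabs_Ropp in h4.
  revert h2; unfold Rmin at 1, Rmax, interval; destruct (Rle_dec 0 y); lra.
Qed.

Lemma ccont2_swap_I2 a n : ccont_I2 a n -> ccont_I2 a (fun x y => n y x).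
Proof. intros h x y hx hy; now apply ccont2_swap, h. Qed.

Lemma interval_0 a x : interval a x -> interval a 0.
Proof. unfold interval; lra. Qed.

Lemma interval_between a x y z : interval a x -> interval a y ->
  Rmin x y <= z <= Rmax x y -> interval a z.
Proof. unfold interval, Rmin, Rmax; destruct (Rle_dec x y); lra. Qed.

Lemma I2_seg a n x c d : ccont_I2 a n -> interval a x -> interval a c -> interval a d ->
  ccont_seg (n x) c d.
Proof.
intros h hx hc hd z hz; apply ccont2_slice, h; [exact hx|].
now apply interval_between with c d.
Qed.

Lemma ccont_RI_moving a n (c d : R -> R) x : ccont_I2 a n -> interval a x ->
  (forall y, interval a y -> interval a (c y)) -> (forall y, interval a y -> interval a (d y)) ->
  continuous c x -> continuous d x ->
  ccont (fun y => RI (n y) (c y) (d y)) x.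
Proof.
intros hn hx hc hd cc cd.
apply ccont_ext_loc with (fun y => RI (n y) 0 (d y) - RI (n y) 0 (c y))%C.
- eapply filter_imp; [|exact (open_interval a x hx)]; intros y hy.
  assert (h0 := interval_0 a y hy).
  rewrite <- (RI_Chasles (n y) 0 (c y) (d y)) by (apply I2_seg with a; auto); ring.
- apply ccont_minus.
  + apply (ccont2_curve (fun x y => RI (n x) 0 y) (fun x => x) d);
      [now apply ccont2_RI_box with a; auto|apply continuous_id|exact cd].
  + apply (ccont2_curve (fun x y => RI (n x) 0 y) (fun x => x) c);
      [now apply ccont2_RI_box with a; auto|apply continuous_id|exact cc].
Qed.

(** Dirichlet's formula: both sides have the same derivative in b. *)
Lemma RI_triangle a n b : ccont_I2 a n -> 0 <= b < a ->
  RI (fun x => RI (fun t => n t x) x b) 0 b = RI (fun t => RI (n t) 0 t) 0 b.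
Proof.
intros hn hb.
assert (hn' := ccont2_swap_I2 a n hn).
set (D := fun B => (RI (fun x => RI (fun t => n t x) x B) 0 B
                    - RI (fun t => RI (n t) 0 t) 0 B)%C).
assert (e : D 0 = D b).
{ apply is_cderive_zero_const; intros B hB.
  rewrite Rmin_left, Rmax_right in hB by lra.
  assert (hBI : interval a B) by (unfold interval; lra).
  apply is_cderive_eq with
    ((RI (n B) 0 B + RtoC 1 * RI (fun t => n t B) B B) - RI (n B) 0 B)%C;
    [|rewrite RI_point; ring].
  apply is_cderive_minus.
  - assert (tube : forall x t, in_tube 0 B B ((a - B) / 2) x t -> interval a x /\ interval a t).
    { intros x t [h1 h2]; apply Rabs_def2 in h1.
      rewrite Rmin_left, Rmax_right in h2 by lra; unfold interval; lra. }
    apply (is_cderive_RI_tube (fun B x => RI (fun t => n t x) x B) n 0 B B ((a - B) / 2)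
      (fun B => B) 1); [lra| | | |reflexivity|apply (is_derive_id (K := R_AbsRing))].
    + intros x t h; destruct (tube x t h) as [hx ht].
      apply (is_cderive_RI (fun s => n s t) t x (- a) a); auto.
      intros z hz; apply (ccont2_slice (fun t s => n s t)); now apply hn'.
    + intros x t h; destruct (tube x t h); now apply hn.
    + intros x t h; destruct (tube x t h) as [hx ht].
      apply (ccont_RI_moving a (fun y s => n s y) (fun y => y) (fun _ => x)); auto.
      * apply continuous_id.
      * apply continuous_const.
  - apply (is_cderive_RI (fun t => RI (n t) 0 t) 0 B (- a) a); try (unfold interval in *; lra).
    intros z hz; apply (ccont_RI_moving a n (fun _ => 0) (fun y => y)); auto.
    + intros y; apply interval_0.
    + apply continuous_const.
    + apply continuous_id. }
unfold D in e; rewrite !RI_point in e.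
replace (RI (fun x => RI (fun t => n t x) x b) 0 b) with
  ((RI (fun x => RI (fun t => n t x) x b) 0 b - RI (fun t => RI (n t) 0 t) 0 b)
   + RI (fun t => RI (n t) 0 t) 0 b)%C by ring.
rewrite <- e; ring.
Qed.

Lemma interval_neg a x : interval a x -> interval a (- x).
Proof. unfold interval; lra. Qed.

Lemma interval_Rabs a x : interval a x -> interval a (Rabs x).
Proof. intros h; apply interval_abs in h; apply interval_abs; now rewrite Rabs_Rabsolu. Qed.

Lemma RInt_nonneg_zero (f : R -> R) c d : (forall x, continuous f x) -> (forall x, 0 <= f x) ->
  RInt f c d = 0 -> forall x, c < x < d -> f x = 0.
Proof.
intros hc hf h0 x hx.
assert (hex : forall s t, ex_RInt f s t) by (intros s t; apply ex_RInt_cont; auto).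
assert (hm : forall s t, s <= t -> 0 <= RInt f s t).
{ intros s t hst; apply RInt_ge_0; auto. }
assert (hz : forall y, c <= y <= d -> RInt f c y = 0).
{ intros y hy; assert (e : RInt f c y + RInt f y d = RInt f c d).
  { apply (RInt_Chasles (V := R_CompleteNormedModule)); auto. }
  assert (h1 := hm c y ltac:(lra)); assert (h2 := hm y d ltac:(lra)); lra. }
assert (d1 : is_derive (fun y => RInt f c y) x (f x)).
{ apply is_derive_RInt_upper with (c - 1) (d + 1); auto; lra. }
assert (d2 : is_derive (fun y => RInt f c y) x 0).
{ apply is_derive_ext_loc with (fun _ => 0);
    [|apply is_derive_Rconst].
  assert (p : 0 < Rmin (x - c) (d - x)) by (apply Rmin_glb_lt; lra).
  exists (mkposreal _ p); intros y hy; change (Rabs (y - x) < Rmin (x - c) (d - x)) in hy.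
  assert (q1 := Rmin_l (x - c) (d - x)); assert (q2 := Rmin_r (x - c) (d - x)).
  apply Rabs_def2 in hy; symmetry; apply hz; lra. }
rewrite <- (is_derive_unique _ _ _ d1); exact (is_derive_unique _ _ _ d2).
Qed.

(** The integrand is r |h|^2, in the form that a bilinear pairing with a multiple of the
    conjugate of h produces. *)
Lemma RI_conj_zero (r : R -> R) h c d : (forall x, continuous r x) -> (forall x, 0 <= r x) ->
  (forall x, ccont (fun t => RtoC (r t) * (Cconj (h t) * h t))%C x) ->
  RI (fun t => RtoC (r t) * (Cconj (h t) * h t))%C c d = RtoC 0 ->
  forall x, c < x < d -> 0 < r x -> h x = RtoC 0.
Proof.
intros hr hr0 hc e x hx hrx.
assert (er : forall t, Re (RtoC (r t) * (Cconj (h t) * h t))%C =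
  r t * (Re (h t) * Re (h t) + Im (h t) * Im (h t))).
{ intros t; simpl; unfold Re, Im; ring. }
assert (z := RInt_nonneg_zero (fun t => Re (RtoC (r t) * (Cconj (h t) * h t))%C) c d).
assert (hz : Re (RtoC (r x) * (Cconj (h x) * h x))%C = 0).
{ apply z; auto.
  - intros t; exact (proj1 (hc t)).
  - intros t; rewrite er; apply Rmult_le_pos; auto.
    assert (h1 := Rle_0_sqr (Re (h t))); assert (h2 := Rle_0_sqr (Im (h t)));
      unfold Rsqr in *; lra.
  - exact (f_equal Re e). }
rewrite er in hz; apply Rmult_integral in hz; destruct hz as [hz|hz]; [lra|].
apply C_eq; simpl; nra.
Qed.

(** The primitive g f' - g' f vanishes at both ends. *)
Lemma RI_green f f1 f2 g g1 g2 c d :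
  (forall x, Rmin c d <= x <= Rmax c d -> is_cderive f x (f1 x) /\ is_cderive f1 x (f2 x) /\
     is_cderive g x (g1 x) /\ is_cderive g1 x (g2 x) /\ ccont f2 x /\ ccont g2 x) ->
  f c = RtoC 0 -> f1 c = RtoC 0 -> f d = RtoC 0 -> f1 d = RtoC 0 ->
  RI (fun x => g x * f2 x)%C c d = RI (fun x => g2 x * f x)%C c d.
Proof.
intros h e1 e2 e3 e4.
assert (cg : ccont_seg (fun x => g x * f2 x)%C c d).
{ intros x hx; destruct (h x hx) as [h1 [h2 [h3 [h4 [h5 h6]]]]].
  apply ccont_mult; [eapply is_cderive_ccont, h3|exact h5]. }
assert (cf : ccont_seg (fun x => g2 x * f x)%C c d).
{ intros x hx; destruct (h x hx) as [h1 [h2 [h3 [h4 [h5 h6]]]]].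
  apply ccont_mult; [exact h6|eapply is_cderive_ccont, h1]. }
assert (e : RI (fun x => g x * f2 x - g2 x * f x)%C c d = RtoC 0).
{ rewrite (RI_FTC (fun x => g x * f1 x - g1 x * f x)%C).
  - rewrite e1, e2, e3, e4; ring.
  - intros x hx; destruct (h x hx) as [h1 [h2 [h3 [h4 [h5 h6]]]]].
    eapply is_cderive_eq;
      [apply is_cderive_minus; apply is_cderive_mult; eassumption|ring].
  - apply ccont_seg_plus; [exact cg|now apply ccont_seg_opp]. }
rewrite RI_minus in e by assumption.
replace (RI (fun x => g x * f2 x)%C c d) with
  ((RI (fun x => g x * f2 x)%C c d - RI (fun x => g2 x * f x)%C c d)
   + RI (fun x => g2 x * f x)%C c d)%C by ring.
rewrite e; ring.
Qed.

Section Transpose.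

Variables (a : R) (q : R -> C) (H : R -> R -> C).
Hypothesis a_pos : 0 < a.
Hypothesis q_smooth : smooth_on (interval a) q.
Hypothesis H_goursat : goursat_solution a q H.

Let K := kernel H.
Let T := Tsq a K.
Let TT := Tfun H.

Lemma K_I2 : ccont_I2 a K.
Proof. intros x y hx hy; now apply (kernel_ccont2 a q H). Qed.

(** The two integrals of [Tsq] folded onto t > 0. Being odd in t, this kernel makes the
    absolute value in the limits of integration harmless. *)
Definition fold_kernel (f : R -> C) (x t : R) : C :=
  (K t x * f t - K (- t) x * f (- t)%R)%C.

Section Continuous.

Variables (b : R) (f : R -> C).
Hypothesis hb : 0 < b < a.
Hypothesis f_cont : forall x, ccont f x.
Hypothesis f_supp : supported_in b f.

Lemma fold_kernel_I2 : ccont_I2 a (fold_kernel f).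
Proof.
intros x t hx ht; apply ccont2_minus; apply ccont2_mult.
- apply (ccont2_swap K); now apply K_I2.
- apply (ccont2_comp1 f (fun x t => t)); [apply f_cont|cont2_affine].
- apply (ccont2_comp K (fun x t => - t) (fun x t => x)); [|cont2_affine|cont2_affine].
  apply K_I2; [now apply interval_neg|exact hx].
- apply (ccont2_comp1 f (fun x t => - t)); [apply f_cont|cont2_affine].
Qed.

Lemma TsqE x : interval a x -> T f x = (f x + RI (fold_kernel f x) (Rabs x) b)%C.
Proof.
intros hx; unfold T, Tsq.
assert (hc : forall t, ccont (fun t => K t x * f t)%C t).
{ intros t; apply ccont_mult_supported with a b; auto; [lra|].
  intros y hy; apply (ccont2_slice (fun x t => K t x)), (ccont2_swap K); now apply K_I2. }
assert (hs : supported_in b (fun t => K t x * f t)%C).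
{ intros t ht; rewrite f_supp by exact ht; apply Cmult_0_r. }
assert (sg : forall c d, ccont_seg (fun t => K t x * f t)%C c d).
{ intros c d; now apply ccont_global_seg. }
rewrite !CInt_RI by apply sg.
rewrite <- (RI_Chasles _ (- a) (- b) (- Rabs x)) by apply sg.
rewrite <- (RI_Chasles _ (Rabs x) b a) by apply sg.
rewrite (RI_supported_neg b _ (- a) (- b)), (RI_supported b _ b a) by (auto; lra).
assert (e := RI_neg _ (Rabs x) b (sg (- Rabs x) (- b))).
rewrite <- (RI_swap _ (- Rabs x) (- b)) in e by apply sg.
rewrite <- e.
unfold fold_kernel.
rewrite (RI_minus (fun t => K t x * f t)%C (fun t => K (- t) x * f (- t)%R)%C);
  [ring|apply sg|].
intros z _; apply (ccont_reflect (fun t => K t x * f t)%C), hc.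
Qed.

Lemma Tsq_supported : supported_in b (T f).
Proof.
intros x hx; unfold T, Tsq; rewrite f_supp by exact hx.
rewrite (CInt_ext _ (fun _ => RtoC 0) (- a)), (CInt_ext _ (fun _ => RtoC 0) (Rabs x)).
- rewrite !CInt_RI, !RI_zero by (intros z _; apply ccont_const). ring.
- intros z hz; rewrite f_supp; [apply Cmult_0_r|].
  assert (h := Rle_abs z); revert hz; unfold Rmin; destruct (Rle_dec (Rabs x) a); lra.
- intros z hz; rewrite f_supp; [apply Cmult_0_r|].
  assert (h := Rle_abs (- z)); rewrite Rabs_Ropp in h.
  revert hz; unfold Rmax; destruct (Rle_dec (- a) (- Rabs x)); lra.
Qed.

Lemma RI_fold_ccont x : interval a x -> ccont (fun x => RI (fold_kernel f x) (Rabs x) b) x.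
Proof.
intros hx; apply (ccont_RI_moving a (fold_kernel f) Rabs (fun _ => b));
  [apply fold_kernel_I2|exact hx|apply interval_Rabs| |apply continuous_Rabs|apply continuous_const].
intros _ _; unfold interval; lra.
Qed.

Lemma Tsq_ccont x : ccont (T f) x.
Proof.
destruct (Rlt_le_dec b (Rabs x)) as [hx|hx].
- apply ccont_ext_loc with (fun _ => RtoC 0); [|apply ccont_const].
  eapply filter_imp; [|exact (supported_loc b _ x Tsq_supported hx)]; intros t ->; reflexivity.
- assert (hx' : interval a x) by (apply interval_abs; lra).
  apply ccont_ext_loc with (fun x => f x + RI (fold_kernel f x) (Rabs x) b)%C.
  + eapply filter_imp; [|exact (open_interval a x hx')]; intros t ht; symmetry; now apply TsqE.
  + apply ccont_plus; [apply f_cont|now apply RI_fold_ccont].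
Qed.

(** Both sides are the integral of K(t,x) g(x) f(t) over |x| < |t| < b, with the sign of t. *)
Lemma Tsq_dual g : ccont_I a g ->
  RI (fun x => g x * T f x)%C (- b) b = RI (fun t => TT g t * f t)%C (- b) b.
Proof.
intros hg.
assert (hbI : forall x, Rmin (- b) b <= x <= Rmax (- b) b -> interval a x).
{ intros x hx; rewrite Rmin_left, Rmax_right in hx by lra; unfold interval; lra. }
set (P := fun x => (g x * RI (fold_kernel f x) (Rabs x) b)%C).
set (J := fun t => RI (fun x => K t x * g x)%C (- t) t).
assert (KgI2 : ccont_I2 a (fun t x => K t x * g x)%C).
{ intros t x ht hx; apply ccont2_mult; [now apply K_I2|].
  apply (ccont2_comp1 g (fun t x => x)); [now apply hg|cont2_affine]. }
set (n := fun t x => (g x * fold_kernel f x t + g (- x)%R * fold_kernel f (- x) t)%C).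
assert (n0I2 : ccont_I2 a (fun t x => g x * fold_kernel f x t)%C).
{ intros t x ht hx; apply ccont2_mult.
  - apply (ccont2_comp1 g (fun t x => x)); [now apply hg|cont2_affine].
  - apply (ccont2_swap (fold_kernel f)); now apply fold_kernel_I2. }
assert (nI2 : ccont_I2 a n).
{ intros t x ht hx; apply ccont2_plus; [now apply n0I2|].
  apply (ccont2_comp (fun t x => g x * fold_kernel f x t)%C (fun t x => t) (fun t x => - x));
    [apply n0I2; [exact ht|now apply interval_neg]|cont2_affine|cont2_affine]. }
assert (cP : ccont_I a P).
{ intros x hx; apply ccont_mult; [now apply hg|now apply RI_fold_ccont]. }
assert (cJ : ccont_I a J).
{ intros t ht; apply (ccont_RI_moving a (fun t x => K t x * g x)%C Ropp (fun t => t)); auto.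
  - intros y; apply interval_neg.
  - apply continuous_Ropp_id.
  - apply continuous_id. }
assert (cgf : ccont_seg (fun x => g x * f x)%C (- b) b).
{ intros x hx; apply ccont_mult; [now apply hg, hbI|apply f_cont]. }
rewrite (RI_ext _ (fun x => g x * f x + P x)%C).
2:{ intros x hx; rewrite TsqE; [unfold P; ring|]; apply hbI; lra. }
rewrite (RI_ext (fun t => TT g t * f t)%C (fun t => g t * f t + J t * f t)%C).
2:{ intros x hx; unfold TT; rewrite (Tfun_kernel a q H); auto; [unfold J, K; ring|].
    apply hbI; lra. }
rewrite RI_plus; [|exact cgf|intros x hx; now apply cP, hbI].
rewrite RI_plus; [|exact cgf|intros x hx; apply ccont_mult; [now apply cJ, hbI|apply f_cont]].
f_equal.
rewrite RI_fold; [|lra|intros x hx; now apply cP, hbI].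
rewrite RI_fold; [|lra|intros x hx; apply ccont_mult; [now apply cJ, hbI|apply f_cont]].
transitivity (RI (fun x => RI (fun t => n t x) x b) 0 b).
- apply RI_ext; intros x hx; rewrite Rmin_left, Rmax_right in hx by lra.
  assert (hx1 : interval a x) by (unfold interval; lra).
  assert (hx2 : interval a (- x)) by (unfold interval; lra).
  assert (hx3 : interval a b) by (unfold interval; lra).
  unfold P; rewrite Rabs_Ropp, (Rabs_right x) by lra.
  assert (s1 : ccont_seg (fold_kernel f x) x b) by (now apply (I2_seg a _ _ _ _ fold_kernel_I2)).
  assert (s2 : ccont_seg (fold_kernel f (- x)) x b)
    by (now apply (I2_seg a _ _ _ _ fold_kernel_I2)).
  assert (cc : forall c : C, ccont_seg (fun _ => c) x b) by (intros c z _; apply ccont_const).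
  unfold n; rewrite (RI_plus (fun t => g x * fold_kernel f x t)%C
    (fun t => g (- x)%R * fold_kernel f (- x) t)%C) by (apply ccont_seg_mult; [apply cc|assumption]).
  rewrite !RI_scal by assumption; reflexivity.
- rewrite (RI_triangle a); [|exact nI2|lra].
  apply RI_ext; intros t ht; rewrite Rmin_left, Rmax_right in ht by lra.
  assert (ht1 : interval a t) by (unfold interval; lra).
  assert (ht2 : interval a (- t)) by (unfold interval; lra).
  unfold n; rewrite <- (RI_fold (fun x => g x * fold_kernel f x t)%C); [|lra|].
  2:{ apply (I2_seg a (fun t x => g x * fold_kernel f x t)%C); auto. }
  unfold J; rewrite Ropp_involutive.
  assert (s1 : ccont_seg (fun x => K t x * g x)%C (- t) t)
    by (now apply (I2_seg a (fun t x => K t x * g x)%C)).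
  assert (s2 : ccont_seg (fun x => K (- t) x * g x)%C (- t) t)
    by (now apply (I2_seg a (fun t x => K t x * g x)%C)).
  rewrite (RI_swap (fun x => K (- t) x * g x)%C (- t) t) by exact s2.
  rewrite (RI_ext _ (fun x => f t * (K t x * g x) - f (- t)%R * (K (- t) x * g x))%C).
  2:{ intros x _; unfold fold_kernel; ring. }
  rewrite (RI_minus (fun x => f t * (K t x * g x))%C (fun x => f (- t)%R * (K (- t) x * g x))%C).
  + rewrite !RI_scal by assumption; ring.
  + apply (ccont_seg_mult (fun _ => f t)); [intros z _; apply ccont_const|exact s1].
  + apply (ccont_seg_mult (fun _ => f (- t))); [intros z _; apply ccont_const|exact s2].
Qed.

End Continuous.

(** The operator d^2/dx^2 - q, which is its own transpose. *)
Definition Lop (f : R -> C) (x : R) : C := (nderiv 1 (nderiv 1 f) x - q x * f x)%C.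

Lemma is_test_Lop f : is_test a f -> is_test a (Lop f).
Proof.
intros hf; apply is_test_plus; [now apply is_test_nderiv1, is_test_nderiv1|].
now apply is_test_opp, is_test_mult.
Qed.

Lemma Lop_supported b f : supported_in b f -> supported_in b (Lop f).
Proof.
intros hs x hx; unfold Lop.
rewrite (nderiv_supported b (nderiv 1 f) 1 (nderiv_supported b f 1 hs) x hx), hs by exact hx.
ring.
Qed.

Section Support.

(* With b0 < b, a function supported in [-b0, b0] vanishes to all orders at both ends of
   (-b, b), where Green's formula is applied. *)
Variables (b0 b : R).
Hypothesis hb0 : 0 < b0 < b.
Hypothesis hb : b < a.

Lemma in_I x : Rmin (- b) b <= x <= Rmax (- b) b -> interval a x.
Proof. intros hx; rewrite Rmin_left, Rmax_right in hx by lra; unfold interval; lra. Qed.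

Lemma abs_b : b0 < Rabs b /\ b0 < Rabs (- b).
Proof. rewrite Rabs_Ropp, Rabs_right by lra; lra. Qed.

(** By duality and Green's formula, the classical property (T g)'' - q T g = T(g'') becomes
    a weak form of (T f)'' = T(f'' - q f) for the transposed operator. *)
Lemma Tsq_Lop_dual f g g1 g2 : is_test a f -> supported_in b0 f ->
  (forall x, is_cderive g x (g1 x)) -> (forall x, is_cderive g1 x (g2 x)) ->
  (forall x, ccont g2 x) ->
  RI (fun x => g2 x * T f x)%C (- b) b = RI (fun x => g x * T (Lop f) x)%C (- b) b.
Proof.
intros hf hs hg hg1 hg2.
assert (tc : forall h x, is_test a h -> ccont h x) by (intros; now apply is_test_ccont with a).
assert (gc : ccont_I a g) by (intros x _; eapply is_cderive_ccont, hg).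
assert (g1c : ccont_I a g1) by (intros x _; eapply is_cderive_ccont, hg1).
assert (g2c : ccont_I a g2) by (intros x _; apply hg2).
assert (hf1 := is_test_nderiv1 a f hf); assert (hf2 := is_test_nderiv1 a _ hf1).
assert (hs' : supported_in b f) by (apply supported_le with b0; auto; lra).
assert (hs1 := nderiv_supported b0 f 1 hs).
rewrite (Tsq_dual b f); auto; try lra.
rewrite (Tsq_dual b (Lop f)); auto using Lop_supported; try lra.
2:{ intros x; apply tc, is_test_Lop, hf. }
assert (cT : ccont_I a (TT g)) by (apply (Tfun_ccont a q H); auto).
assert (cT2 : ccont_I a (TT g2)) by (apply (Tfun_ccont a q H); auto).
assert (cqT : ccont_I a (fun x => q x * TT g x)%C).
{ intros x hx; apply ccont_mult; [now apply smooth_on_ccont with (interval a)|auto]. }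
assert (e : RI (fun x => TT g x * nderiv 1 (nderiv 1 f) x)%C (- b) b =
            RI (fun x => (q x * TT g x + TT g2 x) * f x)%C (- b) b).
{ destruct abs_b.
  apply (RI_green f (nderiv 1 f) (nderiv 1 (nderiv 1 f)) (TT g) (dTfun q H g g1)).
  - intros x hx; assert (hx' := in_I x hx).
    exact (conj (is_test_cderive a f x hf) (conj (is_test_cderive a _ x hf1)
      (conj (Tfun_derive a q H q_smooth H_goursat g g1 x (fun y _ => hg y) g1c hx')
      (conj (dTfun_derive a q H q_smooth H_goursat g g1 g2 x (fun y _ => hg y)
               (fun y _ => hg1 y) g2c hx')
      (conj (tc _ x hf2) (ccont_plus _ _ x (cqT x hx') (cT2 x hx'))))))).
  - now apply hs.
  - now apply hs1.
  - now apply hs.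
  - now apply hs1. }
transitivity (RI (fun x => (q x * TT g x + TT g2 x) * f x - (q x * TT g x) * f x)%C (- b) b).
- apply RI_ext; intros; ring.
- rewrite RI_minus, <- e, <- RI_minus.
  + apply RI_ext; intros; unfold Lop; ring.
  + intros x hx; apply ccont_mult; auto using in_I.
  + intros x hx; apply ccont_mult; auto using in_I.
  + intros x hx; apply ccont_mult; auto; apply ccont_plus; auto using in_I.
  + intros x hx; apply ccont_mult; auto using in_I.
Qed.

(** [T f] is the second primitive of [T (Lop f)] that vanishes to the left of the
    support: the difference is orthogonal to every g'' with g of class C^2, hence to its
    own conjugate. *)
Lemma Tsq_second_primitive f : is_test a f -> supported_in b0 f ->
  forall x, is_cderive (T f) x (RI (T (Lop f)) (- b) x).
Proof.
intros hf hs.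
assert (hLs := Lop_supported b0 f hs).
assert (hL := is_test_Lop f hf).
assert (cf : forall x, ccont f x) by (intros; now apply is_test_ccont with a).
assert (cLf : forall x, ccont (Lop f) x) by (intros; now apply is_test_ccont with a).
set (w := T f); set (z := T (Lop f)).
assert (cw : forall x, ccont w x) by (apply (Tsq_ccont b0 f); auto; lra).
assert (cz : forall x, ccont z x) by (apply (Tsq_ccont b0 (Lop f)); auto; lra).
assert (sw : supported_in b0 w) by (apply (Tsq_supported b0 f); auto; lra).
assert (sz : supported_in b0 z) by (apply (Tsq_supported b0 (Lop f)); auto; lra).
set (Z1 := fun x => RI z (- b) x); set (Z := fun x => RI Z1 (- b) x).
assert (dZ1 : forall x, is_cderive Z1 x (z x)) by (intros; now apply is_cderive_RI_global).
assert (cZ1 : forall x, ccont Z1 x) by (intros; eapply is_cderive_ccont, dZ1).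
assert (dZ : forall x, is_cderive Z x (Z1 x)) by (intros; now apply is_cderive_RI_global).
assert (cZ : forall x, ccont Z x) by (intros; eapply is_cderive_ccont, dZ).
assert (dual := Tsq_Lop_dual f); fold w z in dual.
assert (seg : forall (h : R -> C) c d, (forall x, ccont h x) -> ccont_seg h c d)
  by (intros; now apply ccont_global_seg).
assert (m0 : Z1 b = RtoC 0).
{ assert (e := dual (fun _ => RtoC 1) (fun _ => RtoC 0) (fun _ => RtoC 0) hf hs
    (fun x => is_cderive_const _ x) (fun x => is_cderive_const _ x)
    (fun x => ccont_const _ x)).
  rewrite (RI_ext _ (fun _ => RtoC 0)), RI_zero in e by (intros; ring).
  unfold Z1; rewrite (RI_ext _ (fun x => RtoC 1 * z x)%C) by (intros; ring).
  now symmetry. }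
assert (m1 : Z b = RtoC 0).
{ assert (di : forall x, is_cderive (fun t => RtoC t) x (RtoC 1)).
  { intros x; apply is_cderive_RtoC, (is_derive_id (K := R_AbsRing)). }
  assert (e := dual (fun x => RtoC x) (fun _ => RtoC 1) (fun _ => RtoC 0) hf hs di
    (fun x => is_cderive_const _ x) (fun x => ccont_const _ x)).
  rewrite (RI_ext _ (fun _ => RtoC 0)), RI_zero in e by (intros; ring).
  rewrite (RI_FTC (fun x => RtoC x * Z1 x - Z x)%C) in e.
  - assert (z1 : Z1 (- b) = RtoC 0) by apply RI_point.
    assert (z0 : Z (- b) = RtoC 0) by apply RI_point.
    rewrite m0, z1, z0 in e.
    replace (Z b) with (- (RtoC b * RtoC 0 - Z b - (RtoC (- b) * RtoC 0 - RtoC 0)))%C by ring.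
    rewrite <- e; ring.
  - intros x _; eapply is_cderive_eq;
      [apply is_cderive_minus; [apply is_cderive_mult|]; auto|ring].
  - apply seg; intros x; apply ccont_mult; [eapply is_cderive_ccont, di|auto]. }
assert (far : forall x, b <= Rabs x -> Z1 x = RtoC 0 /\ Z x = RtoC 0).
{ assert (left : forall x, x <= - b -> Z1 x = RtoC 0).
  { intros x hx; apply (RI_supported_neg b); [apply supported_le with b0; auto; lra|lra|lra]. }
  assert (right : forall x, b <= x -> Z1 x = RtoC 0).
  { intros x hx; unfold Z1; rewrite <- (RI_Chasles z (- b) b x) by auto.
    fold (Z1 b); rewrite m0, (RI_supported b); [ring| |lra|lra].
    apply supported_le with b0; auto; lra. }
  intros x hx; destruct (Rle_dec x 0) as [h|h].
  - rewrite Rabs_left1 in hx by lra; split; [apply left; lra|].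
    unfold Z; rewrite (RI_ext _ (fun _ => RtoC 0)); [apply RI_zero|].
    intros t ht; apply left; rewrite Rmax_left in ht by lra; lra.
  - rewrite Rabs_right in hx by lra; split; [apply right; lra|].
    unfold Z; rewrite <- (RI_Chasles Z1 (- b) b x) by auto; fold (Z b); rewrite m1.
    rewrite (RI_ext _ (fun _ => RtoC 0)); [rewrite RI_zero; ring|].
    intros t ht; apply right; rewrite Rmin_left in ht by lra; lra. }
assert (ew : forall x, w x = Z x).
{ set (h := fun x => (w x - Z x)%C).
  assert (ch : forall x, ccont h x) by (intros x; apply ccont_minus; auto).
  set (g2 := fun x => Cconj (h x)).
  assert (cg2 : forall x, ccont g2 x) by (intros x; apply ccont_conj, ch).
  set (g1 := fun x => RI g2 0 x); set (g := fun x => RI g1 0 x).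
  assert (dg1 : forall x, is_cderive g1 x (g2 x)) by (intros; now apply is_cderive_RI_global).
  assert (cg1 : forall x, ccont g1 x) by (intros; eapply is_cderive_ccont, dg1).
  assert (dg : forall x, is_cderive g x (g1 x)) by (intros; now apply is_cderive_RI_global).
  assert (e := dual g g1 g2 hf hs dg dg1 cg2).
  assert (eg : RI (fun x => g x * z x)%C (- b) b = RI (fun x => g2 x * Z x)%C (- b) b).
  { apply (RI_green Z Z1 z g g1 g2); auto.
    - intros x _; exact (conj (dZ x) (conj (dZ1 x) (conj (dg x) (conj (dg1 x)
        (conj (cz x) (cg2 x)))))).
    - apply RI_point.
    - apply RI_point. }
  rewrite eg in e.
  assert (e0 : RI (fun x => RtoC 1 * (Cconj (h x) * h x))%C (- b) b = RtoC 0).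
  { rewrite (RI_ext _ (fun x => g2 x * w x - g2 x * Z x)%C).
    - rewrite RI_minus, e; [ring| |]; apply seg; intros x; apply ccont_mult; auto.
    - intros x _; unfold g2, h; ring. }
  intros x; destruct (Rlt_le_dec (Rabs x) b) as [hx|hx].
  - apply Rabs_lt_between in hx.
    assert (hz : h x = RtoC 0).
    { apply (RI_conj_zero (fun _ => 1) h (- b) b); auto; try lra.
      - intros; apply continuous_const.
      - intros; lra.
      - intros t; apply ccont_mult; [apply ccont_const|apply ccont_mult; auto]. }
    replace (w x) with (h x + Z x)%C by (unfold h; ring); rewrite hz; ring.
  - rewrite (proj2 (far x hx)); apply sw; lra. }
intros x; apply is_cderive_ext with Z; [intros t; symmetry; apply ew|apply dZ].
Qed.

End Support.

Lemma test_support2 f : is_test a f ->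
  exists b0 b, 0 < b0 < b /\ b < a /\ supported_in b0 f.
Proof.
intros hf; destruct (test_support a f a_pos hf) as [b0 [h1 h2]].
exists b0, ((b0 + a) / 2); repeat split; auto; lra.
Qed.

Lemma Tsq_test_ccont f x : is_test a f -> ccont (T f) x.
Proof.
intros hf; destruct (test_support a f a_pos hf) as [b [h1 h2]].
apply (Tsq_ccont b); auto; intros y; now apply is_test_ccont with a.
Qed.

Lemma Tsq_diff2 f : is_test a f -> exists w1, forall x,
  is_cderive (T f) x (w1 x) /\ is_cderive w1 x (T (Lop f) x).
Proof.
intros hf; destruct (test_support2 f hf) as [b0 [b [h1 [h2 h3]]]].
exists (fun x => RI (T (Lop f)) (- b) x); intros x; split.
- now apply (Tsq_second_primitive b0 b).
- apply is_cderive_RI_global; intros y; apply Tsq_test_ccont, is_test_Lop, hf.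
Qed.

Lemma Tsq_smooth f : is_test a f -> smooth_on everywhere (T f).
Proof.
intros hf; apply diffn_smooth_on; [apply open_everywhere|]; intros k.
assert (h : forall f, is_test a f ->
  diffn everywhere k (T f) /\ diffn everywhere (S k) (T f)); [|now apply h].
clear f hf; induction k as [|k IH]; intros f hf; destruct (Tsq_diff2 f hf) as [w1 hw].
- split; [exact I|]; exists w1; split; [intros x _; apply hw|exact I].
- split; [now apply IH|]; exists w1; split; [intros x _; apply hw|].
  exists (T (Lop f)); split; [intros x _; apply hw|now apply IH, is_test_Lop].
Qed.

(** Two derivatives of [T f] are [T (Lop f)], and [Lop f] is a test function again, so
    continuity of all the [T f] implies their smoothness. *)
Lemma is_test_Tsq f : is_test a f -> is_test a (T f).
Proof.
intros hf; split; [now apply Tsq_smooth|].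
destruct (test_support a f a_pos hf) as [b [h1 h2]].
exists b; split; [lra|apply (Tsq_supported b); auto].
Qed.

Lemma Tsq_Lop f x : is_test a f -> nderiv 1 (nderiv 1 (T f)) x = T (Lop f) x.
Proof.
intros hf; destruct (Tsq_diff2 f hf) as [w1 hw].
rewrite <- nderiv_S.
rewrite (nderiv_S_on everywhere _ w1); [|apply open_everywhere|intros y _; apply hw|exact I].
apply nderiv_1, hw.
Qed.

Lemma Tsq_lin c f g x : is_test a f -> is_test a g ->
  T (fun t => c * f t + g t)%C x = (c * T f x + T g x)%C.
Proof.
intros hf hg.
destruct (test_support a f a_pos hf) as [b1 [h1 s1]], (test_support a g a_pos hg) as [b2 [h2 s2]].
set (b := Rmax b1 b2).
assert (hb : 0 < b < a).
{ split; [apply Rlt_le_trans with b1; [lra|apply Rmax_l]|apply Rmax_lub_lt; lra]. }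
assert (sf : supported_in b f) by (apply supported_le with b1; auto; apply Rmax_l).
assert (sg : supported_in b g) by (apply supported_le with b2; auto; apply Rmax_r).
assert (sfg : supported_in b (fun t => c * f t + g t)%C).
{ intros t ht; rewrite sf, sg by exact ht; ring. }
assert (cf : forall x, ccont f x) by (intros; now apply is_test_ccont with a).
assert (cg : forall x, ccont g x) by (intros; now apply is_test_ccont with a).
assert (cfg : forall x, ccont (fun t => c * f t + g t)%C x).
{ intros t; apply ccont_plus; [apply ccont_mult; [apply ccont_const|auto]|auto]. }
destruct (Rlt_le_dec b (Rabs x)) as [hx|hx].
- rewrite !(Tsq_supported b) by auto; ring.
- assert (hx' : interval a x) by (apply interval_abs; lra).
  rewrite !(TsqE b) by auto.
  assert (sgm : forall h, (forall x, ccont h x) -> ccont_seg (fold_kernel h x) (Rabs x) b).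
  { intros h hh; apply (I2_seg a); auto using fold_kernel_I2, interval_Rabs.
    unfold interval; lra. }
  rewrite (RI_ext _ (fun t => c * fold_kernel f x t + fold_kernel g x t)%C).
  2:{ intros t _; unfold fold_kernel; ring. }
  rewrite (RI_plus (fun t => c * fold_kernel f x t)%C), RI_scal; auto; [ring|].
  apply (ccont_seg_mult (fun _ => c)); [intros z _; apply ccont_const|auto].
Qed.

Lemma unull_Tsq b f : 0 < b < a -> (forall n x, ccont (f n) x) ->
  (forall n, supported_in b (f n)) -> unull f -> unull (fun n => T (f n)).
Proof.
intros hb cf sf.
destruct (compact_bounded K (- b) b (- b) b) as [M [hM1 hM2]].
{ intros x y hx hy; apply K_I2; unfold interval; lra. }
apply (unull_dom _ _ (1 + 8 * M * b)).
{ assert (0 <= M * b) by (apply Rmult_le_pos; lra); lra. }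
intros n m hm x.
assert (hm0 : 0 <= m) by (apply Rle_trans with (2 := hm 0); apply Cmod_ge_0).
assert (hMb : 0 <= M * b) by (apply Rmult_le_pos; lra).
destruct (Rlt_le_dec b (Rabs x)) as [hx|hx].
- rewrite (Tsq_supported b) by auto; rewrite Cmod_0; apply Rmult_le_pos; lra.
- assert (hx' : interval a x) by (apply interval_abs; lra).
  rewrite (TsqE b) by auto.
  eapply Rle_trans; [apply Cmod_triangle|].
  assert (hbx : Rmin (Rabs x) b = Rabs x /\ Rmax (Rabs x) b = b)
    by (split; [apply Rmin_left|apply Rmax_right]; lra).
  assert (hx0 := Rabs_pos x).
  assert (hi : Cmod (RI (fold_kernel (f n) x) (Rabs x) b) <= 2 * (2 * M * m) * Rabs (b - Rabs x)).
  { apply RI_bound.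
    - apply (I2_seg a); auto using fold_kernel_I2, interval_Rabs.
      unfold interval; lra.
    - intros t ht; rewrite (proj1 hbx), (proj2 hbx) in ht.
      apply Rabs_le_between in hx.
      unfold fold_kernel, Cminus; eapply Rle_trans; [apply Cmod_triangle|].
      rewrite Cmod_opp, !Cmod_mult.
      replace (2 * M * m) with (M * m + M * m) by ring.
      apply Rplus_le_compat; apply Rmult_le_compat; auto using Cmod_ge_0; apply hM2; lra. }
  rewrite (Rabs_right (b - Rabs x)) in hi by lra.
  assert (hi2 : 2 * (2 * M * m) * (b - Rabs x) <= 4 * (M * m) * b).
  { replace (2 * (2 * M * m)) with (4 * (M * m)) by ring.
    apply Rmult_le_compat_l; [|lra].
    apply Rmult_le_pos; [lra|apply Rmult_le_pos; lra]. }
  specialize (hm x).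
  assert (0 <= M * b * m) by (apply Rmult_le_pos; lra).
  replace ((1 + 8 * M * b) * m) with (m + 8 * (M * b * m)) by ring.
  replace (4 * (M * m) * b) with (4 * (M * b * m)) in hi2 by ring.
  lra.
Qed.

Lemma test_null_Lop f : (forall n, is_test a (f n)) -> test_null a f ->
  test_null a (fun n => Lop (f n)).
Proof.
intros tf hf.
apply test_null_ext with
  (fun n x => RtoC (-1) * (q x * f n x) + nderiv 1 (nderiv 1 (f n)) x)%C.
- intros n x; unfold Lop; apply C_eq; simpl; unfold Re, Im; ring.
- apply (test_null_lin a (RtoC (-1)) (fun n x => q x * f n x)%C
    (fun n => nderiv 1 (nderiv 1 (f n)))).
  + intros n; now apply is_test_mult.
  + intros n; now apply is_test_nderiv1, is_test_nderiv1.
  + now apply test_null_mult.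
  + now apply (test_null_nderiv1 a (fun n => nderiv 1 (f n))), test_null_nderiv1.
Qed.

(** The same climb by two orders, now for uniform estimates. *)
Lemma test_null_Tsq f : (forall n, is_test a (f n)) -> test_null a f ->
  test_null a (fun n => T (f n)).
Proof.
intros tf hf; split.
{ destruct (null_support a f a_pos hf) as [b [h1 h2]].
  exists b; split; [lra|]; intros n; now apply (Tsq_supported b). }
intros k; assert (h : forall f, (forall n, is_test a (f n)) -> test_null a f ->
  unull (fun n => nderiv k (T (f n))) /\ unull (fun n => nderiv (S k) (T (f n))));
  [|now apply h].
clear f tf hf; induction k as [|k IH]; intros f tf hf.
- destruct (null_support a f a_pos hf) as [b0 [h0 h3]].
  set (b := (b0 + a) / 2); assert (h1 : 0 < b0 < b) by (unfold b; lra).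
  assert (h2 : b < a) by (unfold b; lra).
  assert (u0 : forall g, (forall n, is_test a (g n)) -> test_null a g ->
    (forall n, supported_in b0 (g n)) -> unull (fun n => T (g n))).
  { intros g tg hg sg; apply (unull_Tsq b0); auto.
    - intros n x; now apply is_test_ccont with a.
    - exact (proj1 (unull_0 g) (proj2 hg O)). }
  split; [now apply unull_0, u0|].
  apply (unull_dom (fun n => T (Lop (f n))) _ (4 * a)); [lra| |].
  + intros n m hm x.
    assert (hm0 : 0 <= m) by (apply Rle_trans with (2 := hm 0); apply Cmod_ge_0).
    rewrite (nderiv_1 _ _ _ (Tsq_second_primitive b0 b h1 h2 (f n) (tf n) (h3 n) x)).
    assert (hs : supported_in b0 (nderiv 1 (T (f n)))).
    { apply nderiv_supported, (Tsq_supported b0); auto; lra. }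
    destruct (Rlt_le_dec b (Rabs x)) as [hx|hx].
    * rewrite <- (nderiv_1 _ _ _ (Tsq_second_primitive b0 b h1 h2 (f n) (tf n) (h3 n) x)).
      rewrite hs by lra; rewrite Cmod_0; apply Rmult_le_pos; lra.
    * eapply Rle_trans; [apply RI_bound with (M := m); [|auto]|].
      -- apply ccont_global_seg; intros y; apply Tsq_test_ccont, is_test_Lop, tf.
      -- apply Rabs_le_between in hx; rewrite Rabs_right by lra.
         replace (4 * a * m) with (2 * m * (2 * a)) by ring.
         apply Rmult_le_compat_l; lra.
  + apply u0.
    * intros n; apply is_test_Lop, tf.
    * now apply test_null_Lop.
    * intros n; now apply Lop_supported.
- split; [now apply IH|].
  destruct (IH (fun n => Lop (f n))) as [h _].
  + intros n; apply is_test_Lop, tf.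
  + now apply test_null_Lop.
  + apply unull_ext with (2 := h); intros n x.
    rewrite (nderiv_S (T (f n)) (S k)), (nderiv_S (nderiv 1 (T (f n))) k).
    apply nderiv_ext; intros t; symmetry; now apply Tsq_Lop.
Qed.

Lemma good_Tsq : good_op a T.
Proof.
split; [exact is_test_Tsq|exact Tsq_lin|exact test_null_Tsq].
Qed.

(** This is [Tsq_dual], read as an equality of distributions. *)
Lemma T_op_regular g : ccont_I a g -> T_op K (regular a g) = regular a (TT g).
Proof.
intros hg; apply distr_eq; intros f hf.
unfold T_op; rewrite (pairing_transpose a (Tsq a K)) by (auto; exact good_Tsq).
assert (cT : ccont_I a (TT g)) by (apply (Tfun_ccont a q H); auto).
rewrite !pairing_regular; auto; [|exact (is_test_Tsq f hf)].
destruct (test_support a f a_pos hf) as [b [hb hs]].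
assert (cf : forall x, ccont f x) by (intros; now apply is_test_ccont with a).
rewrite !(RI_supported_eq a b); try lra.
- now apply (Tsq_dual b f).
- intros x hx; rewrite hs by exact hx; apply Cmult_0_r.
- intros x; apply ccont_mult_supported with a b; auto; lra.
- intros x hx.
  rewrite (Tsq_supported b f) by auto; apply Cmult_0_r.
- intros x; apply (ccont_mult_supported a b); auto; try lra.
  + apply (Tsq_ccont b); auto.
  + apply (Tsq_supported b); auto.
Qed.

End Transpose.

(** * Bump functions *)

Definition flat (n : nat) (x : R) : R :=
  if Rlt_dec 0 x then (/ x) ^ n * exp (- / x) else 0.

Lemma flat_pos n x : 0 < x -> flat n x = (/ x) ^ n * exp (- / x).
Proof. intros h; unfold flat; destruct (Rlt_dec 0 x); [reflexivity|contradiction]. Qed.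

Lemma flat_neg n x : x <= 0 -> flat n x = 0.
Proof. intros h; unfold flat; destruct (Rlt_dec 0 x); [lra|reflexivity]. Qed.

Lemma exp_nat_mult (m : nat) t : exp (INR m * t) = exp t ^ m.
Proof.
induction m as [|m IH]; [simpl; rewrite Rmult_0_l; apply exp_0|].
rewrite S_INR; replace ((INR m + 1) * t) with (t + INR m * t) by ring.
rewrite exp_plus, IH; reflexivity.
Qed.

(** The power m+1 of s/(m+1) <= exp(s/(m+1)). *)
Lemma pow_le_exp (m : nat) s : 0 <= s -> s ^ S m <= INR (S m) ^ S m * exp s.
Proof.
intros hs; assert (hm : 0 < INR (S m)) by (apply lt_0_INR; lia).
assert (e : s / INR (S m) <= exp (s / INR (S m))).
{ assert (h := exp_ineq1_le (s / INR (S m))); lra. }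
assert (h0 : 0 <= s / INR (S m)).
{ apply Rmult_le_pos; [exact hs|left; now apply Rinv_0_lt_compat]. }
assert (h := pow_incr _ _ (S m) (conj h0 e)).
rewrite <- exp_nat_mult in h.
replace (INR (S m) * (s / INR (S m))) with s in h by (field; lra).
replace (s ^ S m) with (INR (S m) ^ S m * (s / INR (S m)) ^ S m).
- apply Rmult_le_compat_l; [apply pow_le; lra|exact h].
- rewrite <- Rpow_mult_distr; f_equal; field; lra.
Qed.

Lemma flat_quadratic n x : Rabs (flat n x) <= INR (S (S n)) ^ S (S n) * x ^ 2.
Proof.
destruct (Rlt_le_dec 0 x) as [h|h].
- rewrite flat_pos by exact h.
  assert (hs : 0 < / x) by now apply Rinv_0_lt_compat.
  rewrite Rabs_right.
  2:{ apply Rle_ge, Rmult_le_pos; [apply pow_le; lra|left; apply exp_pos]. }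
  assert (e := pow_le_exp (S n) (/ x) (Rlt_le _ _ hs)).
  rewrite exp_Ropp.
  assert (hexp := exp_pos (/ x)).
  apply Rmult_le_reg_r with (exp (/ x)); [exact hexp|].
  replace ((/ x) ^ n * / exp (/ x) * exp (/ x)) with ((/ x) ^ n) by (field; lra).
  replace ((/ x) ^ n) with ((/ x) ^ S (S n) * x ^ 2) by (simpl; field; lra).
  replace (INR (S (S n)) ^ S (S n) * x ^ 2 * exp (/ x)) with
    (INR (S (S n)) ^ S (S n) * exp (/ x) * x ^ 2) by ring.
  apply Rmult_le_compat_r; [apply pow2_ge_0|exact e].
- rewrite flat_neg by exact h; rewrite Rabs_R0.
  apply Rmult_le_pos; [apply pow_le, pos_INR|apply pow2_ge_0].
Qed.

Lemma is_derive_inv_pow n x : 0 < x ->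
  is_derive (fun y => (/ y) ^ n) x (- INR n * (/ x) ^ S n).
Proof.
intros hx; induction n as [|n IH].
- replace (- INR 0 * (/ x) ^ 1) with 0 by (simpl; ring).
  exact (is_derive_Rconst 1 x).
- assert (hi : is_derive (fun y => / y) x (- (/ x) ^ 2)).
  { auto_derive; [lra|simpl; field; lra]. }
  assert (h := is_derive_Rmult _ _ _ _ _ hi IH).
  replace (- INR (S n) * (/ x) ^ S (S n)) with
    (- (/ x) ^ 2 * (/ x) ^ n + / x * (- INR n * (/ x) ^ S n)); [exact h|].
  rewrite S_INR; simpl; ring.
Qed.

(** At 0 the difference quotient tends to 0 by the quadratic bound. *)
Lemma is_derive_flat n x :
  is_derive (flat n) x (flat (S (S n)) x - INR n * flat (S n) x).
Proof.
destruct (Rtotal_order x 0) as [h|[->|h]].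
- rewrite !flat_neg by lra.
  apply is_derive_ext_loc with (fun _ => 0).
  + assert (p : 0 < - x) by lra.
    exists (mkposreal _ p); intros y hy; change (Rabs (y - x) < - x) in hy.
    apply Rabs_def2 in hy; rewrite flat_neg by lra; reflexivity.
  + replace (0 - INR n * 0) with 0 by ring.
    apply is_derive_Rconst.
- rewrite !flat_neg by lra; replace (0 - INR n * 0) with 0 by ring.
  apply is_derive_Reals; intros eps he.
  set (M := INR (S (S n)) ^ S (S n)).
  assert (hM : 0 <= M) by apply pow_le, pos_INR.
  assert (p : 0 < eps / (M + 1)) by (apply Rdiv_lt_0_compat; lra).
  exists (mkposreal _ p); simpl; intros t ht hd.
  rewrite (flat_neg n 0) by lra; rewrite Rplus_0_l, !Rminus_0_r.
  unfold Rdiv; rewrite Rabs_mult, Rabs_inv.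
  assert (ht' := Rabs_pos_lt t ht).
  apply Rle_lt_trans with (M * Rabs t).
  + apply Rmult_le_reg_r with (Rabs t); [exact ht'|].
    rewrite Rmult_assoc, Rinv_l, Rmult_1_r by lra.
    replace (M * Rabs t * Rabs t) with (M * t ^ 2); [apply flat_quadratic|].
    rewrite <- (pow2_abs t); ring.
  + apply Rle_lt_trans with (M * (eps / (M + 1))).
    * apply Rmult_le_compat_l; lra.
    * replace eps with ((M + 1) * (eps / (M + 1))) at 2 by (field; lra).
      apply Rmult_lt_compat_r; lra.
- rewrite !flat_pos by exact h.
  apply is_derive_ext_loc with (fun y => (/ y) ^ n * exp (- / y)).
  + exists (mkposreal _ h); intros y hy; change (Rabs (y - x) < x) in hy.
    apply Rabs_def2 in hy; rewrite flat_pos by lra; reflexivity.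
  + assert (he : is_derive (fun y => exp (- / y)) x ((/ x) ^ 2 * exp (- / x))).
    { auto_derive; [lra|simpl; field; lra]. }
    assert (hm := is_derive_Rmult _ _ _ _ _ (is_derive_inv_pow n x h) he).
    replace ((/ x) ^ S (S n) * exp (- / x) - INR n * ((/ x) ^ S n * exp (- / x))) with
      (- INR n * (/ x) ^ S n * exp (- / x) + (/ x) ^ n * ((/ x) ^ 2 * exp (- / x)));
      [exact hm|simpl; ring].
Qed.

(** The functions [flat n] are closed under differentiation up to linear combination. *)
Lemma smooth_flat n : smooth_on everywhere (fun x => RtoC (flat n x)).
Proof.
apply diffn_smooth_on; [apply open_everywhere|]; intros k; revert n.
induction k as [|k IH]; intros n; [exact I|].
exists (fun x => RtoC (flat (S (S n)) x) + RtoC (- INR n) * RtoC (flat (S n) x))%C; split.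
- intros x _; eapply is_cderive_eq; [apply is_cderive_RtoC, is_derive_flat|].
  rewrite <- RtoC_mult, <- RtoC_plus; f_equal; ring.
- apply diffn_plus; [apply IH|apply diffn_mult; [apply diffn_const|apply IH]].
Qed.

Definition bump (p r x : R) : R := flat 0 (x - p) * flat 0 (r - x).

Lemma flat0_nonneg x : 0 <= flat 0 x.
Proof.
destruct (Rlt_le_dec 0 x) as [h|h]; [rewrite flat_pos by exact h|rewrite flat_neg by exact h; lra].
simpl; rewrite Rmult_1_l; left; apply exp_pos.
Qed.

Lemma bump_nonneg p r x : 0 <= bump p r x.
Proof. apply Rmult_le_pos; apply flat0_nonneg. Qed.

Lemma bump_pos p r x : p < x < r -> 0 < bump p r x.
Proof.
intros h; unfold bump; rewrite !flat_pos by lra; simpl; rewrite !Rmult_1_l.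
apply Rmult_lt_0_compat; apply exp_pos.
Qed.

Lemma bump_out p r x : x <= p \/ r <= x -> bump p r x = 0.
Proof.
unfold bump; intros [h|h]; [rewrite (flat_neg 0 (x - p)) by lra|rewrite (flat_neg 0 (r - x)) by lra];
  ring.
Qed.

Lemma smooth_bump p r : smooth_on everywhere (fun x => RtoC (bump p r x)).
Proof.
assert (h : forall u v, smooth_on everywhere (fun x => RtoC (flat 0 (u * x + v)))).
{ intros u v.
  apply (smooth_on_affine everywhere everywhere (fun x => RtoC (flat 0 x)) u v);
    [apply open_everywhere|easy|apply smooth_flat]. }
apply smooth_on_ext with (fun x => RtoC (flat 0 (1 * x + - p)) * RtoC (flat 0 (-1 * x + r)))%C.
- apply open_everywhere.
- intros x _; unfold bump; rewrite RtoC_mult; f_equal; f_equal; f_equal; ring.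
- apply smooth_on_mult; [apply open_everywhere|apply h|apply h].
Qed.

Lemma bump_ccont p r x : ccont (fun x => RtoC (bump p r x)) x.
Proof. exact (smooth_on_ccont everywhere _ x (smooth_bump p r) I). Qed.

Lemma bump_mass p r : p < r ->
  exists m, 0 < m /\ RI (fun x => RtoC (bump p r x)) p r = RtoC m.
Proof.
intros h; exists (RInt (bump p r) p r); split.
- apply RInt_gt_0; [exact h|intros x hx; now apply bump_pos|].
  intros x _; exact (proj1 (bump_ccont p r x)).
- apply C_eq; simpl; [reflexivity|].
  transitivity (RInt (fun _ => 0) p r); [reflexivity|].
  rewrite (RInt_const (V := R_CompleteNormedModule)); apply Rmult_0_r.
Qed.

Lemma bump_test a c : 0 < c < a -> is_test a (fun x => RtoC (bump (- c) c x)).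
Proof.
intros h; split; [apply smooth_bump|].
exists c; split; [lra|]; intros x hx; rewrite bump_out; [reflexivity|].
revert hx; unfold Rabs; destruct (Rcase_abs x); lra.
Qed.

Lemma smooth_step p r : p < r -> exists s, smooth_on everywhere s /\
  (forall x, x <= p -> s x = RtoC 1) /\ (forall x, r <= x -> s x = RtoC 0).
Proof.
intros h; destruct (bump_mass p r h) as [m [hm em]].
set (B := fun x => RtoC (bump p r x)) in *.
assert (hB : forall x, ccont B x) by (intros; apply bump_ccont).
exists (fun x => RtoC (/ m) * RI B x r)%C; split; [|split].
- apply smooth_on_mult; [apply open_everywhere|apply smooth_on_const|].
  apply smooth_on_of_derive with (fun x => - B x)%C; [apply open_everywhere| |].
  + intros x _; apply is_cderive_ext with (fun x => - RI B r x)%C.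
    * intros t; symmetry; apply RI_swap; now apply ccont_global_seg.
    * apply is_cderive_opp, is_cderive_RI_global, hB.
  + apply smooth_on_opp; [apply open_everywhere|apply smooth_bump].
- intros x hx; rewrite <- (RI_Chasles B x p r) by (now apply ccont_global_seg).
  rewrite (RI_ext B (fun _ => RtoC 0) x p), RI_zero, em, Cplus_0_l, <- RtoC_mult.
  { rewrite Rinv_l by lra; reflexivity. }
  intros t ht; unfold B; rewrite bump_out; [reflexivity|].
  rewrite Rmax_right in ht by lra; lra.
- intros x hx; rewrite (RI_ext B (fun _ => RtoC 0)), RI_zero; [ring|].
  intros t ht; unfold B; rewrite bump_out; [reflexivity|].
  rewrite Rmin_right in ht by lra; lra.
Qed.

Lemma cutoff a c d : 0 < c < d -> d < a -> exists chi, is_test a chi /\ supported_in d chi /\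
  forall x, Rabs x <= c -> chi x = RtoC 1.
Proof.
intros h hd; destruct (smooth_step c d (proj2 h)) as [s [s1 [s2 s3]]].
assert (hs : supported_in d (fun x => s x * s (- x)%R)%C).
{ intros x hx; revert hx; unfold Rabs; destruct (Rcase_abs x); intros hx.
  - rewrite (s3 (- x)) by lra; ring.
  - rewrite (s3 x) by lra; ring. }
exists (fun x => s x * s (- x)%R)%C; split; [split|split].
- apply smooth_on_mult; [apply open_everywhere|exact s1|].
  apply smooth_on_ext with (fun x => s (-1 * x + 0)); [apply open_everywhere| |].
  + intros x _; f_equal; ring.
  + apply smooth_on_affine with everywhere; [apply open_everywhere|easy|exact s1].
- exists d; split; [exact hd|exact hs].
- exact hs.
- intros x hx; apply Rabs_le_between in hx.
  rewrite s2, (s2 (- x)) by lra; ring.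
Qed.

(** The conjugate of g times a bump is a test function, because g is smooth. *)
Lemma regular_inj a g : 0 < a -> smooth_on (interval a) g ->
  (forall f, is_test a f -> pairing a (regular a g) f = RtoC 0) ->
  forall x, interval a x -> g x = RtoC 0.
Proof.
intros ha hg h x hx.
assert (hxa := proj1 (interval_abs a x) hx).
set (c := (Rabs x + a) / 2).
assert (hx0 := Rabs_pos x).
assert (hc : 0 < c < a) by (unfold c; lra).
set (f := fun x => (Cconj (g x) * RtoC (bump (- c) c x))%C).
assert (hf : is_test a f).
{ apply is_test_mult; [|now apply bump_test].
  apply smooth_on_conj; [apply open_interval|exact hg]. }
assert (gc : ccont_I a g) by (intros y; now apply smooth_on_ccont).
specialize (h f hf); rewrite pairing_regular in h by auto.
apply (RI_conj_zero (bump (- c) c) g (- a) a).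
- intros y; exact (proj1 (bump_ccont (- c) c y)).
- apply bump_nonneg.
- intros y; apply ccont_ext_loc with (fun t => g t * f t)%C.
  + apply filter_forall; intros t; unfold f; ring.
  + destruct (test_support a f ha hf) as [b [hb hs]].
    apply (ccont_mult_supported a b); auto; [lra|].
    intros z; now apply is_test_ccont with a.
- rewrite <- h; apply RI_ext; intros t _; unfold f; ring.
- exact hx.
- apply bump_pos; apply Rabs_lt_between; unfold c; lra.
Qed.

(** * Distributional solutions of u'' = q u *)

Lemma is_test_primitive a f : 0 < a -> is_test a f -> RI f (- a) a = RtoC 0 ->
  is_test a (fun x => RI f (- a) x).
Proof.
intros ha hf h0; split.
- apply smooth_on_of_derive with f; [apply open_everywhere| |now apply is_test_smooth with a].
  intros x _; apply is_cderive_RI_global; intros y; now apply is_test_ccont with a.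
- destruct (test_support a f ha hf) as [b [hb hs]].
  exists b; split; [lra|]; intros x hx; destruct (Rle_dec x 0) as [h|h].
  + rewrite Rabs_left1 in hx by lra; apply (RI_supported_neg b); auto; lra.
  + rewrite Rabs_right in hx by lra.
    rewrite <- (RI_Chasles f (- a) a x) by (now apply is_test_seg with a).
    rewrite h0, (RI_supported b) by (auto; lra); ring.
Qed.

Lemma RI_derivative_test a f : 0 < a -> is_test a f -> RI (nderiv 1 f) (- a) a = RtoC 0.
Proof.
intros ha hf; destruct (test_support a f ha hf) as [b [hb hs]].
rewrite (RI_FTC f).
- rewrite !hs; [ring| |]; rewrite ?Rabs_Ropp, Rabs_right; lra.
- intros x _; now apply is_test_cderive with a.
- apply is_test_seg with a; now apply is_test_nderiv1.
Qed.

Section Solutions.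

Variables (a : R) (q y1 y2 : R -> C).
Hypothesis a_pos : 0 < a.
Hypothesis q_smooth : smooth_on (interval a) q.
Let solution (y : R -> C) : Prop := smooth_on (interval a) y /\
  forall x, interval a x -> is_cderive (nderiv 1 y) x (q x * y x)%C.
Hypothesis y1_sol : solution y1.
Hypothesis y2_sol : solution y2.
Hypothesis wronskian : forall x, interval a x ->
  (y1 x * nderiv 1 y2 x - nderiv 1 y1 x * y2 x)%C = RtoC 1.

Let hy1 : smooth_on (interval a) y1 := proj1 y1_sol.
Let hy2 : smooth_on (interval a) y2 := proj1 y2_sol.

Lemma smooth_derive y x : smooth_on (interval a) y -> interval a x ->
  is_cderive y x (nderiv 1 y x).
Proof. intros; now apply smooth_on_cderive with (interval a). Qed.

(** Variation of constants: the moments against y1 and y2 are the only obstruction to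
    solving psi'' - q psi = phi with compact support. *)
Lemma Lop_range phi : is_test a phi ->
  RI (fun x => y1 x * phi x)%C (- a) a = RtoC 0 ->
  RI (fun x => y2 x * phi x)%C (- a) a = RtoC 0 ->
  exists psi, is_test a psi /\ forall x, Lop q psi x = phi x.
Proof.
intros hphi h1 h2.
set (f1 := fun x => (y1 x * phi x)%C) in *; set (f2 := fun x => (y2 x * phi x)%C) in *.
assert (t1 : is_test a f1) by (now apply is_test_mult).
assert (t2 : is_test a f2) by (now apply is_test_mult).
set (A1 := fun x => RI f1 (- a) x); set (A2 := fun x => RI f2 (- a) x).
assert (tA1 : is_test a A1) by (now apply is_test_primitive).
assert (tA2 : is_test a A2) by (now apply is_test_primitive).
assert (dA1 : forall x, is_cderive A1 x (f1 x)).
{ intros x; apply is_cderive_RI_global; intros; now apply is_test_ccont with a. }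
assert (dA2 : forall x, is_cderive A2 x (f2 x)).
{ intros x; apply is_cderive_RI_global; intros; now apply is_test_ccont with a. }
set (psi := fun x => (y2 x * A1 x + - (y1 x * A2 x))%C).
assert (tpsi : is_test a psi).
{ apply is_test_plus; [|apply is_test_opp]; now apply is_test_mult. }
exists psi; split; [exact tpsi|]; intros x.
destruct (Rlt_le_dec (Rabs x) a) as [hx|hx].
- apply interval_abs in hx.
  assert (d1 : forall y, interval a y ->
    is_cderive psi y (nderiv 1 y2 y * A1 y - nderiv 1 y1 y * A2 y)%C).
  { intros y hy; eapply is_cderive_eq.
    - exact (is_cderive_plus _ _ _ _ _
        (is_cderive_mult _ _ _ _ _ (smooth_derive y2 y hy2 hy) (dA1 y))
        (is_cderive_opp _ _ _ (is_cderive_mult _ _ _ _ _ (smooth_derive y1 y hy1 hy) (dA2 y)))).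
    - unfold f1, f2; ring. }
  assert (d2 : is_cderive (fun y => nderiv 1 y2 y * A1 y - nderiv 1 y1 y * A2 y)%C x
    (q x * psi x + phi x)%C).
  { eapply is_cderive_eq.
    - exact (is_cderive_minus _ _ _ _ _
        (is_cderive_mult _ _ _ _ _ (proj2 y2_sol x hx) (dA1 x))
        (is_cderive_mult _ _ _ _ _ (proj2 y1_sol x hx) (dA2 x))).
    - transitivity (q x * psi x
        + (y1 x * nderiv 1 y2 x - nderiv 1 y1 x * y2 x) * phi x)%C.
      + unfold psi, f1, f2; ring.
      + rewrite wronskian by exact hx; ring. }
  unfold Lop; rewrite <- nderiv_S, (nderiv_S_on (interval a) psi _ 1 x
    (open_interval a) d1 hx), (nderiv_1 _ _ _ d2); ring.
- destruct (test_support a psi a_pos tpsi) as [b [hb hs]].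
  destruct (test_support a phi a_pos hphi) as [b' [hb' hs']].
  rewrite hs' by lra; apply (Lop_supported q b); [exact hs|lra].
Qed.

(** This is psi'' - q psi for psi = theta w, where theta is a smoothed Heaviside function
    with derivative rho and w a solution. Since psi is not compactly supported the moments
    do not vanish; they are Wronskians. *)
Definition moment_test (rho w : R -> C) (x : R) : C :=
  (w x * nderiv 1 rho x + RtoC 2 * (nderiv 1 w x * rho x))%C.

Lemma is_test_moment rho w : is_test a rho -> smooth_on (interval a) w ->
  is_test a (moment_test rho w).
Proof.
intros hr hw; apply is_test_plus.
- apply is_test_mult; [exact hw|now apply is_test_nderiv1].
- apply is_test_scal, is_test_mult; [now apply smooth_on_nderiv1|exact hr].
Qed.

Lemma moment_wronskian rho w y : is_test a rho ->
  smooth_on (interval a) w -> smooth_on (interval a) y ->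
  RI (fun x => y x * moment_test rho w x)%C (- a) a =
  RI (fun x => (y x * nderiv 1 w x - nderiv 1 y x * w x) * rho x)%C (- a) a.
Proof.
intros hr hw hy.
set (F := fun x => (y x * (w x * rho x))%C).
assert (tw : is_test a (fun x => w x * rho x)%C) by (now apply is_test_mult).
assert (tF : is_test a F) by (now apply is_test_mult).
set (V := fun x => ((y x * nderiv 1 w x + - (nderiv 1 y x * w x)) * rho x)%C).
assert (tV : is_test a V).
{ apply is_test_mult; [|exact hr].
  apply smooth_on_plus; [apply open_interval| |apply smooth_on_opp; [apply open_interval|]];
    (apply smooth_on_mult; [apply open_interval| |]); auto using smooth_on_nderiv1. }
rewrite (RI_ext _ (fun x => nderiv 1 F x + V x)%C).
- rewrite RI_plus, RI_derivative_test; auto.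
  + rewrite Cplus_0_l; apply RI_ext; intros; unfold V; ring.
  + apply is_test_seg with a; now apply is_test_nderiv1.
  + now apply is_test_seg with a.
- intros x hx; rewrite Rmin_left, Rmax_right in hx by lra.
  assert (hx' : interval a x) by exact hx.
  rewrite (nderiv_1 F x (nderiv 1 y x * (w x * rho x)
    + y x * (nderiv 1 w x * rho x + w x * nderiv 1 rho x))%C).
  + unfold V, moment_test; ring.
  + apply is_cderive_mult; [now apply smooth_derive|].
    apply is_cderive_mult; [now apply smooth_derive|now apply is_test_cderive with a].
Qed.

(** The moment tests of y1 and y2 are dual to y2 and y1 up to sign. Subtracting them from a
    test function cancels its two moments, and what remains is in the range of [Lop], where
    u vanishes. *)
Lemma distr_solution (u : distribution a) :
  (forall f, is_test a f -> pairing a u (Lop q f) = RtoC 0) ->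
  exists c d : C, u = regular a (fun x => c * y1 x + d * y2 x)%C.
Proof.
intros hu.
assert (hb : 0 < a / 2 < a) by lra.
destruct (bump_mass (- (a / 2)) (a / 2)) as [m [hm em]]; [lra|].
set (rho := fun x => (RtoC (/ m) * RtoC (bump (- (a / 2)) (a / 2) x))%C).
assert (tb := bump_test a (a / 2) hb).
assert (tr : is_test a rho) by (now apply is_test_scal).
assert (er : RI rho (- a) a = RtoC 1).
{ unfold rho; rewrite RI_scal by (now apply is_test_seg with a).
  rewrite (RI_supported_eq a (a / 2)).
  - rewrite em, <- RtoC_mult, Rinv_l by lra; reflexivity.
  - lra.
  - intros x hx; rewrite bump_out; [reflexivity|].
    revert hx; unfold Rabs; destruct (Rcase_abs x); lra.
  - apply bump_ccont. }
set (x1 := moment_test rho y1); set (x2 := moment_test rho y2).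
assert (tx1 : is_test a x1) by (now apply is_test_moment).
assert (tx2 : is_test a x2) by (now apply is_test_moment).
assert (inI : forall x, Rmin (- a) a < x < Rmax (- a) a -> interval a x).
{ intros x hx; rewrite Rmin_left, Rmax_right in hx by lra; exact hx. }
assert (m11 : RI (fun x => y1 x * x1 x)%C (- a) a = RtoC 0).
{ unfold x1; rewrite moment_wronskian by assumption.
  rewrite (RI_ext _ (fun _ => RtoC 0)); [apply RI_zero|intros; ring]. }
assert (m22 : RI (fun x => y2 x * x2 x)%C (- a) a = RtoC 0).
{ unfold x2; rewrite moment_wronskian by assumption.
  rewrite (RI_ext _ (fun _ => RtoC 0)); [apply RI_zero|intros; ring]. }
assert (m12 : RI (fun x => y1 x * x2 x)%C (- a) a = RtoC 1).
{ unfold x2; rewrite moment_wronskian, <- er by assumption.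
  apply RI_ext; intros x hx; rewrite wronskian by auto; ring. }
assert (m21 : RI (fun x => y2 x * x1 x)%C (- a) a = RtoC (-1)).
{ unfold x1; rewrite moment_wronskian by assumption.
  rewrite (RI_ext _ (fun x => RtoC (-1) * rho x)%C).
  - rewrite RI_scal, er by (now apply is_test_seg with a); ring.
  - intros x hx.
    replace (y2 x * nderiv 1 y1 x - nderiv 1 y2 x * y1 x)%C with
      (- (y1 x * nderiv 1 y2 x - nderiv 1 y1 x * y2 x))%C by ring.
    rewrite wronskian by auto; apply C_eq; simpl; unfold Re, Im; ring. }
exists (pairing a u x2), (- pairing a u x1)%C; apply distr_eq; intros f hf.
assert (hc : ccont_I a (fun x => pairing a u x2 * y1 x + - pairing a u x1 * y2 x)%C).
{ intros x hx; apply ccont_plus; (apply ccont_mult; [apply ccont_const|]);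
    now apply smooth_on_ccont with (interval a). }
rewrite pairing_regular by assumption.
assert (sg : forall y f, smooth_on (interval a) y -> is_test a f ->
  ccont_seg (fun x => y x * f x)%C (- a) a).
{ intros y g hy hg; apply is_test_seg with a; now apply is_test_mult. }
assert (cs : forall (c : C) g, ccont_seg g (- a) a -> ccont_seg (fun x => c * g x)%C (- a) a).
{ intros c g hg; apply (ccont_seg_mult (fun _ => c)); [intros x _; apply ccont_const|exact hg]. }
set (m1 := RI (fun x => y1 x * f x)%C (- a) a).
set (m2 := RI (fun x => y2 x * f x)%C (- a) a).
set (phi := fun x => (- m1 * x2 x + (m2 * x1 x + f x))%C).
assert (tphi1 : is_test a (fun x => m2 * x1 x + f x)%C) by (now apply is_test_lin_fun).
assert (tphi : is_test a phi) by (now apply is_test_lin_fun).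
assert (moment : forall y, smooth_on (interval a) y ->
  RI (fun x => y x * phi x)%C (- a) a =
  (- m1 * RI (fun x => y x * x2 x)%C (- a) a + (m2 * RI (fun x => y x * x1 x)%C (- a) a
   + RI (fun x => y x * f x)%C (- a) a))%C).
{ intros y hy.
  rewrite (RI_ext _ (fun x => - m1 * (y x * x2 x) + (m2 * (y x * x1 x) + y x * f x))%C)
    by (intros; unfold phi; ring).
  rewrite (RI_plus (fun x => - m1 * (y x * x2 x))%C
    (fun x => m2 * (y x * x1 x) + y x * f x)%C); auto using ccont_seg_plus.
  rewrite (RI_plus (fun x => m2 * (y x * x1 x))%C (fun x => y x * f x)%C); auto.
  rewrite !RI_scal by auto; reflexivity. }
destruct (Lop_range phi tphi) as [psi [tpsi epsi]].
- rewrite moment by assumption; rewrite m12, m11; fold m1; ring.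
- rewrite moment by assumption; rewrite m22, m21; fold m2.
  apply C_eq; simpl; unfold Re, Im; ring.
- assert (e := hu psi tpsi).
  rewrite (pairing_ext a u _ phi epsi) in e.
  unfold phi in e; rewrite !pairing_lin in e by assumption.
  rewrite (RI_ext _ (fun x => pairing a u x2 * (y1 x * f x)
    + - pairing a u x1 * (y2 x * f x))%C) by (intros; ring).
  rewrite (RI_plus (fun x => pairing a u x2 * (y1 x * f x))%C
    (fun x => - pairing a u x1 * (y2 x * f x))%C) by auto.
  rewrite !RI_scal by auto; fold m1 m2.
  replace (pairing a u f) with
    ((- m1 * pairing a u x2 + (m2 * pairing a u x1 + pairing a u f))
     + (m1 * pairing a u x2 - m2 * pairing a u x1))%C by ring.
  rewrite e; ring.
Qed.

End Solutions.

(** * The Landau kernel *)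

Lemma RI_bound_fun f (g : R -> R) a b : a <= b -> ccont_seg f a b ->
  (forall z, a <= z <= b -> continuous g z) ->
  (forall z, a <= z <= b -> Cmod (f z) <= g z) -> Cmod (RI f a b) <= 2 * RInt g a b.
Proof.
intros hab hf hg h.
assert (eg : ex_RInt g a b).
{ apply ex_RInt_cont; rewrite Rmin_left, Rmax_right by lra; exact hg. }
assert (bd : forall k : R -> R, ex_RInt k a b -> (forall z, a <= z <= b -> Rabs (k z) <= g z) ->
  Rabs (RInt k a b) <= RInt g a b).
{ intros k hk hkg; apply Rabs_le; split.
  - assert (e : RInt (fun z => - g z) a b = - RInt g a b)
      by (apply (RInt_opp (V := R_CompleteNormedModule)); exact eg).
    rewrite <- e; apply RInt_le; auto.
    + apply (ex_RInt_opp (V := R_NormedModule)); exact eg.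
    + intros z hz; assert (hz' := hkg z ltac:(lra)).
      assert (t := Rle_abs (- k z)); rewrite Rabs_Ropp in t; lra.
  - apply RInt_le; auto; intros z hz; assert (hz' := hkg z ltac:(lra)).
    assert (t := Rle_abs (k z)); lra. }
destruct (ccont_seg_ex _ _ _ hf) as [h1 h2].
eapply Rle_trans; [apply Cmod_le_sum|].
assert (b1 : Rabs (RInt (fun t => Re (f t)) a b) <= RInt g a b).
{ apply bd; [exact h1|]; intros z hz; eapply Rle_trans; [apply Re_le_Cmod|auto]. }
assert (b2 : Rabs (RInt (fun t => Im (f t)) a b) <= RInt g a b).
{ apply bd; [exact h2|]; intros z hz; eapply Rle_trans; [apply Im_le_Cmod|auto]. }
simpl; lra.
Qed.

Section Landau.

Variable c : R.
Hypothesis c_pos : 0 < c.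

(** The kernel is polynomial, which is what turns smoothing into polynomial
    approximation. *)
Definition landau (n : nat) (s : R) : R := (1 - s ^ 2 / c ^ 2) ^ n.

Lemma landau_base s : - c <= s <= c -> 0 <= 1 - s ^ 2 / c ^ 2 <= 1.
Proof.
intros hs; assert (hc : 0 < c ^ 2) by (apply pow_lt; lra).
assert (h1 : 0 <= s ^ 2) by apply pow2_ge_0.
assert (h2 : s ^ 2 <= c ^ 2) by nra.
assert (h3 : 0 <= s ^ 2 / c ^ 2) by (apply Rmult_le_pos; [lra|left; now apply Rinv_0_lt_compat]).
assert (h4 : s ^ 2 / c ^ 2 <= 1).
{ apply Rmult_le_reg_r with (c ^ 2); [lra|]; unfold Rdiv.
  rewrite Rmult_assoc, Rinv_l by lra; lra. }
lra.
Qed.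

Lemma landau_nonneg n s : - c <= s <= c -> 0 <= landau n s.
Proof. intros hs; apply pow_le; now apply landau_base. Qed.

Lemma is_derive_landau (n : nat) (s : R) :
  is_derive (landau (S n)) s (- (2 * INR (S n) / c ^ 2) * (s * landau n s)).
Proof.
unfold landau; auto_derive; [auto|].
change (match n with O => 1 | S _ => INR n + 1 end) with (INR (S n)).
replace (1 + - (s * (s * 1) * / (c * (c * 1)))) with (1 - s ^ 2 / c ^ 2)
  by (simpl; unfold Rdiv; ring).
generalize (INR (S n)), ((1 - s ^ 2 / c ^ 2) ^ n); intros; simpl; field; lra.
Qed.

Lemma continuous_landau (n : nat) (s : R) : continuous (landau n) s.
Proof.
destruct n as [|n]; [exact (continuous_const (V := R_UniformSpace) 1 s)|].
eapply is_derive_R_continuous, is_derive_landau.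
Qed.

Definition landau_mass (n : nat) : R := RInt (landau n) (- c) c.

Lemma ex_RInt_all (f : R -> R) u v : (forall z, continuous f z) -> ex_RInt f u v.
Proof. intros h; apply ex_RInt_cont; auto. Qed.

Lemma landau_mass_pos n : 0 < landau_mass n.
Proof.
apply RInt_gt_0; [lra| |intros; apply continuous_landau].
intros s hs; apply pow_lt.
assert (hc : 0 < c ^ 2) by (apply pow_lt; lra).
assert (h2 : s ^ 2 < c ^ 2) by nra.
apply Rmult_lt_reg_r with (c ^ 2); [lra|].
unfold Rdiv; rewrite Rmult_minus_distr_r, Rmult_assoc, Rinv_l by lra; lra.
Qed.

(** Integrating the derivative of s L_(n+1)(s) compares the second moment with the mass. *)
Lemma landau_second_moment n :
  RInt (fun s => s ^ 2 * landau n s) (- c) c <= c ^ 2 / (2 * INR (S n)) * landau_mass n.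
Proof.
assert (hc : 0 < c ^ 2) by (apply pow_lt; lra).
assert (hn : 0 < INR (S n)) by (apply lt_0_INR; lia).
set (k := 2 * INR (S n) / c ^ 2).
assert (hk : 0 < k) by (apply Rdiv_lt_0_compat; lra).
assert (cont2 : forall s, continuous (fun s => s ^ 2 * landau n s) s).
{ intros s; apply continuous_Rmult; [|apply continuous_landau].
  apply is_derive_R_continuous with (2 * s); auto_derive; [auto|ring]. }
assert (e : RInt (fun s => landau (S n) s - k * (s ^ 2 * landau n s)) (- c) c = 0).
{ apply is_RInt_unique.
  assert (h := is_RInt_derive (V := R_CompleteNormedModule) (fun s => s * landau (S n) s)
    (fun s => landau (S n) s - k * (s ^ 2 * landau n s)) (- c) c).
  assert (l0 : landau (S n) c = 0).
  { unfold landau; simpl; field_simplify_eq; [ring|lra]. }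
  assert (l1 : landau (S n) (- c) = 0).
  { unfold landau; simpl; field_simplify_eq; [ring|lra]. }
  cbv beta in h; rewrite l0, l1 in h.
  change (minus (c * 0) (- c * 0)) with (c * 0 - - c * 0) in h.
  replace (c * 0 - - c * 0) with 0 in h by ring; apply h.
  - intros s _; assert (d := is_derive_Rmult (fun s => s) (landau (S n)) s 1 _
      (is_derive_id (K := R_AbsRing) s) (is_derive_landau n s)).
    replace (landau (S n) s - k * (s ^ 2 * landau n s)) with
      (1 * landau (S n) s + s * (- (2 * INR (S n) / c ^ 2) * (s * landau n s)));
      [exact d|unfold k; ring].
  - intros s _; apply continuous_Rminus; [apply continuous_landau|].
    apply continuous_Rmult; [apply continuous_const|apply cont2]. }
assert (e2 : RInt (fun s => landau (S n) s - k * (s ^ 2 * landau n s)) (- c) c =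
  landau_mass (S n) - k * RInt (fun s => s ^ 2 * landau n s) (- c) c).
{ assert (es : RInt (fun s => k * (s ^ 2 * landau n s)) (- c) c =
    k * RInt (fun s => s ^ 2 * landau n s) (- c) c).
  { apply (RInt_scal (V := R_CompleteNormedModule)); apply ex_RInt_all, cont2. }
  rewrite <- es.
  apply (RInt_minus (V := R_CompleteNormedModule)); apply ex_RInt_all.
  - apply continuous_landau.
  - intros s; apply continuous_Rmult; [apply continuous_const|apply cont2]. }
assert (e3 : landau_mass (S n) <= landau_mass n).
{ apply RInt_le; [lra| | |].
  - apply ex_RInt_all, continuous_landau.
  - apply ex_RInt_all, continuous_landau.
  - intros s hs; unfold landau; simpl; fold (landau n s).
    assert (h1 := landau_base s ltac:(lra)).
    assert (h2 := landau_nonneg n s ltac:(lra)); unfold landau in h2.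
    simpl in h1, h2; nra. }
rewrite e in e2.
apply Rmult_le_reg_l with k; [exact hk|].
replace (k * (c ^ 2 / (2 * INR (S n)) * landau_mass n)) with (landau_mass n)
  by (unfold k; field; lra).
lra.
Qed.

(** ** Convolution with the normalized kernel *)

Definition landau_conv (n : nat) (f : R -> C) (y : R) : C :=
  (RtoC (/ landau_mass n) * RI (fun s => RtoC (landau n s) * f (y + s)%R) (- c) c)%C.

Lemma landau_ccont2 n f x s : (forall z, ccont f z) ->
  ccont2 (fun y s => RtoC (landau n s) * f (y + s)%R)%C x s.
Proof.
intros hf; apply ccont2_mult.
- apply (ccont2_comp1 (fun s => RtoC (landau n s)) (fun y s => s)); [|cont2_affine].
  apply ccont_RtoC, continuous_landau.
- apply (ccont2_comp1 f (fun y s => y + s)); [apply hf|cont2_affine].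
Qed.

Lemma is_cderive_landau_conv n f f' y : (forall z, is_cderive f z (f' z)) ->
  (forall z, ccont f' z) -> is_cderive (landau_conv n f) y (landau_conv n f' y).
Proof.
intros hf hf'; apply is_cderive_scal.
assert (cf : forall z, ccont f z) by (intros; eapply is_cderive_ccont, hf).
eapply is_cderive_eq.
- apply (is_cderive_RI_tube (fun y s => RtoC (landau n s) * f (y + s)%R)%C
    (fun y s => RtoC (landau n s) * f' (y + s)%R)%C (- c) y c 1 (fun _ => c) 0); [lra| | | | |].
  + intros x s _; eapply is_cderive_eq; [apply is_cderive_scal|].
    * apply (is_cderive_comp f (fun x => x + s) x (f' (x + s)) 1); [apply hf|].
      auto_derive; [auto|ring].
    * ring.
  + intros x s _; now apply landau_ccont2.
  + intros x s _; apply (ccont2_slice (fun y s => RtoC (landau n s) * f (y + s)%R)%C).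
    now apply landau_ccont2.
  + reflexivity.
  + apply is_derive_Rconst.
- ring.
Qed.

Lemma smooth_landau_conv n f : smooth_on everywhere f -> smooth_on everywhere (landau_conv n f).
Proof.
intros hf; apply diffn_smooth_on; [apply open_everywhere|]; intros k; revert f hf.
induction k as [|k IH]; intros f hf; [exact I|].
assert (hf' := smooth_on_nderiv1 _ _ hf).
exists (landau_conv n (nderiv 1 f)); split; [|now apply IH].
intros x _; apply is_cderive_landau_conv.
- intros z; now apply smooth_on_cderive with everywhere.
- intros z; now apply smooth_on_ccont with everywhere.
Qed.

Lemma nderiv_landau_conv n f k y : smooth_on everywhere f ->
  nderiv k (landau_conv n f) y = landau_conv n (nderiv k f) y.
Proof.
revert f y; induction k as [|k IH]; intros f y hf.
- now rewrite !nderiv_0.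
- assert (hf' := smooth_on_nderiv1 _ _ hf).
  assert (e : nderiv (S k) f = nderiv k (nderiv 1 f)).
  { apply functional_extensionality; intros x; apply nderiv_S. }
  rewrite e, <- IH by exact hf'.
  apply (nderiv_S_on everywhere); [apply open_everywhere| |exact I].
  intros z _; apply is_cderive_landau_conv.
  + intros t; now apply smooth_on_cderive with everywhere.
  + intros t; now apply smooth_on_ccont with everywhere.
Qed.

Lemma test_lipschitz a f : 0 < a -> is_test a f ->
  exists M, 0 <= M /\ forall y s, Cmod (f (y + s)%R - f y)%C <= M * Rabs s.
Proof.
intros ha hf; assert (hf' := is_test_nderiv1 a f hf).
destruct (test_support a _ ha hf') as [b [hb hs]].
destruct (compact_bounded1 (nderiv 1 f) (- b) b) as [M [hM1 hM2]].
{ intros x _; now apply is_test_ccont with a. }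
assert (hM : forall x, Cmod (nderiv 1 f x) <= M).
{ intros x; destruct (Rlt_le_dec b (Rabs x)) as [h|h].
  - rewrite hs by exact h; rewrite Cmod_0; exact hM1.
  - apply hM2; now apply Rabs_le_between. }
exists (2 * M); split; [lra|]; intros y s.
rewrite <- (RI_FTC f (nderiv 1 f) y (y + s)).
- eapply Rle_trans; [apply RI_bound with (M := M); [|auto]|].
  + now apply is_test_seg with a.
  + replace (y + s - y) with s by ring; lra.
- intros z _; now apply is_test_cderive with a.
- now apply is_test_seg with a.
Qed.

Lemma landau_conv_const n (k : C) : 
  (RtoC (/ landau_mass n) * RI (fun s => RtoC (landau n s) * k) (- c) c)%C = k.
Proof.
assert (hm := landau_mass_pos n).
assert (cl : ccont_seg (fun s => RtoC (landau n s)) (- c) c).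
{ intros s _; apply ccont_RtoC, continuous_landau. }
rewrite (RI_ext _ (fun s => k * RtoC (landau n s))%C) by (intros; ring).
rewrite RI_scal by exact cl.
replace (RI (fun s => RtoC (landau n s)) (- c) c) with (RtoC (landau_mass n)).
- replace (RtoC (/ landau_mass n) * (k * RtoC (landau_mass n)))%C with
    (RtoC (/ landau_mass n) * RtoC (landau_mass n) * k)%C by ring.
  rewrite <- RtoC_mult, Rinv_l by lra; ring.
- apply C_eq; simpl; [reflexivity|].
  transitivity (RInt (fun _ => 0) (- c) c); [|reflexivity].
  rewrite (RInt_const (V := R_CompleteNormedModule)); symmetry; apply Rmult_0_r.
Qed.

(** With |s| <= e + s^2/e, the second moment controls the first. *)
Lemma landau_conv_unull a f : 0 < a -> is_test a f ->
  unull (fun n y => landau_conv n f y - f y)%C.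
Proof.
intros ha hf eps heps.
destruct (test_lipschitz a f ha hf) as [M [hM1 hM2]].
assert (cf : forall z, ccont f z) by (intros; now apply is_test_ccont with a).
set (e := eps / (8 * (M + 1))).
assert (he : 0 < e) by (apply Rdiv_lt_0_compat; lra).
assert (hc2 : 0 < c ^ 2) by (apply pow_lt; lra).
(* For n >= N the second moment contributes at most e as well. *)
destruct (nfloor_ex (c ^ 2 / (2 * e * e))) as [N [_ hN]].
{ apply Rmult_le_pos; [lra|left; apply Rinv_0_lt_compat]; nra. }
exists N; intros n hn y.
assert (hm := landau_mass_pos n).
set (g := fun s => M * (e * landau n s + / e * (s ^ 2 * landau n s))).
assert (cont2 : forall s, continuous (fun s => s ^ 2 * landau n s) s).
{ intros s; apply continuous_Rmult; [|apply continuous_landau].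
  apply is_derive_R_continuous with (2 * s); auto_derive; [auto|ring]. }
assert (sc : forall (k : R) (h : R -> R) s, continuous h s -> continuous (fun s => k * h s) s).
{ intros k h s hh; apply continuous_Rmult; [apply continuous_const|exact hh]. }
assert (cg : forall s, continuous g s).
{ intros s; apply sc, continuous_Rplus; apply sc; [apply continuous_landau|apply cont2]. }
assert (cl : forall h, (forall z, ccont h z) ->
  ccont_seg (fun s => RtoC (landau n s) * h s)%C (- c) c).
{ intros h hh s _; apply ccont_mult; [apply ccont_RtoC, continuous_landau|apply hh]. }
assert (cfy : forall z, ccont (fun s => f (y + s)%R) z).
{ intros z; apply (ccont_comp f (fun s => y + s)); [apply cf|].
  apply is_derive_R_continuous with 1; auto_derive; [auto|ring]. }
assert (b1 : Cmod (RI (fun s => RtoC (landau n s) * (f (y + s)%R - f y))%C (- c) c)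
  <= 2 * RInt g (- c) c).
{ apply RI_bound_fun; [lra| |intros; apply cg|].
  - apply (cl (fun s => f (y + s)%R - f y)%C).
    intros z; apply ccont_minus; [apply cfy|apply ccont_const].
  - intros s hs; rewrite Cmod_mult, Cmod_R.
    assert (hl := landau_nonneg n s hs); rewrite Rabs_right by lra.
    unfold g.
    replace (M * (e * landau n s + / e * (s ^ 2 * landau n s))) with
      (landau n s * (M * (e + / e * s ^ 2))) by ring.
    apply Rmult_le_compat_l; [exact hl|].
    eapply Rle_trans; [apply hM2|]; apply Rmult_le_compat_l; [exact hM1|].
    apply Rmult_le_reg_l with e; [exact he|].
    replace (e * (e + / e * s ^ 2)) with (e * e + s ^ 2) by (field; lra).
    rewrite <- (pow2_abs s); nra. }
assert (b2 : RInt g (- c) c <= M * (2 * e) * landau_mass n).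
{ assert (eg : RInt g (- c) c =
    M * (e * landau_mass n + / e * RInt (fun s => s ^ 2 * landau n s) (- c) c)).
  { unfold g.
    assert (s1 : forall (k : R) (h : R -> R), (forall s, continuous h s) ->
      RInt (fun s => k * h s) (- c) c = k * RInt h (- c) c).
    { intros k h hh; apply (RInt_scal (V := R_CompleteNormedModule)), ex_RInt_all, hh. }
    rewrite s1 by (intros s; apply continuous_Rplus; apply sc;
      [apply continuous_landau|apply cont2]).
    f_equal; unfold landau_mass; rewrite <- s1 by apply continuous_landau.
    rewrite <- (s1 (/ e)) by apply cont2.
    apply (RInt_plus (V := R_CompleteNormedModule)); apply ex_RInt_all; intros s; apply sc;
      [apply continuous_landau|apply cont2]. }
  rewrite eg, Rmult_assoc; apply Rmult_le_compat_l; [exact hM1|].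
  assert (sm := landau_second_moment n).
  assert (hn' : c ^ 2 / (2 * e * e) <= INR (S n)).
  { left; eapply Rlt_le_trans; [exact hN|].
    rewrite S_INR; apply Rplus_le_compat_r, le_INR; lia. }
  assert (hS : 0 < INR (S n)) by (apply lt_0_INR; lia).
  assert (q : c ^ 2 / (2 * INR (S n)) <= e * e).
  { apply Rmult_le_reg_r with (2 * INR (S n)); [lra|].
    replace (c ^ 2 / (2 * INR (S n)) * (2 * INR (S n))) with (c ^ 2) by (field; lra).
    apply Rmult_le_compat_r with (r := 2 * e * e) in hn'; [|nra].
    replace (c ^ 2 / (2 * e * e) * (2 * e * e)) with (c ^ 2) in hn' by (field; lra).
    lra. }
  assert (q2 : RInt (fun s => s ^ 2 * landau n s) (- c) c <= e * e * landau_mass n).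
  { eapply Rle_trans; [exact sm|]; apply Rmult_le_compat_r; lra. }
  apply Rmult_le_reg_l with e; [exact he|].
  replace (e * (e * landau_mass n + / e * RInt (fun s => s ^ 2 * landau n s) (- c) c)) with
    (e * e * landau_mass n + RInt (fun s => s ^ 2 * landau n s) (- c) c) by (field; lra).
  lra. }
replace (landau_conv n f y - f y)%C with
  (RtoC (/ landau_mass n) * RI (fun s => RtoC (landau n s) * (f (y + s)%R - f y)) (- c) c)%C.
- rewrite Cmod_mult, Cmod_R, Rabs_right.
  2:{ apply Rle_ge; left; now apply Rinv_0_lt_compat. }
  apply Rle_lt_trans with (/ landau_mass n * (2 * (M * (2 * e) * landau_mass n))).
  + apply Rmult_le_compat_l; [left; now apply Rinv_0_lt_compat|lra].
  + replace (/ landau_mass n * (2 * (M * (2 * e) * landau_mass n))) with (4 * M * e)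
      by (field; lra).
    assert (h8 : 8 * (M + 1) * e = eps) by (unfold e; field; lra).
    nra.
- rewrite (RI_ext _ (fun s => RtoC (landau n s) * f (y + s)%R - RtoC (landau n s) * f y)%C)
    by (intros; ring).
  rewrite RI_minus; [|now apply (cl (fun s => f (y + s)%R))|apply (cl (fun _ => f y)); intros; apply ccont_const].
  assert (e0 := landau_conv_const n (f y)); unfold landau_conv.
  set (X := RI (fun s => RtoC (landau n s) * f (y + s)%R)%C (- c) c).
  set (Y := RI (fun s => RtoC (landau n s) * f y)%C (- c) c) in *.
  rewrite <- e0; ring.
Qed.

End Landau.

(** * Density of polynomials in distributions *)

(** Kernels that are polynomial in the first variable: pairing one with a distribution in
    the second variable gives a polynomial. *)
Inductive separated : (R -> R -> C) -> Prop :=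
| separated_zero : separated (fun _ _ => RtoC 0)
| separated_add (i : nat) (l : R -> C) (h : R -> R -> C) :
    smooth_on everywhere l -> separated h ->
    separated (fun x y => RtoC (x ^ i) * l y + h x y)%C.

Lemma separated_ext h k : (forall x y, h x y = k x y) -> separated h -> separated k.
Proof.
intros e; replace k with h; [auto|].
now apply functional_extensionality; intros x; apply functional_extensionality.
Qed.

Lemma separated_plus h k : separated h -> separated k ->
  separated (fun x y => h x y + k x y)%C.
Proof.
intros hh hk; induction hh as [|i l h hl hh IH].
- apply separated_ext with k; [intros; ring|exact hk].
- apply separated_ext with (fun x y => RtoC (x ^ i) * l y + (h x y + k x y))%C;
    [intros; ring|now apply separated_add].
Qed.

Lemma separated_mult_x h : separated h -> separated (fun x y => RtoC x * h x y)%C.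
Proof.
intros hh; induction hh as [|i l h hl hh IH].
- apply separated_ext with (2 := separated_zero); intros; ring.
- apply separated_ext with (fun x y => RtoC (x ^ S i) * l y + RtoC x * h x y)%C;
    [intros; rewrite RtoC_pow_S; ring|now apply separated_add].
Qed.

Lemma separated_mult_y m h : smooth_on everywhere m -> separated h ->
  separated (fun x y => m y * h x y)%C.
Proof.
intros hm hh; induction hh as [|i l h hl hh IH].
- apply separated_ext with (2 := separated_zero); intros; ring.
- apply separated_ext with (fun x y => RtoC (x ^ i) * (m y * l y) + m y * h x y)%C;
    [intros; ring|apply separated_add; [|exact IH]].
  now apply smooth_on_mult; [apply open_everywhere| |].
Qed.

Lemma separated_landau c n : c <> 0 -> separated (fun x y => RtoC (landau c n (x - y))).
Proof.
intros hc; induction n as [|n IH].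
- apply separated_ext with (fun x y => RtoC (x ^ 0) * RtoC 1 + RtoC 0)%C.
  + intros x y; unfold landau; simpl; ring.
  + exact (separated_add 0 (fun _ => RtoC 1) _ (smooth_on_const _ _) separated_zero).
- set (h := fun x y => RtoC (landau c n (x - y))) in *.
  assert (hy := smooth_on_id everywhere open_everywhere).
  assert (cm : forall k : C, smooth_on everywhere (fun _ => k)) by (intros; apply smooth_on_const).
  set (d := fun x y => (RtoC x * h x y + RtoC (-1) * (RtoC y * h x y))%C).
  assert (sm : forall k, separated k ->
    separated (fun x y => RtoC x * k x y + RtoC (-1) * (RtoC y * k x y))%C).
  { intros k hk; apply separated_plus; [now apply separated_mult_x|].
    apply (separated_mult_y (fun _ => RtoC (-1)) (fun x y => RtoC y * k x y)%C); [apply cm|].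
    now apply (separated_mult_y (fun y => RtoC y)). }
  apply separated_ext with (fun x y => h x y + RtoC (- / c ^ 2)
    * (RtoC x * d x y + RtoC (-1) * (RtoC y * d x y)))%C.
  + intros x y; unfold d, h; rewrite <- !RtoC_mult, <- !RtoC_plus, <- !RtoC_mult, <- !RtoC_plus,
      <- !RtoC_mult, <- !RtoC_plus.
    f_equal; unfold landau; simpl; field; lra.
  + apply separated_plus; [exact IH|].
    apply (separated_mult_y (fun _ => RtoC (- / c ^ 2))); [apply cm|].
    apply sm; unfold d; now apply sm.
Qed.

Inductive poly_span (a : R) : distribution a -> Prop :=
| poly_span_zero : poly_span a (distr_zero a)
| poly_span_add (c : C) (k : nat) (v : distribution a) :
    poly_span a v -> poly_span a (distr_lin c (monomial a k) v).

Lemma monomial_ccont a k : ccont_I a (fun x => RtoC (x ^ k)).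
Proof.
intros x hx; exact (smooth_on_ccont (interval a) _ x (smooth_on_pow _ k (open_interval a)) hx).
Qed.

Lemma separated_ccont h y x : separated h -> ccont (fun x => h x y) x.
Proof.
intros hh; induction hh as [|i l h hl hh IH]; [apply ccont_const|].
apply ccont_plus; [apply ccont_mult; [|apply ccont_const]|exact IH].
exact (smooth_on_ccont everywhere _ x (smooth_on_pow _ i open_everywhere) I).
Qed.

Lemma pairing_separated a (u : distribution a) chi h : 0 < a -> is_test a chi -> separated h ->
  exists p, poly_span a p /\ forall f, is_test a f ->
    is_test a (fun y => chi y * RI (fun x => h x y * f x)%C (- a) a)%C /\
    pairing a p f = pairing a u (fun y => chi y * RI (fun x => h x y * f x)%C (- a) a)%C.
Proof.
intros ha hchi hh; induction hh as [|i l h hl hh [p [sp hp]]].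
- exists (distr_zero a); split; [apply poly_span_zero|]; intros f hf.
  assert (e : forall y, RtoC 0 = (chi y * RI (fun x => RtoC 0 * f x)%C (- a) a)%C).
  { intros y; rewrite (RI_ext _ (fun _ => RtoC 0)), RI_zero by (intros; ring); ring. }
  split; [exact (is_test_ext a _ _ e (is_test_zero a))|].
  rewrite <- (pairing_ext a u _ _ e), pairing_zero; reflexivity.
- assert (tl : is_test a (fun y => l y * chi y)%C).
  { apply is_test_mult; [now apply smooth_on_sub with everywhere|exact hchi]. }
  exists (distr_lin (pairing a u (fun y => l y * chi y)%C) (monomial a i) p); split;
    [now apply poly_span_add|]; intros f hf.
  destruct (hp f hf) as [t1 e1].
  set (m := RI (fun x => RtoC (x ^ i) * f x)%C (- a) a).
  assert (tm : is_test a (fun x => RtoC (x ^ i) * f x)%C).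
  { apply is_test_mult; [apply smooth_on_pow, open_interval|exact hf]. }
  assert (e : forall y, (m * (l y * chi y) + chi y * RI (fun x => h x y * f x) (- a) a)%C
    = (chi y * RI (fun x => (RtoC (x ^ i) * l y + h x y) * f x) (- a) a)%C).
  { intros y.
    rewrite (RI_ext (fun x => (RtoC (x ^ i) * l y + h x y) * f x)%C
      (fun x => l y * (RtoC (x ^ i) * f x) + h x y * f x)%C) by (intros; ring).
    assert (s1 : ccont_seg (fun x => RtoC (x ^ i) * f x)%C (- a) a)
      by (now apply is_test_seg with a).
    rewrite (RI_plus (fun x => l y * (RtoC (x ^ i) * f x))%C (fun x => h x y * f x)%C).
    - rewrite RI_scal by exact s1; fold m; ring.
    - apply (ccont_seg_mult (fun _ => l y)); [intros z _; apply ccont_const|exact s1].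
    - intros z _; apply ccont_mult; [now apply separated_ccont|now apply is_test_ccont with a]. }
  split.
  + apply (is_test_ext a _ _ e); now apply is_test_lin_fun.
  + rewrite <- (pairing_ext a u _ _ e), pairing_lin by assumption.
    rewrite pairing_distr_lin, e1; f_equal.
    unfold monomial; rewrite pairing_regular; [fold m; ring|exact ha|apply monomial_ccont|exact hf].
Qed.

(** With c = 2a, the window (y-c, y+c) contains I for every y in I, so the integral runs over
    I and the kernel appears as a polynomial in x and y. *)
Lemma landau_conv_polynomial a n f y : 0 < a -> is_test a f -> interval a y ->
  landau_conv (2 * a) n f y =
  RI (fun x => (RtoC (/ landau_mass (2 * a) n) * RtoC (landau (2 * a) n (x - y))) * f x)%C (- a) a.
Proof.
intros ha hf hy.
set (k := fun x => (RtoC (landau (2 * a) n (x - y)) * f x)%C).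
assert (ck : forall x, ccont k x).
{ intros x; apply ccont_mult; [|now apply is_test_ccont with a].
  apply ccont_RtoC; apply (continuous_comp (fun x => x - y) (landau (2 * a) n)).
  - apply is_derive_R_continuous with 1; auto_derive; [auto|ring].
  - apply continuous_landau; lra. }
destruct (test_support a f ha hf) as [b [hb hs]].
assert (hk : supported_in b k).
{ intros x hx; unfold k; rewrite hs by exact hx; ring. }
assert (e := RI_comp_affine k 1 y (- (2 * a)) (2 * a) (ccont_global_seg _ _ _ ck)).
rewrite Cmult_1_l in e.
unfold landau_conv.
rewrite (RI_ext (fun s => RtoC (landau (2 * a) n s) * f (y + s)%R)%C (fun s => k (1 * s + y))).
2:{ intros s _; unfold k; f_equal; [f_equal; f_equal; ring|f_equal; ring]. }
rewrite e.
rewrite (RI_ext _ (fun x => RtoC (/ landau_mass (2 * a) n) * k x)%C (- a))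
  by (intros; unfold k; ring).
rewrite RI_scal by (now apply ccont_global_seg); f_equal.
unfold interval in hy.
rewrite <- (RI_Chasles k (1 * - (2 * a) + y) (- a)) by (now apply ccont_global_seg).
rewrite <- (RI_Chasles k (- a) a (1 * (2 * a) + y)) by (now apply ccont_global_seg).
rewrite (RI_supported_neg b k), (RI_supported b k a) by (auto; lra); ring.
Qed.

Lemma test_null_cutoff a chi h : 0 < a -> is_test a chi -> (forall n, smooth_on everywhere (h n)) ->
  (forall k, unull (fun n => nderiv k (h n))) -> test_null a (fun n x => chi x * h n x)%C.
Proof.
intros ha hchi hh hu; split.
- destruct hchi as [_ [b [hb hs]]]; exists b; split; [exact hb|].
  intros n x hx; rewrite hs by exact hx; ring.
- intros k; revert chi hchi h hh hu; induction k as [|k IH]; intros chi hchi h hh hu.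
  + apply unull_0.
    destruct (test_support a chi ha hchi) as [b [hb hs]].
    destruct (compact_bounded1 chi (- b) b) as [M [hM1 hM2]].
    { intros x _; now apply is_test_ccont with a. }
    apply (unull_dom h _ M hM1); [|exact (proj1 (unull_0 h) (hu O))].
    intros n m hm x; rewrite Cmod_mult; apply Rmult_le_compat; auto using Cmod_ge_0.
    destruct (Rlt_le_dec b (Rabs x)) as [h1|h1].
    * rewrite hs by exact h1; rewrite Cmod_0; exact hM1.
    * apply hM2; now apply Rabs_le_between.
  + assert (hchi' := is_test_nderiv1 a chi hchi).
    apply (unull_ext (fun n x => RtoC 1 * nderiv k (fun t => nderiv 1 chi t * h n t)%C x
                        + nderiv k (fun t => chi t * nderiv 1 (h n) t)%C x)%C).
    * intros n x.
      assert (s0 := is_test_smooth a chi hchi).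
      rewrite <- (proj1 (nderiv_lin (RtoC 1)
        (smooth_on_mult everywhere _ _ open_everywhere (smooth_on_nderiv1 _ _ s0) (hh n))
        (smooth_on_mult everywhere _ _ open_everywhere s0 (smooth_on_nderiv1 _ _ (hh n))) k x)).
      rewrite nderiv_S; apply nderiv_ext; intros t; symmetry.
      apply nderiv_1; rewrite Cmult_1_l; apply is_cderive_mult.
      -- now apply is_test_cderive with a.
      -- exact (smooth_on_cderive everywhere _ t (hh n) I).
    * apply unull_plus; [apply unull_scal|]; apply IH; auto.
      -- intros n; apply smooth_on_nderiv1, hh.
      -- intros j; apply unull_ext with (2 := hu (S j)); intros n x; apply nderiv_S.
Qed.

(** Polynomials approximate compactly supported distributions: <u, chi (L_n * f)> is the
    pairing of f with a polynomial. *)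
Lemma poly_approx a (u : distribution a) chi : 0 < a -> is_test a chi ->
  exists p : nat -> distribution a, (forall n, poly_span a (p n)) /\ distr_cv p (dmul chi u).
Proof.
intros ha hchi.
assert (hc : 0 < 2 * a) by lra.
set (h := fun n x y => (RtoC (/ landau_mass (2 * a) n) * RtoC (landau (2 * a) n (x - y)))%C).
assert (hsep : forall n, separated (h n)).
{ intros n; apply (separated_mult_y (fun _ => RtoC (/ landau_mass (2 * a) n)));
    [apply smooth_on_const|apply separated_landau; lra]. }
set (P := fun n => constructive_indefinite_description _
  (pairing_separated a u chi (h n) ha hchi (hsep n))).
exists (fun n => proj1_sig (P n)); split.
- intros n; exact (proj1 (proj2_sig (P n))).
- apply distr_cvE; intros f hf.
  assert (sf := is_test_smooth a f hf).
  unfold dmul; rewrite pairing_transpose; [|apply good_mul|exact hf].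
  2:{ apply smooth_on_sub with everywhere; [easy|now apply is_test_smooth with a]. }
  assert (tcf : is_test a (fun x => chi x * f x)%C).
  { apply is_test_mult; [|exact hf].
    apply smooth_on_sub with everywhere; [easy|now apply is_test_smooth with a]. }
  destruct (test_support a chi ha hchi) as [b [hb hs]].
  assert (e : forall n y, (chi y * RI (fun x => h n x y * f x) (- a) a)%C =
    (chi y * landau_conv (2 * a) n f y)%C).
  { intros n y; destruct (Rlt_le_dec b (Rabs y)) as [hy|hy].
    - rewrite hs by exact hy; ring.
    - rewrite landau_conv_polynomial; auto; apply interval_abs; lra. }
  assert (tn : forall n, is_test a (fun y => chi y * landau_conv (2 * a) n f y)%C).
  { intros n; apply (is_test_ext a _ _ (e n)); now apply (proj2 (proj2_sig (P n))). }
  assert (nu : test_null a (fun n y => chi y * (landau_conv (2 * a) n f y - f y))%C).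
  { apply (test_null_cutoff a chi (fun n y => landau_conv (2 * a) n f y - f y)%C ha hchi).
    - intros n; apply smooth_on_plus; [apply open_everywhere|now apply smooth_landau_conv|].
      apply smooth_on_opp; [apply open_everywhere|exact sf].
    - intros k; assert (tk : is_test a (nderiv k f)).
      { now apply is_test_nderiv. }
      apply unull_ext with (2 := landau_conv_unull (2 * a) hc a _ ha tk); intros n x.
      rewrite <- nderiv_landau_conv by (auto; lra).
      transitivity (nderiv k (fun y => RtoC (-1) * f y + landau_conv (2 * a) n f y)%C x).
      + rewrite (proj1 (nderiv_lin (RtoC (-1)) sf (smooth_landau_conv (2 * a) hc n f sf) k x)); ring.
      + apply nderiv_ext; intros y; ring. }
  apply tends_ext with (fun n => pairing a u (fun x => chi x * f x)%C
    + pairing a u (fun y => chi y * (landau_conv (2 * a) n f y - f y))%C)%C.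
  + intros n; rewrite (proj2 (proj2 (proj2_sig (P n)) f hf)).
    rewrite (pairing_ext a u _ _ (e n)).
    rewrite (pairing_ext a u (fun y => chi y * (landau_conv (2 * a) n f y - f y))%C
      (fun y => chi y * landau_conv (2 * a) n f y - chi y * f y)%C) by (intros; ring).
    rewrite pairing_minus by auto; ring.
  + assert (nt : forall n, is_test a (fun y => chi y * (landau_conv (2 * a) n f y - f y))%C).
    { intros n; apply is_test_ext with
        (fun y => RtoC (-1) * (chi y * f y) + chi y * landau_conv (2 * a) n f y)%C;
        [intros; ring|now apply is_test_lin_fun]. }
    assert (lim := tends_plus _ _ _ _ (tends_const (pairing a u (fun x => chi x * f x)%C))
      (pairing_null a u _ nt nu)).
    rewrite Cplus_0_r in lim; exact lim.
Qed.

(** Against a given test function the cut-off distributions are eventually constant. *)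
Lemma exhaustion a (u : distribution a) : 0 < a ->
  exists chi : nat -> R -> C, (forall m, is_test a (chi m)) /\
    distr_cv (fun m => dmul (chi m) u) u.
Proof.
intros ha.
assert (hex : forall m : nat, exists chi, is_test a chi /\
  forall x, Rabs x <= a - a / (INR m + 2) -> chi x = RtoC 1).
{ intros m; assert (hm := pos_INR m).
  assert (hi : 0 < a / (INR m + 2)) by (apply Rdiv_lt_0_compat; lra).
  assert (hj : a / (INR m + 2) < a).
  { apply Rmult_lt_reg_r with (INR m + 2); [lra|].
    unfold Rdiv; rewrite Rmult_assoc, Rinv_l by lra; nra. }
  destruct (cutoff a (a - a / (INR m + 2)) (a - a / (INR m + 2) / 2)) as [chi [h1 [h2 h3]]];
    [lra|lra|].
  exists chi; split; assumption. }
set (X := fun m => constructive_indefinite_description _ (hex m)).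
exists (fun m => proj1_sig (X m)); split.
- intros m; exact (proj1 (proj2_sig (X m))).
- apply distr_cvE; intros f hf.
  destruct (test_support a f ha hf) as [b [hb hs]].
  destruct (nfloor_ex (a / (a - b))) as [N [_ hN]].
  { apply Rmult_le_pos; [lra|left; apply Rinv_0_lt_compat; lra]. }
  apply tends_eventually with N; intros m hm.
  unfold dmul; rewrite pairing_transpose; [|apply good_mul|exact hf].
  2:{ apply smooth_on_sub with everywhere; [easy|].
      apply is_test_smooth with a; exact (proj1 (proj2_sig (X m))). }
  apply pairing_ext; intros x.
  destruct (Rlt_le_dec b (Rabs x)) as [hx|hx]; [rewrite hs by exact hx; ring|].
  rewrite (proj2 (proj2_sig (X m))); [ring|].
  assert (hm' : INR N <= INR m) by (now apply le_INR).
  assert (hm0 := pos_INR m).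
  assert (h : a / (INR m + 2) <= a - b).
  { apply Rmult_le_reg_r with (INR m + 2); [lra|].
    unfold Rdiv at 1; rewrite Rmult_assoc, Rinv_l by lra.
    apply Rmult_lt_compat_r with (r := a - b) in hN; [|lra].
    unfold Rdiv in hN; rewrite Rmult_assoc, Rinv_l in hN by lra; nra. }
  lra.
Qed.

Lemma distr_cv_unique a (u : nat -> distribution a) v w : distr_cv u v -> distr_cv u w -> v = w.
Proof.
intros h h'; apply distr_eq; intros f hf; rewrite distr_cvE in h, h'.
exact (tends_unique _ _ _ (h f hf) (h' f hf)).
Qed.

Lemma linear_op_zero a (F : distribution a -> distribution a) : linear_op F ->
  F (distr_zero a) = distr_zero a.
Proof.
intros hF; assert (e : distr_zero a = distr_lin (RtoC (-1)) (distr_zero a) (distr_zero a)).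
{ apply distr_eq; intros f _; rewrite pairing_distr_lin, pairing_distr_zero; ring. }
rewrite e at 1; rewrite hF; apply distr_eq; intros f _.
rewrite pairing_distr_lin, pairing_distr_zero.
apply C_eq; simpl; unfold Re, Im; ring.
Qed.

(** Two limits are taken one after the other: in the approximation of a cut-off distribution
    by polynomials, then in the cut-off. *)
Lemma op_eq_of_monomials a (F G : distribution a -> distribution a) : 0 < a ->
  linear_op F -> linear_op G -> continuous_op F -> continuous_op G ->
  (forall k, F (monomial a k) = G (monomial a k)) -> forall u, F u = G u.
Proof.
intros ha lF lG cF cG h u.
assert (hp : forall p, poly_span a p -> F p = G p).
{ intros p hp; induction hp as [|c k v hv IH].
  - now rewrite !linear_op_zero.
  - now rewrite lF, lG, h, IH. }
destruct (exhaustion a u ha) as [chi [t1 t2]].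
assert (hchi : forall m, F (dmul (chi m) u) = G (dmul (chi m) u)).
{ intros m; destruct (poly_approx a u (chi m) ha (t1 m)) as [p [p1 p2]].
  apply distr_cv_unique with (fun n => F (p n)); [now apply cF|].
  apply cG in p2; intros f; refine (filterlim_ext _ _ _ (p2 f)).
  intros n; now rewrite hp. }
apply distr_cv_unique with (fun m => F (dmul (chi m) u)); [now apply cF|].
apply cG in t2; intros f; refine (filterlim_ext _ _ _ (t2 f)).
intros m; now rewrite hchi.
Qed.

(** * Operators commuting with d^2/dx^2 *)

Definition commutes_d2 (a : R) (S : (R -> C) -> R -> C) : Prop :=
  forall f x, is_test a f -> nderiv 2 (S f) x = S (nderiv 2 f) x.

Lemma good_comb a c S S' : good_op a S -> good_op a S' ->
  good_op a (fun f x => c * S f x + S' f x)%C.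
Proof.
intros [h1 h2 h3] [h1' h2' h3']; split.
- intros f hf; apply is_test_lin_fun; auto.
- intros d f g x hf hg; rewrite h2, h2' by assumption; ring.
- intros f tf hf; apply (test_null_lin a c (fun n => S (f n)) (fun n => S' (f n))); auto.
Qed.

Lemma good_scal a c S : good_op a S -> good_op a (fun f x => c * S f x)%C.
Proof.
intros [h1 h2 h3]; split.
- intros f hf; apply is_test_scal; auto.
- intros d f g x hf hg; rewrite h2 by assumption; ring.
- intros f tf hf; apply (test_null_scal a c (fun n => S (f n))); auto.
Qed.

Lemma good_comp a S S' : good_op a S -> good_op a S' -> good_op a (fun f => S (S' f)).
Proof.
intros [h1 h2 h3] [h1' h2' h3']; split.
- auto.
- intros d f g x hf hg.
  replace (S' (fun t => d * f t + g t)%C) with (fun t => d * S' f t + S' g t)%C;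
    [apply h2; auto|].
  apply functional_extensionality; intros t; symmetry; now apply h2'.
- intros f tf hf; apply (h3 (fun n => S' (f n))); auto.
Qed.

Lemma commutes_comb a c S S' : good_op a S -> good_op a S' ->
  commutes_d2 a S -> commutes_d2 a S' -> commutes_d2 a (fun f x => c * S f x + S' f x)%C.
Proof.
intros g g' h h' f x hf.
rewrite nderiv_lin_test with (a := a) by (now apply good_test).
now rewrite h, h'.
Qed.

Lemma commutes_scal a c S : good_op a S ->
  commutes_d2 a S -> commutes_d2 a (fun f x => c * S f x)%C.
Proof.
intros g h f x hf.
rewrite nderiv_scal_test with (a := a) by (now apply good_test).
now rewrite h.
Qed.

Lemma commutes_comp a S S' : good_op a S' ->
  commutes_d2 a S -> commutes_d2 a S' -> commutes_d2 a (fun f => S (S' f)).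
Proof.
intros g h h' f x hf; rewrite h by (now apply good_test).
f_equal; apply functional_extensionality; intros t; now apply h'.
Qed.

Lemma commutes_neg_deriv a : commutes_d2 a (fun f x => (- nderiv 1 f x)%C).
Proof.
intros f x hf.
rewrite (nderiv_ext _ (fun t => RtoC (-1) * nderiv 1 f t)%C)
  by (intros; apply C_eq; simpl; unfold Re, Im; ring).
rewrite nderiv_scal_test with (a := a) by (now apply is_test_nderiv1).
rewrite <- nderiv_S.
replace (nderiv 1 (nderiv 2 f) x) with (nderiv 3 f x).
- apply C_eq; simpl; unfold Re, Im; ring.
- unfold nderiv; simpl; now apply C_eq.
Qed.

Lemma commutes_reflection_comb a (c d : C) S :
  (forall f x, S f x = (c * f x + d * f (- x)%R)%C) -> commutes_d2 a S.
Proof.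
intros e f x hf.
rewrite (nderiv_ext _ (fun t => c * f t + d * f (- t)%R)%C) by (intros; apply e).
assert (hr := is_test_reflect a f hf).
rewrite nderiv_lin_test with (a := a); [|exact hf|now apply is_test_scal].
rewrite (nderiv_scal_test a d (fun t => f (- t))) by exact hr.
rewrite (nderiv_reflect a f 2 x hf), e.
replace ((-1) ^ 2) with 1 by ring; rewrite Cmult_1_l; reflexivity.
Qed.

Lemma commutes_even_part a : commutes_d2 a even_part.
Proof. exact (commutes_reflection_comb a _ _ _ even_partE). Qed.

Lemma commutes_odd_part a : commutes_d2 a odd_part.
Proof. exact (commutes_reflection_comb a _ _ _ odd_partE). Qed.

Lemma nderiv_Asq a f x : 0 < a -> is_test a f -> (forall t, f (- t) = (- f t)%C) ->
  nderiv 1 (Asq a f) x = (- f x)%C.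
Proof. intros ha hf ho; now apply nderiv_1, is_cderive_Asq. Qed.

Lemma commutes_Asq_odd a : 0 < a -> commutes_d2 a (fun f => Asq a (odd_part f)).
Proof.
intros ha f x hf.
assert (ho : is_test a (odd_part f)) by (now apply good_odd_part).
assert (ho2 := is_test_nderiv a f 2 hf).
assert (t2 : is_test a (odd_part (nderiv 2 f))) by (now apply good_odd_part).
rewrite nderiv_S, (nderiv_ext _ (fun t => RtoC (-1) * odd_part f t)%C).
2:{ intros t; rewrite nderiv_Asq by (auto using odd_part_reflect).
    apply C_eq; simpl; unfold Re, Im; ring. }
rewrite nderiv_scal_test with (a := a) by exact ho.
rewrite AsqE by (auto using odd_part_reflect).
assert (e : forall t, odd_part (nderiv 2 f) t = nderiv 1 (nderiv 1 (odd_part f)) t).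
{ intros t; rewrite <- nderiv_S; symmetry; now apply (commutes_odd_part a). }
rewrite (RI_ext _ (nderiv 1 (nderiv 1 (odd_part f)))) by (intros; apply e).
assert (t1 := is_test_nderiv1 a _ ho).
rewrite (RI_FTC (nderiv 1 (odd_part f))).
- destruct (test_support a _ ha t1) as [b [hb hs]].
  rewrite (hs (- a)); [apply C_eq; simpl; unfold Re, Im; ring|].
  rewrite Rabs_Ropp, Rabs_right; lra.
- intros z _; now apply is_test_cderive with a.
- apply is_test_seg with a; now apply is_test_nderiv1.
Qed.

Section Combination.

Variables (a : R) (c1 c2 c3 c4 : C).
Hypothesis a_pos : 0 < a.

(** The transpose of c1 P_+ + c2 P_- + c3 A P_+ + c4 (d/dx) P_-. *)
Definition comb_op (f : R -> C) (x : R) : C :=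
  (c1 * even_part f x + (c2 * odd_part f x + (c3 * Asq a (odd_part f) x
   + c4 * odd_part (fun t => - nderiv 1 f t) x)))%C.

Lemma good_comb_op : good_op a comb_op.
Proof.
apply (good_comb a c1 even_part); [apply good_even_part|].
apply (good_comb a c2 odd_part); [apply good_odd_part|].
apply (good_comb a c3 (fun f => Asq a (odd_part f))); [now apply good_Asq_odd|].
apply (good_scal a c4 (fun f => odd_part (fun t => - nderiv 1 f t)%C)).
apply (good_comp a odd_part (fun f t => - nderiv 1 f t)%C);
  [apply good_odd_part|apply good_neg_deriv].
Qed.

Lemma commutes_comb_op : commutes_d2 a comb_op.
Proof.
assert (g4 : good_op a (fun f => odd_part (fun t => - nderiv 1 f t)%C)).
{ apply (good_comp a odd_part (fun f t => - nderiv 1 f t)%C);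
    [apply good_odd_part|apply good_neg_deriv]. }
assert (h4 : commutes_d2 a (fun f => odd_part (fun t => - nderiv 1 f t)%C)).
{ apply (commutes_comp a odd_part (fun f t => - nderiv 1 f t)%C);
    [apply good_neg_deriv|apply commutes_odd_part|apply commutes_neg_deriv]. }
assert (g4' := good_scal a c4 _ g4).
assert (g3 := good_comb a c3 _ _ (good_Asq_odd a a_pos) g4').
assert (g2 := good_comb a c2 _ _ (good_odd_part a) g3).
apply (commutes_comb a c1 even_part); [apply good_even_part|exact g2|apply commutes_even_part|].
apply (commutes_comb a c2 odd_part); [apply good_odd_part|exact g3|apply commutes_odd_part|].
apply (commutes_comb a c3 (fun f => Asq a (odd_part f)));
  [now apply good_Asq_odd|exact g4'|now apply commutes_Asq_odd|].
now apply (commutes_scal a c4 (fun f => odd_part (fun t => - nderiv 1 f t)%C)).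
Qed.

(** ** The combination on functions *)

(** Here [Gam] is any primitive of g: its odd part is the integral of the even part of g
    from 0 to x. The even part of g' is the derivative of the odd part of g. *)
Definition comb_fun (g Gam : R -> C) (x : R) : C :=
  (c1 * even_part g x + (c2 * odd_part g x + (c3 * odd_part Gam x
   + c4 * even_part (nderiv 1 g) x)))%C.

Lemma smooth_reflect g : smooth_on everywhere g -> smooth_on everywhere (fun x => g (- x)).
Proof.
intros h; apply smooth_on_ext with (fun x => g (-1 * x + 0)); [apply open_everywhere| |].
- intros x _; f_equal; ring.
- apply smooth_on_affine with everywhere; [apply open_everywhere|easy|exact h].
Qed.

Lemma smooth_even_part g : smooth_on everywhere g -> smooth_on everywhere (even_part g).
Proof.
intros h; apply smooth_on_ext with (fun x => RtoC (/ 2) * g x + RtoC (/ 2) * g (- x)%R)%C;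
  [apply open_everywhere|intros; symmetry; apply even_partE|].
apply smooth_on_plus; [apply open_everywhere| |];
  (apply smooth_on_mult; [apply open_everywhere|apply smooth_on_const|]);
  [exact h|now apply smooth_reflect].
Qed.

Lemma smooth_odd_part g : smooth_on everywhere g -> smooth_on everywhere (odd_part g).
Proof.
intros h; apply smooth_on_ext with (fun x => RtoC (/ 2) * g x + RtoC (- / 2) * g (- x)%R)%C;
  [apply open_everywhere|intros; symmetry; apply odd_partE|].
apply smooth_on_plus; [apply open_everywhere| |];
  (apply smooth_on_mult; [apply open_everywhere|apply smooth_on_const|]);
  [exact h|now apply smooth_reflect].
Qed.

Lemma is_cderive_reflect g x l : is_cderive g (- x) l -> is_cderive (fun t => g (- t)) x (- l)%C.
Proof.
intros h; apply is_cderive_eq with (RtoC (-1) * l)%C.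
- apply (is_cderive_comp g (fun t => - t)); [exact h|auto_derive; [auto|ring]].
- apply C_eq; simpl; unfold Re, Im; ring.
Qed.

Lemma is_cderive_even_part g g' x : (forall y, is_cderive g y (g' y)) ->
  is_cderive (even_part g) x (odd_part g' x).
Proof.
intros h; apply is_cderive_ext with (fun x => RtoC (/ 2) * g x + RtoC (/ 2) * g (- x)%R)%C.
- intros; symmetry; apply even_partE.
- eapply is_cderive_eq; [apply is_cderive_plus; apply is_cderive_scal;
    [apply h|apply is_cderive_reflect, h]|].
  rewrite odd_partE, RtoC_opp; ring.
Qed.

Lemma is_cderive_odd_part g g' x : (forall y, is_cderive g y (g' y)) ->
  is_cderive (odd_part g) x (even_part g' x).
Proof.
intros h; apply is_cderive_ext with (fun x => RtoC (/ 2) * g x + RtoC (- / 2) * g (- x)%R)%C.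
- intros; symmetry; apply odd_partE.
- eapply is_cderive_eq; [apply is_cderive_plus; apply is_cderive_scal;
    [apply h|apply is_cderive_reflect, h]|].
  rewrite even_partE, RtoC_opp; ring.
Qed.

Lemma even_part_0 g : even_part g 0 = g 0.
Proof. unfold even_part; rewrite Ropp_0; field; apply half_neq. Qed.

Lemma odd_part_0 g : odd_part g 0 = RtoC 0.
Proof. unfold odd_part; rewrite Ropp_0; field; apply half_neq. Qed.

Section Fun.

Variables (g Gam : R -> C).
Hypothesis g_smooth : smooth_on everywhere g.
Hypothesis Gam_derive : forall x, is_cderive Gam x (g x).

Lemma smooth_cderive h x : smooth_on everywhere h -> is_cderive h x (nderiv 1 h x).
Proof. intros hh; now apply smooth_on_cderive with everywhere. Qed.

Lemma smooth_ccont h x : smooth_on everywhere h -> ccont h x.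
Proof. intros hh; now apply smooth_on_ccont with everywhere. Qed.

Lemma Gam_smooth : smooth_on everywhere Gam.
Proof. apply smooth_on_of_derive with g; auto using open_everywhere. Qed.

Lemma comb_fun_smooth : smooth_on everywhere (comb_fun g Gam).
Proof.
assert (ho := open_everywhere); assert (hG := Gam_smooth).
assert (hg' := smooth_on_nderiv1 _ _ g_smooth).
assert (sc : forall (c : C) h, smooth_on everywhere h -> smooth_on everywhere (fun x => c * h x)%C).
{ intros c h hh; apply smooth_on_mult; auto using smooth_on_const. }
apply (smooth_on_plus everywhere (fun x => c1 * even_part g x)%C); [exact ho| |].
{ now apply sc, smooth_even_part. }
apply (smooth_on_plus everywhere (fun x => c2 * odd_part g x)%C); [exact ho| |].
{ now apply sc, smooth_odd_part. }
apply (smooth_on_plus everywhere (fun x => c3 * odd_part Gam x)%C); [exact ho| |].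
{ now apply sc, smooth_odd_part. }
now apply sc, smooth_even_part.
Qed.

Lemma comb_fun_0 : comb_fun g Gam 0 = (c1 * g 0 + c4 * nderiv 1 g 0)%C.
Proof. unfold comb_fun; rewrite !even_part_0, !odd_part_0; ring. Qed.

Lemma comb_fun_deriv_0 : nderiv 1 (comb_fun g Gam) 0 = (c2 * nderiv 1 g 0 + c3 * g 0)%C.
Proof.
assert (dg : forall x, is_cderive g x (nderiv 1 g x)) by (intros; now apply smooth_cderive).
assert (dg' : forall x, is_cderive (nderiv 1 g) x (nderiv 1 (nderiv 1 g) x)).
{ intros; apply smooth_cderive; now apply smooth_on_nderiv1. }
apply nderiv_1; eapply is_cderive_eq.
- apply (is_cderive_plus (fun x => c1 * even_part g x)%C); [apply is_cderive_scal|].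
  2: apply (is_cderive_plus (fun x => c2 * odd_part g x)%C); [apply is_cderive_scal|].
  3: apply (is_cderive_plus (fun x => c3 * odd_part Gam x)%C); apply is_cderive_scal.
  + apply (is_cderive_even_part g (nderiv 1 g)), dg.
  + apply (is_cderive_odd_part g (nderiv 1 g)), dg.
  + apply (is_cderive_odd_part Gam g), Gam_derive.
  + apply (is_cderive_even_part (nderiv 1 g) (nderiv 1 (nderiv 1 g))), dg'.
- rewrite !even_part_0, !odd_part_0; ring.
Qed.

Lemma smooth_test_seg h f : smooth_on everywhere h -> is_test a f ->
  ccont_seg (fun x => h x * f x)%C (- a) a.
Proof.
intros hh hf x _; apply ccont_mult; [now apply smooth_ccont|now apply is_test_ccont with a].
Qed.

Lemma RI_parts h h' f : (forall x, is_cderive h x (h' x)) -> (forall x, ccont h' x) ->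
  is_test a f ->
  RI (fun x => h' x * f x)%C (- a) a = (- RI (fun x => h x * nderiv 1 f x)%C (- a) a)%C.
Proof.
intros dh ch hf; assert (hf' := is_test_nderiv1 a f hf).
assert (s1 : ccont_seg (fun x => h' x * f x)%C (- a) a).
{ intros x _; apply ccont_mult; [apply ch|now apply is_test_ccont with a]. }
assert (s2 : ccont_seg (fun x => h x * nderiv 1 f x)%C (- a) a).
{ intros x _; apply ccont_mult; [eapply is_cderive_ccont, dh|now apply is_test_ccont with a]. }
assert (e : RI (fun x => h' x * f x + h x * nderiv 1 f x)%C (- a) a = RtoC 0).
{ rewrite (RI_FTC (fun x => h x * f x)%C).
  - destruct (test_support a f a_pos hf) as [b [hb hs]].
    rewrite (hs a), (hs (- a)); [ring|rewrite Rabs_Ropp|]; rewrite Rabs_right; lra.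
  - intros x _; apply is_cderive_mult; [apply dh|now apply is_test_cderive with a].
  - now apply ccont_seg_plus. }
rewrite RI_plus in e by assumption.
replace (RI (fun x => h' x * f x)%C (- a) a) with
  ((RI (fun x => h' x * f x)%C (- a) a + RI (fun x => h x * nderiv 1 f x)%C (- a) a)
   - RI (fun x => h x * nderiv 1 f x)%C (- a) a)%C by ring.
rewrite e; ring.
Qed.

Lemma RI_reflect h f : smooth_on everywhere h -> is_test a f ->
  RI (fun x => h x * f (- x)%R)%C (- a) a = RI (fun x => h (- x)%R * f x)%C (- a) a.
Proof.
intros hh hf.
assert (s : ccont_seg (fun x => h (- x)%R * f x)%C (- a) a).
{ apply (smooth_test_seg (fun x => h (- x))); [now apply smooth_reflect|exact hf]. }
assert (s' : ccont_seg (fun x => h (- x)%R * f x)%C (- - a) (- a)).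
{ rewrite Ropp_involutive; intros z hz; apply s; now rewrite Rmin_comm, Rmax_comm in hz. }
assert (e := RI_neg _ (- a) a s'); rewrite Ropp_involutive in e.
rewrite (RI_swap _ (- a) a) in e by exact s.
rewrite (RI_ext (fun x => h x * f (- x)%R)%C (fun x => h (- - x)%R * f (- x)%R)%C).
- etransitivity; [exact e|ring].
- intros x _; now rewrite Ropp_involutive.
Qed.

Lemma RI_reflection_comb (c d : C) h f : smooth_on everywhere h -> is_test a f ->
  RI (fun x => h x * (c * f x + d * f (- x)%R))%C (- a) a =
  RI (fun x => (c * h x + d * h (- x)%R) * f x)%C (- a) a.
Proof.
intros hh hf; assert (hr := is_test_reflect a f hf).
assert (s1 := smooth_test_seg h f hh hf).
assert (s2 := smooth_test_seg h _ hh hr).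
assert (s3 := smooth_test_seg _ f (smooth_reflect h hh) hf).
assert (sc : forall (k : C) u, ccont_seg u (- a) a -> ccont_seg (fun x => k * u x)%C (- a) a).
{ intros k u hu; apply (ccont_seg_mult (fun _ => k)); [intros z _; apply ccont_const|exact hu]. }
rewrite (RI_ext _ (fun x => c * (h x * f x) + d * (h x * f (- x)%R))%C) by (intros; ring).
rewrite (RI_ext (fun x => (c * h x + d * h (- x)%R) * f x)%C
  (fun x => c * (h x * f x) + d * (h (- x)%R * f x))%C) by (intros; ring).
rewrite (RI_plus (fun x => c * (h x * f x))%C (fun x => d * (h x * f (- x)%R))%C) by auto.
rewrite (RI_plus (fun x => c * (h x * f x))%C (fun x => d * (h (- x)%R * f x))%C) by auto.
rewrite !RI_scal by assumption; now rewrite RI_reflect.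
Qed.

Lemma RI_even_part h f : smooth_on everywhere h -> is_test a f ->
  RI (fun x => h x * even_part f x)%C (- a) a = RI (fun x => even_part h x * f x)%C (- a) a.
Proof.
intros hh hf.
rewrite (RI_ext _ (fun x => h x * (RtoC (/ 2) * f x + RtoC (/ 2) * f (- x)%R))%C)
  by (intros; now rewrite even_partE).
rewrite RI_reflection_comb by assumption.
apply RI_ext; intros; now rewrite even_partE.
Qed.

Lemma RI_odd_part h f : smooth_on everywhere h -> is_test a f ->
  RI (fun x => h x * odd_part f x)%C (- a) a = RI (fun x => odd_part h x * f x)%C (- a) a.
Proof.
intros hh hf.
rewrite (RI_ext _ (fun x => h x * (RtoC (/ 2) * f x + RtoC (- / 2) * f (- x)%R))%C)
  by (intros; now rewrite odd_partE).
rewrite RI_reflection_comb by assumption.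
apply RI_ext; intros; now rewrite odd_partE.
Qed.

Lemma comb_op_regular :
  transpose comb_op (regular a g) = regular a (comb_fun g Gam).
Proof.
assert (cg : ccont_I a g) by (intros x _; now apply smooth_ccont).
assert (cc : ccont_I a (comb_fun g Gam)).
{ intros x _; apply smooth_ccont, comb_fun_smooth. }
assert (hG := Gam_smooth).
apply distr_eq; intros f hf.
rewrite pairing_transpose by (auto using good_comb_op).
assert (tf : is_test a (comb_op f)) by (now apply good_comb_op).
rewrite !pairing_regular by assumption.
assert (te : is_test a (even_part f)) by (now apply good_even_part).
assert (to : is_test a (odd_part f)) by (now apply good_odd_part).
assert (tA : is_test a (Asq a (odd_part f))).
{ now apply (good_test _ _ (good_Asq_odd a a_pos)). }
assert (td : is_test a (fun t => - nderiv 1 f t)%C).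
{ now apply (good_test _ _ (good_neg_deriv a)). }
assert (tod : is_test a (odd_part (fun t => - nderiv 1 f t)%C)) by (now apply good_odd_part).
set (d := nderiv 1 g).
assert (hd : smooth_on everywhere d) by (now apply smooth_on_nderiv1).
assert (i3 : RI (fun x => g x * Asq a (odd_part f) x)%C (- a) a =
             RI (fun x => odd_part Gam x * f x)%C (- a) a).
{ rewrite (RI_parts Gam) by (auto; intros; now apply smooth_ccont).
  rewrite <- RI_odd_part by assumption.
  rewrite (RI_ext _ (fun x => - (Gam x * odd_part f x))%C).
  - rewrite RI_opp by (now apply smooth_test_seg); ring.
  - intros x _; rewrite nderiv_Asq by (auto using odd_part_reflect); ring. }
assert (i4 : RI (fun x => g x * odd_part (fun t => - nderiv 1 f t) x)%C (- a) a =
             RI (fun x => even_part d x * f x)%C (- a) a).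
{ rewrite RI_odd_part by assumption.
  rewrite (RI_parts (odd_part g) (even_part d) f).
  - rewrite <- RI_opp.
    + apply RI_ext; intros; ring.
    + apply smooth_test_seg; [now apply smooth_odd_part|now apply is_test_nderiv1].
  - intros x; apply is_cderive_odd_part; intros; now apply smooth_cderive.
  - intros x; apply smooth_ccont; now apply smooth_even_part.
  - exact hf. }
assert (sc : forall (k : C) u, ccont_seg u (- a) a -> ccont_seg (fun x => k * u x)%C (- a) a).
{ intros k u hu; apply (ccont_seg_mult (fun _ => k)); [intros z _; apply ccont_const|exact hu]. }
assert (add4 : forall u1 u2 u3 u4 : R -> C, ccont_seg u1 (- a) a -> ccont_seg u2 (- a) a ->
  ccont_seg u3 (- a) a -> ccont_seg u4 (- a) a ->
  RI (fun x => c1 * u1 x + (c2 * u2 x + (c3 * u3 x + c4 * u4 x)))%C (- a) a =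
  (c1 * RI u1 (- a) a + (c2 * RI u2 (- a) a + (c3 * RI u3 (- a) a + c4 * RI u4 (- a) a)))%C).
{ intros u1 u2 u3 u4 h1 h2 h3 h4.
  assert (k3 := ccont_seg_plus _ _ _ _ (sc c3 u3 h3) (sc c4 u4 h4)).
  assert (k2 := ccont_seg_plus _ _ _ _ (sc c2 u2 h2) k3).
  rewrite (RI_plus (fun x => c1 * u1 x)%C _ _ _ (sc c1 u1 h1) k2).
  rewrite (RI_plus (fun x => c2 * u2 x)%C _ _ _ (sc c2 u2 h2) k3).
  rewrite (RI_plus (fun x => c3 * u3 x)%C _ _ _ (sc c3 u3 h3) (sc c4 u4 h4)).
  now rewrite !RI_scal by assumption. }
rewrite (RI_ext _ (fun x => c1 * (g x * even_part f x) + (c2 * (g x * odd_part f x)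
  + (c3 * (g x * Asq a (odd_part f) x)
     + c4 * (g x * odd_part (fun t => - nderiv 1 f t) x))))%C)
  by (intros; unfold comb_op; ring).
rewrite (RI_ext (fun x => comb_fun g Gam x * f x)%C
  (fun x => c1 * (even_part g x * f x) + (c2 * (odd_part g x * f x)
  + (c3 * (odd_part Gam x * f x) + c4 * (even_part d x * f x))))%C)
  by (intros; unfold comb_fun, d; ring).
rewrite (add4 (fun x => g x * even_part f x)%C (fun x => g x * odd_part f x)%C
  (fun x => g x * Asq a (odd_part f) x)%C
  (fun x => g x * odd_part (fun t => - nderiv 1 f t) x)%C) by (now apply smooth_test_seg).
rewrite (add4 (fun x => even_part g x * f x)%C (fun x => odd_part g x * f x)%C
  (fun x => odd_part Gam x * f x)%C (fun x => even_part d x * f x)%C)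
  by (apply smooth_test_seg; auto using smooth_even_part, smooth_odd_part).
now rewrite RI_even_part, RI_odd_part, i3, i4.
Qed.

End Fun.

End Combination.

(** * Transmutations *)

Lemma linear_transpose a S : good_op a S -> linear_op (transpose (a := a) S).
Proof.
intros hS c u v; apply distr_eq; intros f hf.
rewrite pairing_distr_lin, !pairing_transpose by assumption.
apply pairing_distr_lin.
Qed.

Lemma pairing_d2 a (u : distribution a) f : is_test a f ->
  pairing a (dderiv (dderiv u)) f = pairing a u (nderiv 2 f).
Proof.
intros hf; assert (hf' := is_test_nderiv1 a f hf); unfold dderiv.
rewrite !pairing_transpose; auto using good_neg_deriv;
  [|now apply (good_test _ _ (good_neg_deriv a))].
apply pairing_ext; intros x.
rewrite (nderiv_ext _ (fun t => RtoC (-1) * nderiv 1 f t)%C)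
  by (intros; apply C_eq; simpl; unfold Re, Im; ring).
rewrite nderiv_scal_test with (a := a) by exact hf'.
rewrite <- nderiv_S; apply C_eq; simpl; unfold Re, Im; ring.
Qed.

Lemma d2_regular a g : 0 < a -> smooth_on everywhere g ->
  dderiv (dderiv (regular a g)) = regular a (nderiv 2 g).
Proof.
intros ha hg; assert (hg1 := smooth_on_nderiv1 _ _ hg); assert (hg2 := smooth_on_nderiv1 _ _ hg1).
assert (e2 : nderiv 1 (nderiv 1 g) = nderiv 2 g).
{ apply functional_extensionality; intros x; symmetry; apply nderiv_S. }
rewrite e2 in hg2.
apply distr_eq; intros f hf; rewrite pairing_d2 by exact hf.
rewrite !pairing_regular; auto using is_test_nderiv;
  try (intros x _; now apply smooth_ccont).
assert (hf1 := is_test_nderiv1 a f hf); assert (hf2 := is_test_nderiv a f 2 hf).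
destruct (test_support a f ha hf) as [b [hb hs]].
assert (hs1 := nderiv_supported b f 1 hs).
assert (out : b < Rabs (- a) /\ b < Rabs a) by (rewrite Rabs_Ropp, Rabs_right by lra; lra).
destruct out as [o1 o2].
apply (RI_green f (nderiv 1 f) (nderiv 2 f) g (nderiv 1 g) (nderiv 2 g)); auto.
intros x _.
assert (df2 : is_cderive (nderiv 1 f) x (nderiv 2 f x)).
{ rewrite nderiv_S; now apply is_test_cderive with a. }
assert (dg2 : is_cderive (nderiv 1 g) x (nderiv 2 g x)).
{ rewrite nderiv_S; now apply smooth_cderive. }
exact (conj (is_test_cderive a f x hf) (conj df2 (conj (smooth_cderive g x hg) (conj dg2
  (conj (is_test_ccont a _ x hf2) (smooth_ccont _ x hg2)))))).
Qed.

Lemma is_cderive_pow k x :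
  is_cderive (fun t => RtoC (t ^ S k)) x (RtoC (INR (S k)) * RtoC (x ^ k))%C.
Proof.
rewrite <- RtoC_mult; apply is_cderive_RtoC.
replace (INR (S k) * x ^ k) with (INR (S k) * 1 * x ^ Nat.pred (S k)) by (simpl; ring).
apply (is_derive_pow (fun t => t) (S k) x 1).
apply (is_derive_id (K := R_AbsRing)).
Qed.

Lemma d2_monomial a k : 0 < a -> exists c : C, exists j : nat,
  dderiv (dderiv (monomial a k)) = distr_scal c (monomial a j) /\
  (c = RtoC 0 \/ (j + 2 <= k)%nat).
Proof.
intros ha; unfold monomial.
assert (sp : forall j, smooth_on everywhere (fun x => RtoC (x ^ j))).
{ intros j; apply smooth_on_pow, open_everywhere. }
assert (red : forall (c : C) (j : nat), (forall x, nderiv 2 (fun x => RtoC (x ^ k)) x = (c * RtoC (x ^ j))%C) ->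
  dderiv (dderiv (regular a (fun x => RtoC (x ^ k)))) =
  distr_scal c (regular a (fun x => RtoC (x ^ j)))).
{ intros c j e; rewrite d2_regular by auto; apply distr_eq; intros f hf.
  rewrite pairing_distr_scal, !pairing_regular; auto.
  - rewrite <- RI_scal.
    + apply RI_ext; intros x _; rewrite e; ring.
    + intros x _; apply ccont_mult; [now apply smooth_ccont|now apply is_test_ccont with a].
  - intros x _; now apply smooth_ccont.
  - intros x _; apply smooth_ccont.
    apply smooth_on_ext with (nderiv 1 (nderiv 1 (fun x => RtoC (x ^ k)))).
    + apply open_everywhere.
    + intros t _; symmetry; apply nderiv_S.
    + now apply smooth_on_nderiv1, smooth_on_nderiv1. }
destruct k as [|[|k]].
- exists (RtoC 0), O; split; [|now left]; apply red; intros x.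
  rewrite Cmult_0_l, nderiv_S.
  rewrite (nderiv_ext _ (fun _ => RtoC 0)); [apply nderiv_zero|].
  intros t; exact (nderiv_1 _ _ _ (is_cderive_const (RtoC 1) t)).
- exists (RtoC 0), O; split; [|now left]; apply red; intros x.
  rewrite Cmult_0_l, nderiv_S.
  rewrite (nderiv_ext _ (fun _ => RtoC (INR 1) * RtoC 1)%C).
  + exact (nderiv_1 _ _ _ (is_cderive_const _ x)).
  + intros t; exact (nderiv_1 _ _ _ (is_cderive_pow 0 t)).
- exists (RtoC (INR (S (S k))) * RtoC (INR (S k)))%C, k; split; [|right; lia].
  apply red; intros x; rewrite nderiv_S.
  rewrite (nderiv_ext _ (fun t => RtoC (INR (S (S k))) * RtoC (t ^ S k))%C).
  + rewrite <- Cmult_assoc; apply nderiv_1, is_cderive_scal, is_cderive_pow.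
  + intros t; apply nderiv_1, is_cderive_pow.
Qed.

Section Main.

Variables (a : R) (q : R -> C) (H : R -> R -> C).
Hypothesis a_pos : 0 < a.
Hypothesis q_smooth : smooth_on (interval a) q.
Hypothesis H_goursat : goursat_solution a q H.

Let T : distribution a -> distribution a := T_op (kernel H).
Let good_T : good_op a (Tsq a (kernel H)) := good_Tsq a q H a_pos q_smooth H_goursat.

Lemma transmutation_pairing (F : distribution a -> distribution a) :
  linear_op F ->
  transmutation q F <-> forall u f, is_test a f ->
    pairing a (F u) (Lop q f) = pairing a (F (dderiv (dderiv u))) f.
Proof.
intros lF.
assert (e : forall u f, is_test a f ->
  pairing a (distr_sub (dderiv (dderiv u)) (dmul q u)) f = pairing a u (Lop q f)).
{ intros u f hf; rewrite pairing_distr_sub, pairing_d2 by exact hf.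
  unfold dmul; rewrite pairing_transpose by (auto using good_mul).
  rewrite <- pairing_minus.
  - apply pairing_ext; intros x; unfold Lop; now rewrite nderiv_S.
  - now apply is_test_nderiv.
  - now apply is_test_mult. }
split.
- intros [_ h] u f hf; rewrite <- h, e by exact hf; reflexivity.
- intros h; split; [exact lF|]; intros u; apply distr_eq; intros f hf.
  rewrite e by exact hf; now apply h.
Qed.

Lemma pairing_T u f : is_test a f -> pairing a (T u) f = pairing a u (Tsq a (kernel H) f).
Proof. intros hf; unfold T, T_op; now apply pairing_transpose. Qed.

Section Comb.

Variables c1 c2 c3 c4 : C.

Let G (u : distribution a) : distribution a :=
  distr_add (distr_scal c1 (T (P_even u)))
    (distr_add (distr_scal c2 (T (P_odd u)))
    (distr_add (distr_scal c3 (T (AP_even u)))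
      (distr_scal c4 (T (dderiv (P_odd u)))))).
Let S := comb_op a c1 c2 c3 c4.
Let good_S : good_op a S := good_comb_op a c1 c2 c3 c4 a_pos.

(** T acts last in each of the four terms, so the combination can be formed before it. *)
Lemma combE u : G u = T (transpose S u).
Proof.
apply distr_eq; intros f hf; unfold G.
rewrite !pairing_distr_add, !pairing_distr_scal, !pairing_T by exact hf.
set (w := Tsq a (kernel H) f).
assert (tw : is_test a w) by (now apply good_test).
assert (td : is_test a (fun t => - nderiv 1 w t)%C).
{ now apply (good_test _ _ (good_neg_deriv a)). }
assert (te : is_test a (even_part w)) by (now apply good_even_part).
assert (to : is_test a (odd_part w)) by (now apply good_odd_part).
assert (tA : is_test a (Asq a (odd_part w))).
{ now apply (good_test _ _ (good_Asq_odd a a_pos)). }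
assert (tod : is_test a (odd_part (fun t => - nderiv 1 w t)%C)) by (now apply good_odd_part).
unfold P_even, P_odd, AP_even, dderiv.
rewrite !pairing_transpose; auto using good_even_part, good_odd_part, good_Asq_odd, good_neg_deriv.
unfold S, comb_op.
rewrite (pairing_lin a u c1 (even_part w)); [|exact te|].
- rewrite (pairing_lin a u c2 (odd_part w)); [|exact to|].
  + rewrite (pairing_lin a u c3 (Asq a (odd_part w))); [|exact tA|now apply is_test_scal].
    now rewrite pairing_scal.
  + apply is_test_lin_fun; [exact tA|now apply is_test_scal].
- apply is_test_lin_fun; [exact to|].
  apply is_test_lin_fun; [exact tA|now apply is_test_scal].
Qed.

Lemma linear_comb : linear_op G.
Proof.
intros c u v; rewrite !combE.
rewrite (linear_transpose a S good_S); exact (linear_transpose a _ good_T c _ _).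
Qed.

Lemma continuous_comb : continuous_op G.
Proof.
intros u v h.
assert (h' := continuous_op_comp a T (transpose S) (continuous_transpose a _ good_T)
  (continuous_transpose a _ good_S) u v h).
intros f; rewrite combE; refine (filterlim_ext _ _ _ (h' f)).
intros n; now rewrite combE.
Qed.

(** Both factors behave: the transpose of T turns f'' - q f into a second derivative, and
    [comb_op] commutes with second derivatives. *)
Lemma transmutation_comb u f : is_test a f ->
  pairing a (G u) (Lop q f) = pairing a (G (dderiv (dderiv u))) f.
Proof.
intros hf; assert (hL := is_test_Lop a q q_smooth f hf).
rewrite !combE, !pairing_T by assumption.
set (w := Tsq a (kernel H) f).
assert (tw : is_test a w) by (now apply good_test).
assert (twL : is_test a (Tsq a (kernel H) (Lop q f))) by (now apply good_test).
rewrite (pairing_transpose a S u _ good_S twL), (pairing_transpose a S _ w good_S tw).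
rewrite pairing_d2 by (now apply (good_test a S)).
apply pairing_ext; intros x; unfold S.
rewrite (commutes_comb_op a c1 c2 c3 c4 a_pos w x tw).
apply (f_equal (fun h => comb_op a c1 c2 c3 c4 h x)).
apply functional_extensionality; intros t.
rewrite nderiv_S; symmetry; now apply (Tsq_Lop a q H).
Qed.

(** The Cauchy data at 0 see only g(0) and g'(0): this gives at once the standard property
    (both vanish for x^k with k >= 2) and the role of the four coefficients. *)
Lemma comb_regular g Gam : smooth_on everywhere g -> (forall x, is_cderive Gam x (g x)) ->
  exists phi, smooth_on (interval a) phi /\ G (regular a g) = regular a phi /\
    phi 0 = (c1 * g 0 + c4 * nderiv 1 g 0)%C /\
    nderiv 1 phi 0 = (c2 * nderiv 1 g 0 + c3 * g 0)%C.
Proof.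
intros hg hG.
set (p := comb_fun c1 c2 c3 c4 g Gam).
assert (sp : smooth_on everywhere p) by (now apply comb_fun_smooth).
assert (spI : smooth_on (interval a) p) by (now apply smooth_on_sub with everywhere).
exists (Tfun H p); split; [|split; [|split]].
- now apply (Tfun_smooth a q H).
- rewrite combE; unfold S; rewrite (comb_op_regular a c1 c2 c3 c4 a_pos g Gam) by assumption.
  apply (T_op_regular a q H); auto; intros x hx; now apply smooth_on_ccont with (interval a).
- rewrite Tfun_0; apply comb_fun_0.
- rewrite <- (comb_fun_deriv_0 c1 c2 c3 c4 g Gam hg hG); fold p.
  rewrite (nderiv_1 _ _ (dTfun q H p (nderiv 1 p) 0)); [apply dTfun_0|].
  apply (Tfun_derive a q H); auto.
  + intros y _; now apply smooth_cderive.
  + intros y _; apply smooth_ccont; now apply smooth_on_nderiv1.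
  + unfold interval; lra.
Qed.

End Comb.

Lemma origin : interval a 0.
Proof. unfold interval; lra. Qed.

(** T maps solutions of g'' = 0 to solutions of y'' = q y and preserves Cauchy data at 0. *)
Lemma Tfun_affine g (m : C) : (forall x, is_cderive g x m) ->
  (smooth_on (interval a) (Tfun H g) /\
   forall x, interval a x -> is_cderive (nderiv 1 (Tfun H g)) x (q x * Tfun H g x)%C) /\
  Tfun H g 0 = g 0 /\ nderiv 1 (Tfun H g) 0 = m.
Proof.
intros hg.
assert (sg : smooth_on (interval a) g).
{ apply smooth_on_of_derive with (fun _ => m); [apply open_interval|auto|apply smooth_on_const]. }
assert (cm : ccont_I a (fun _ => m)) by (intros x _; apply ccont_const).
assert (d1 : forall x, interval a x -> is_cderive (Tfun H g) x (dTfun q H g (fun _ => m) x)).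
{ intros x hx; apply (Tfun_derive a q H); auto. }
split; [split|split].
- now apply (Tfun_smooth a q H).
- intros x hx; apply is_cderive_ext_loc with (dTfun q H g (fun _ => m)).
  + eapply filter_imp; [|exact (open_interval a x hx)]; intros t ht; symmetry.
    now apply nderiv_1, d1.
  + apply is_cderive_eq with (q x * Tfun H g x + Tfun H (fun _ => RtoC 0) x)%C.
    * apply (dTfun_derive a q H) with (g'' := fun _ => RtoC 0); auto.
      -- intros; apply is_cderive_const.
      -- intros y _; apply ccont_const.
    * unfold Tfun at 2, Ht; rewrite (RI_ext _ (fun _ => RtoC 0)), RI_zero by (intros; ring); ring.
- apply Tfun_0.
- rewrite (nderiv_1 _ _ _ (d1 0 origin)); apply dTfun_0.
Qed.

Let y1 := Tfun H (fun _ => RtoC 1).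
Let y2 := Tfun H (fun x => RtoC x).
Let sol1 := Tfun_affine (fun _ => RtoC 1) (RtoC 0) (fun x => is_cderive_const _ x).
Let sol2 := Tfun_affine (fun x => RtoC x) (RtoC 1)
  (fun x => is_cderive_RtoC _ x 1 (is_derive_id (K := R_AbsRing) x)).

Lemma wronskian_one x : interval a x ->
  (y1 x * nderiv 1 y2 x - nderiv 1 y1 x * y2 x)%C = RtoC 1.
Proof.
destruct sol1 as [[s1 d1] [v1 w1]], sol2 as [[s2 d2] [v2 w2]].
fold y1 in s1, d1, v1, w1; fold y2 in s2, d2, v2, w2.
intros hx.
rewrite <- (is_cderive_zero_const
  (fun x => y1 x * nderiv 1 y2 x - nderiv 1 y1 x * y2 x)%C 0 x).
- cbv beta; rewrite v1, w1, v2, w2; ring.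
- intros z hz; assert (hz' := interval_between a 0 x z origin hx hz).
  eapply is_cderive_eq.
  + apply is_cderive_minus; apply is_cderive_mult.
    * now apply smooth_derive with a.
    * now apply d2.
    * now apply d1.
    * now apply smooth_derive with a.
  + fold y1 y2; ring.
Qed.

Lemma solution_regular (u : distribution a) :
  (forall f, is_test a f -> pairing a u (Lop q f) = RtoC 0) ->
  exists phi, smooth_on (interval a) phi /\ u = regular a phi /\
    exists c d : C, (forall x, phi x = (c * y1 x + d * y2 x)%C) /\
      phi 0 = c /\ nderiv 1 phi 0 = d.
Proof.
intros hu.
destruct sol1 as [S1 [v1 w1]], sol2 as [S2 [v2 w2]]; fold y1 in S1, v1, w1; fold y2 in S2, v2, w2.
destruct (distr_solution a q y1 y2 a_pos S1 S2 wronskian_one u hu) as [c [d e]].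
exists (fun x => c * y1 x + d * y2 x)%C; split; [|split; [exact e|exists c, d; split; [|split]]].
- apply smooth_on_plus; [apply open_interval| |];
    (apply smooth_on_mult; [apply open_interval|apply smooth_on_const|]);
    [exact (proj1 S1)|exact (proj1 S2)].
- reflexivity.
- rewrite v1, v2; ring.
- assert (h := is_cderive_plus _ _ _ _ _
    (is_cderive_scal c _ _ _ (smooth_derive a y1 0 (proj1 S1) origin))
    (is_cderive_scal d _ _ _ (smooth_derive a y2 0 (proj1 S2) origin))).
  rewrite (nderiv_1 _ _ _ h), w1, w2; ring.
Qed.

(** The distribution is a combination of y1 and y2 whose coefficients are the Cauchy data
    at 0. *)
Lemma solution_zero (u : distribution a) phi :
  (forall f, is_test a f -> pairing a u (Lop q f) = RtoC 0) ->
  u = regular a phi -> smooth_on (interval a) phi ->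
  phi 0 = RtoC 0 -> nderiv 1 phi 0 = RtoC 0 -> u = distr_zero a.
Proof.
intros hu e sphi p0 p1.
destruct (solution_regular u hu) as [psi [spsi [e' [c [d [epsi [s0 s1]]]]]]].
assert (eq : forall x, interval a x -> (psi x + - phi x)%C = RtoC 0).
{ apply regular_inj.
  - exact a_pos.
  - apply smooth_on_plus; [apply open_interval|exact spsi|].
    apply smooth_on_opp; [apply open_interval|exact sphi].
  - intros f hf.
    assert (c1 : ccont_I a psi) by (intros x hx; now apply smooth_on_ccont with (interval a)).
    assert (c2 : ccont_I a phi) by (intros x hx; now apply smooth_on_ccont with (interval a)).
    rewrite pairing_regular; auto.
    2:{ intros x hx; apply ccont_plus; [auto|apply ccont_opp; auto]. }
    rewrite (RI_ext _ (fun x => psi x * f x - phi x * f x)%C) by (intros; ring).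
    rewrite RI_minus; try (apply is_test_seg with a; now apply is_test_mult).
    rewrite <- !pairing_regular by auto; rewrite <- e, <- e'; ring. }
assert (eq' : forall x, interval a x -> psi x = phi x).
{ intros x hx; replace (psi x) with ((psi x + - phi x) + phi x)%C by ring.
  rewrite eq by exact hx; ring. }
assert (hc : c = RtoC 0) by (rewrite <- s0, eq', p0 by exact origin; reflexivity).
assert (hd : d = RtoC 0).
{ rewrite <- s1, <- p1; apply nderiv_ext_loc.
  eapply filter_imp; [|exact (open_interval a 0 origin)]; exact eq'. }
rewrite e'; apply distr_eq; intros f hf.
rewrite pairing_regular by (auto; intros x hx; now apply smooth_on_ccont with (interval a)).
rewrite (RI_ext _ (fun _ => RtoC 0)); [apply RI_zero|].
intros x _; rewrite epsi, hc, hd; ring.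
Qed.

Lemma monomial_data k :
  exists Gam, smooth_on everywhere (fun x => RtoC (x ^ k)) /\
    (forall x, is_cderive Gam x (RtoC (x ^ k))) /\
    ((2 <= k)%nat -> RtoC (0 ^ k) = RtoC 0 /\ nderiv 1 (fun x => RtoC (x ^ k)) 0 = RtoC 0).
Proof.
assert (hk : INR (S k) <> 0) by (apply not_0_INR; lia).
exists (fun x => RtoC (/ INR (S k)) * RtoC (x ^ S k))%C; split; [|split].
- apply smooth_on_pow, open_everywhere.
- intros x; eapply is_cderive_eq; [apply is_cderive_scal, is_cderive_pow|].
  rewrite Cmult_assoc, <- RtoC_mult, Rinv_l by exact hk; ring.
- intros h2; destruct k as [|[|k]]; try lia; split.
  + simpl; now rewrite Rmult_0_l.
  + rewrite (nderiv_1 _ _ _ (is_cderive_pow (S k) 0)); simpl; rewrite Rmult_0_l; ring.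
Qed.

Lemma nderiv_pow1 : nderiv 1 (fun x => RtoC (x ^ 1)) 0 = RtoC 1.
Proof.
rewrite (nderiv_1 _ _ _ (is_cderive_pow 0 0)); simpl; ring.
Qed.

(** On the monomials F is determined by F(1) and F(x): F(x^k) solves
    y'' - q y = F((x^k)'') and has vanishing Cauchy data at 0 for k >= 2. *)
Lemma standard_transmutation_iff (F : distribution a -> distribution a) :
  linear_op F -> continuous_op F ->
  (transmutation q F /\ standard F) <->
  exists c1 c2 c3 c4 : C, forall u : distribution a,
    F u = distr_add (distr_scal c1 (T (P_even u)))
         (distr_add (distr_scal c2 (T (P_odd u)))
         (distr_add (distr_scal c3 (T (AP_even u)))
                   (distr_scal c4 (T (dderiv (P_odd u)))))).
Proof.
intros lF cF; rewrite transmutation_pairing by exact lF; split.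
- intros [tF sF].
  assert (low : forall k, (k < 2)%nat -> forall f, is_test a f ->
    pairing a (F (monomial a k)) (Lop q f) = RtoC 0).
  { intros k hk f hf; rewrite tF by exact hf.
    destruct (d2_monomial a k a_pos) as [c [j [e [->|hj]]]]; [|lia].
    rewrite e; unfold distr_scal.
    rewrite lF, linear_op_zero, pairing_distr_lin, pairing_distr_zero by exact lF; ring. }
  (* F(1) and F(x) are classical solutions; their Cauchy data at 0 are the coefficients. *)
  destruct (solution_regular _ (low 0%nat ltac:(lia))) as [phi0 [s0 [e0 [c1 [c3 [_ [v1 v3]]]]]]].
  destruct (solution_regular _ (low 1%nat ltac:(lia))) as [phi1 [s1 [e1 [c4 [c2 [_ [v4 v2]]]]]]].
  exists c1, c2, c3, c4.
  apply op_eq_of_monomials; auto using linear_comb, continuous_comb.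
  assert (tG := transmutation_comb c1 c2 c3 c4).
  assert (lG := linear_comb c1 c2 c3 c4).
  assert (rG := comb_regular c1 c2 c3 c4).
  set (G := fun u => distr_add (distr_scal c1 (T (P_even u)))
    (distr_add (distr_scal c2 (T (P_odd u))) (distr_add (distr_scal c3 (T (AP_even u)))
      (distr_scal c4 (T (dderiv (P_odd u))))))) in *.
  assert (key : forall k, F (monomial a k) = G (monomial a k)); [|exact key].
  intros k; induction k as [k IH] using (well_founded_induction Wf_nat.lt_wf).
  destruct (monomial_data k) as [Gam [sg [dG hk]]].
  destruct (rG _ Gam sg dG) as [psi [spsi [epsi [psi0 psi1]]]].
  assert (eF : exists phi, smooth_on (interval a) phi /\ F (monomial a k) = regular a phi /\
    phi 0 = psi 0 /\ nderiv 1 phi 0 = nderiv 1 psi 0).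
  { rewrite psi0, psi1; destruct k as [|[|k]].
    - exists phi0; split; [exact s0|split; [exact e0|]].
      assert (d0 : nderiv 1 (fun x => RtoC (x ^ 0)) 0 = RtoC 0)
        by exact (nderiv_1 _ _ _ (is_cderive_const (RtoC 1) 0)).
      rewrite v1, v3, d0; simpl.
      split; ring.
    - exists phi1; split; [exact s1|split; [exact e1|]].
      rewrite v4, v2, nderiv_pow1; simpl; rewrite Rmult_0_l; split; ring.
    - destruct (sF (S (S k))) as [phi [sphi [ephi [p0 p1]]]]; [lia|].
      destruct hk as [hk0 hk1]; [lia|].
      exists phi; split; [exact sphi|split; [exact ephi|]].
      rewrite p0, p1, hk0, hk1; split; ring. }
  destruct eF as [phi [sphi [ephi [p0 p1]]]].
  assert (z : distr_sub (F (monomial a k)) (G (monomial a k)) = distr_zero a).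
  { apply solution_zero with (fun x => phi x + - psi x)%C.
    - intros f hf; rewrite pairing_distr_sub, tF, tG by exact hf.
      destruct (d2_monomial a k a_pos) as [c [j [e hj]]]; rewrite e.
      unfold distr_scal; rewrite lF, lG, (linear_op_zero a F lF), (linear_op_zero a G lG).
      rewrite !pairing_distr_lin.
      destruct hj as [->|hj]; [ring|rewrite IH by lia; ring].
    - apply distr_eq; intros f hf.
      assert (cphi : ccont_I a phi) by (intros x hx; now apply smooth_on_ccont with (interval a)).
      assert (cpsi : ccont_I a psi) by (intros x hx; now apply smooth_on_ccont with (interval a)).
      unfold monomial in ephi |- *.
      rewrite pairing_distr_sub, ephi, epsi, !pairing_regular; auto.
      + rewrite <- RI_minus; try (apply is_test_seg with a; now apply is_test_mult).
        apply RI_ext; intros; ring.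
      + intros x hx; apply ccont_plus; [auto|apply ccont_opp; auto].
    - apply smooth_on_plus; [apply open_interval|exact sphi|].
      apply smooth_on_opp; [apply open_interval|exact spsi].
    - rewrite p0; ring.
    - assert (h := is_cderive_plus _ _ _ _ _ (smooth_derive a phi 0 sphi origin)
        (is_cderive_opp _ _ _ (smooth_derive a psi 0 spsi origin))).
      rewrite (nderiv_1 _ _ _ h), p1; ring. }
  apply distr_eq; intros f hf.
  assert (zf := f_equal (fun u => pairing a u f) z); cbv beta in zf.
  rewrite pairing_distr_sub, pairing_distr_zero in zf.
  replace (pairing a (F (monomial a k)) f) with
    ((pairing a (F (monomial a k)) f - pairing a (G (monomial a k)) f)
     + pairing a (G (monomial a k)) f)%C by ring.
  rewrite zf; ring.
- intros [c1 [c2 [c3 [c4 h]]]]; split.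
  + intros u f hf; rewrite !h; now apply transmutation_comb.
  + intros k hk.
    destruct (monomial_data k) as [Gam [sg [dG hk']]]; destruct (hk' hk) as [k0 k1].
    destruct (comb_regular c1 c2 c3 c4 _ Gam sg dG) as [psi [spsi [epsi [psi0 psi1]]]].
    exists psi; split; [exact spsi|split; [rewrite h; exact epsi|]].
    rewrite psi0, psi1, k0, k1; split; ring.
Qed.

End Main.

Theorem proposition29 :
  forall (a : R), 0 < a ->
  forall (q : R -> C), smooth_on (interval a) q ->
  forall (H : R -> R -> C), goursat_solution a q H ->
  forall (F : distribution a -> distribution a), linear_op F -> continuous_op F ->
  let T : distribution a -> distribution a := T_op (kernel H) in
  (transmutation q F /\ standard F) <->
  exists c1 c2 c3 c4 : C, forall u : distribution a,
    F u = distr_add (distr_scal c1 (T (P_even u)))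
         (distr_add (distr_scal c2 (T (P_odd u)))
         (distr_add (distr_scal c3 (T (AP_even u)))
                   (distr_scal c4 (T (dderiv (P_odd u)))))).
Proof.
intros a a_pos q q_smooth H H_goursat F lF cF.
exact (standard_transmutation_iff a q H a_pos q_smooth H_goursat F lF cF).
Qed.
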